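(* Let $\boldsymbol{M}$ be a weight sequence satisfying $\operatorname{(sm)}$ and $(p!)_p\subset\boldsymbol{M}$, and let $\boldsymbol{A}$ be a sequence satisfying $\operatorname{(nq)}$ and such that $\widehat{\boldsymbol{A}}$ is a weight sequence. Then the following statements are equivalent: (i) $\displaystyle\sum_{p=0}^\infty \frac{1}{m_p^{1/2}}=\infty$. (ii) $\mathcal{B}\colon\mathcal{A}_{\{\boldsymbol{M}_{+1}\}}(\mathbb{H})\to\Lambda_{\{\boldsymbol{M}_{+1}\}}$ is injective. (iii) $\mathcal{M}\colon C_{\{\boldsymbol{M}\}}(0,\infty)\to\Lambda_{\{\boldsymbol{M}_{+1}\}}$ is injective. (iv) $\mathcal{M}\colon\mathcal{S}_{\{\boldsymbol{M}\}}(0,\infty)\to\Lambda_{\{\boldsymbol{M}_{+1}\}}$ is injective. (v) $\mathcal{M}\colon\mathcal{S}^{\{\widehat{\boldsymbol{A}}\}}_{\{\boldsymbol{M}\}}(0,\infty)\to\Lambda_{\{\boldsymbol{M}_{+1}\}}$ is injective.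
   Context: All sequences are sequences of positive real numbers indexed by $\mathbb{N}_0=\{0,1,2,\dots\}$; for a sequence $\boldsymbol{M}=(M_p)_p$ (with $M_0=1$) the quotients are $m_p=M_{p+1}/M_p$. $\boldsymbol{M}$ is a weight sequence if $M_p^2\le M_{p-1}M_{p+1}$ for $p\ge1$ and $m_p\to\infty$. $\operatorname{(sm)}$: there are $C_0>0$, $H>1$ with $\log(m_{p+1}/m_p)\le C_0H^{p+1}$ for all $p\in\mathbb{N}_0$. $\operatorname{(nq)}$: $\sum_{p\ge0}1/((p+1)a_p)<\infty$ (for $\boldsymbol{A}$ with quotients $a_p$). $\widehat{\boldsymbol{A}}=(p!A_p)_p$, $\boldsymbol{M}_{+1}=(M_{p+1})_p$. $(p!)_p\subset\boldsymbol{M}$ means $p!\le Ch^pM_p$ for all $p$ and some $C,h>0$. $\mathbb{H}$ is the open upper half-plane. For a sequence $\boldsymbol{N}$ and $h>0$, $\mathcal{A}_{\boldsymbol{N},h}(\mathbb{H})$ is the space of holomorphic $f$ on $\mathbb{H}$ with $\sup_{p\in\mathbb{N}_0}\sup_{z\in\mathbb{H}}|f^{(p)}(z)|/(h^pN_p)<\infty$, and $\mathcal{A}_{\{\boldsymbol{N}\}}(\mathbb{H})=\bigcup_{h>0}\mathcal{A}_{\boldsymbol{N},h}(\mathbb{H})$; each such $f$ and all its derivatives extend continuously to $\overline{\mathbb{H}}$, and $f^{(p)}(0)$ denotes the value of this extension at $0$. $\Lambda_{\{\boldsymbol{N}\}}$ is the space of complex sequences $(c_p)_p$ with $\sup_p|c_p|/(h^pN_p)<\infty$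 for some $h>0$. The Borel map is $\mathcal{B}(f)=(f^{(p)}(0))_p$. $C_{\{\boldsymbol{M}\}}(0,\infty)$ is the space of continuous $\varphi$ on $(0,\infty)$ with $\sup_{p}\sup_{x>0}x^p|\varphi(x)|/(h^pM_p)<\infty$ for some $h>0$. $\mathcal{S}_{\{\boldsymbol{M}\}}(0,\infty)$ is the space of $\varphi\in C^\infty(\mathbb{R})$ with support in $[0,\infty)$ for which there is $h>0$ with $\sup_p\sup_{x\in\mathbb{R}}|x^p\varphi^{(q)}(x)|/(h^pM_p)<\infty$ for every $q\in\mathbb{N}_0$. $\mathcal{S}^{\{\widehat{\boldsymbol{A}}\}}_{\{\boldsymbol{M}\}}(0,\infty)$ is the space of $\varphi\in C^\infty(\mathbb{R})$ with support in $[0,\infty)$ for which there is $h>0$ with $\sup_{p,q}\sup_{x}|x^p\varphi^{(q)}(x)|/(h^{p+q}M_pq!A_q)<\infty$. The moment map is $\mathcal{M}(\varphi)=(\mu_p(\varphi))_p$, $\mu_p(\varphi)=\int_0^\infty x^p\varphi(x)\,dx$ (defined on these spaces, viewing elements of the last two as functions on $(0,\infty)$). *)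

(* Defs.v *)
From Stdlib Require Import Reals Factorial.
From Coquelicot Require Import Coquelicot.
Open Scope R_scope.

Definition quot (M : nat -> R) (p : nat) : R := M (S p) / M p.

Definition pos_seq (M : nat -> R) : Prop := M 0%nat = 1 /\ forall p, 0 < M p.

Definition weight_seq (M : nat -> R) : Prop :=
  pos_seq M /\
  (forall p, (1 <= p)%nat -> M p ^ 2 <= M (p - 1)%nat * M (S p)) /\
  is_lim_seq (quot M) p_infty.

Definition cond_sm (M : nat -> R) : Prop :=
  exists C0 H, 0 < C0 /\ 1 < H /\
    forall p, ln (quot M (S p) / quot M p) <= C0 * H ^ (S p).

Definition cond_nq (A : nat -> R) : Prop :=
  ex_series (fun p => / (INR (S p) * quot A p)).

Definition fact_incl (M : nat -> R) : Prop :=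
  exists C h, 0 < C /\ 0 < h /\ forall p, INR (fact p) <= C * h ^ p * M p.

Definition hat (A : nat -> R) (p : nat) : R := INR (fact p) * A p.

Definition shift1 (M : nat -> R) (p : nat) : R := M (S p).

Definition UHP (z : C) : Prop := 0 < Im z.

Definition cderiv_tower (f : C -> C) (F : nat -> C -> C) : Prop :=
  forall z, UHP z -> F 0%nat z = f z /\ forall p, is_derive (F p) z (F (S p) z).

Definition A_Nh (N : nat -> R) (h : R) (f : C -> C) : Prop :=
  exists F, cderiv_tower f F /\
    exists K, forall p z, UHP z -> Cmod (F p z) <= K * h ^ p * N p.

Definition A_N (N : nat -> R) (f : C -> C) : Prop := exists h, 0 < h /\ A_Nh N h f.

(* Borel map: c = (f^{(p)}(0))_p, the values at 0 of the continuous extensions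
   of the derivatives to the closed half-plane, i.e. their limits at 0 within H. *)
Definition borel_is (f : C -> C) (c : nat -> C) : Prop :=
  exists F, cderiv_tower f F /\
    forall p, filterlim (F p) (within UHP (locally (0 : C))) (locally (c p)).

Definition borel_injective (N : nat -> R) : Prop :=
  forall f g c, A_N N f -> A_N N g -> borel_is f c -> borel_is g c ->
    forall z, UHP z -> f z = g z.

Definition moment_is (phi : R -> C) (p : nat) (l : C) : Prop :=
  is_RInt_gen (fun x => scal (x ^ p) (phi x)) (at_right 0) (Rbar_locally p_infty) l.

Definition C_M (M : nat -> R) (phi : R -> C) : Prop :=
  (forall x, 0 < x -> continuous phi x) /\
  exists h K, 0 < h /\ forall p x, 0 < x -> x ^ p * Cmod (phi x) <= K * h ^ p * M p.

Definition rderiv_tower (phi : R -> C) (Phi : nat -> R -> C) : Prop :=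
  (forall x, Phi 0%nat x = phi x) /\ forall q x, is_derive (Phi q) x (Phi (S q) x).

Definition S_M (M : nat -> R) (phi : R -> C) : Prop :=
  (forall x, x < 0 -> phi x = 0) /\
  exists Phi, rderiv_tower phi Phi /\
    exists h, 0 < h /\ forall q, exists K,
      forall p x, Rabs (x ^ p) * Cmod (Phi q x) <= K * h ^ p * M p.

Definition S_BM (B M : nat -> R) (phi : R -> C) : Prop :=
  (forall x, x < 0 -> phi x = 0) /\
  exists Phi, rderiv_tower phi Phi /\
    exists h K, 0 < h /\
      forall p q x, Rabs (x ^ p) * Cmod (Phi q x) <= K * h ^ (p + q) * M p * B q.

Definition moment_injective (Sp : (R -> C) -> Prop) : Prop :=
  forall phi psi, Sp phi -> Sp psi ->
    (forall p, exists l, moment_is phi p l /\ moment_is psi p l) ->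
    forall x, 0 < x -> phi x = psi x.

(* Main.v *)
Require Import Defs.
From Stdlib Require Import Reals Lra Lia Psatz.
From Coquelicot Require Import Coquelicot.
Open Scope R_scope.

(** (i) => (ii).  Let [f] be flat at 0 and put [F u = f (i u)] on the right half-plane.  The transforms
    [G_p t = RInt_(Re w = c) e^(tw) w^-1 F^(p)(1/w) dw] satisfy [(t G_p')' = G_(p+1)].  With
    [t = s^2/4] this is the radial system [g_p' = h_p], [(s h_p)' = s g_(p+1)], to which Bang's proof
    of the Denjoy-Carleman theorem applies: [|G_p| <= C h^p M_(p+2)] locally, so the orders [2p] and
    [2p+1] each contribute [m_(p+2)^(-1/2)], and divergence of the sum forces [G_0 = 0] on [[0,oo)].
    On [(-oo,0]] it vanishes because the line of integration can be moved to [c = +oo].  Fourier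
    uniqueness on each line [Re w = c] then gives [F = 0].

    (ii) => (iii).  The Laplace transform of the difference of two functions with the same moments is
    flat at 0; (sm) is what keeps it in the class of [M_(+1)].

    (v) => (i).  If the sum converges, an infinite convolution of boxes of widths [m_p^(-1/2)], each
    used twice, produces a bump [rho] supported away from 0 with [|rho^(2p)| <= C 4^p M_p].  Then
    [phi x = RInt rho(s) sin(s sqrt x) ds] satisfies [x^p |phi x| <= C 4^p M_p], and by Fourier
    inversion its moments are multiples of [rho^(2p+1)(0) = 0].  A further convolution with boxes of
    widths [1 / (lam (p+1) a_p)], summable by (nq), makes [phi] ultradifferentiable and preserves
    the vanishing of the moments. *)

(** Bang's argument applied to [f] along a ray would only see the divergence of the sum of
    [1 / m_p]. The square root comes from the half-plane. Flatness at 0 makes [F p (/ w)] decay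
    faster than any power of [/ w] on the lines [Re w = c], so the transforms converge, and one
    differentiation of [F] becomes an operator of order two in [s]: each quotient is shared by two
    orders. Vanishing for [t <= 0] supplies the zero initial data at [s = 0]. The converse mirrors
    this: [M p] controls order [2 p] of the bump, whence each box width occurs twice.

    No contour integration is used. Integrals are real, taken of a real or imaginary part, and a
    free complex multiplier recovers the complex statement. Moving a line means differentiating in
    [c] under the integral sign. Fourier uniqueness rests on Poisson kernels, and the inversion
    behind the vanishing moments is replaced by an explicit primitive that tends to 0 at infinity.

    Averaging over a box preserves vanishing moments because it is a difference quotient of a
    primitive, whose moments vanish too by integration by parts. *)

(** * Dominated integrals over the line *)

(* Domination by [K / (1 + y^2)] makes every integral over the line below absolutely convergent. *)
Definition dom (K : R) (f : R -> R) : Prop :=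
  (forall y, continuous f y) /\ forall y, Rabs (f y) <= K / (1 + y ^ 2).

(** Improper integral along the windows [[-n, n]]. [Lim_seq] and [real] are total, so the value is
    meaningful only under [dom]. *)
Definition rint (f : R -> R) : R :=
  real (Lim_seq (fun n => RInt f (- INR n) (INR n))).

Lemma one_plus_sq_pos (y : R) : 0 < 1 + y ^ 2.
Proof. generalize (pow2_ge_0 y); lra. Qed.

(** Sign conditions by recursion on the expression. Linear arithmetic is tried early, so the tactic
    is also called on equations that hold after rearrangement. *)
Ltac pos :=
  first
    [ assumption | lra | solve [auto] |
      lazymatch goal with
      | |- _ >= _ => apply Rle_ge; pos
      | |- _ > _ => apply Rlt_gt; pos
      | |- _ <> 0 => apply Rgt_not_eq; pos
      | |- 0 < 1 + _ ^ 2 => apply one_plus_sq_pos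
      | |- 0 < _ + _ => first [apply Rplus_lt_le_0_compat; pos | apply Rplus_le_lt_0_compat; pos]
      | |- 0 < _ * _ => apply Rmult_lt_0_compat; pos
      | |- 0 < / _ => apply Rinv_0_lt_compat; pos
      | |- 0 < _ / _ => apply Rdiv_lt_0_compat; pos
      | |- 0 < _ ^ _ => apply pow_lt; pos
      | |- 0 < exp _ => apply exp_pos
      | |- 0 < sqrt _ => apply sqrt_lt_R0; pos
      | |- 0 < PI => apply PI_RGT_0
      | |- 0 < Rmin _ _ => apply Rmin_pos; pos
      | |- 0 <= _ + _ => apply Rplus_le_le_0_compat; pos
      | |- 0 <= _ * _ => apply Rmult_le_pos; pos
      | |- 0 <= _ / _ => apply Rdiv_le_0_compat; pos
      | |- 0 <= _ ^ 2 => apply pow2_ge_0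
      | |- 0 <= _ ^ _ => apply pow_le; pos
      | |- 0 <= Cmod _ => apply Cmod_ge_0
      | |- 0 <= Rabs _ => apply Rabs_pos
      | |- 0 <= INR _ => apply pos_INR
      | |- 0 <= sqrt _ => apply sqrt_pos
      | |- 0 <= _ => left; pos
      end ].

Ltac mono :=
  first
    [ assumption | lra | solve [auto] |
      lazymatch goal with
      | |- ?a * _ <= ?a * _ => apply Rmult_le_compat_l; [pos | mono]
      | |- _ * ?a <= _ * ?a => apply Rmult_le_compat_r; [pos | mono]
      | |- ?a * _ < ?a * _ => apply Rmult_lt_compat_l; [pos | mono]
      | |- _ * ?a < _ * ?a => apply Rmult_lt_compat_r; [pos | mono]
      | |- _ * _ <= _ * _ => apply Rmult_le_compat; [pos | pos | mono | mono]
      | |- _ / _ <= _ / _ => unfold Rdiv; mono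
      | |- _ + _ <= _ + _ => apply Rplus_le_compat; mono
      | |- / _ <= / _ => apply Rinv_le_contravar; [pos | mono]
      | |- _ ^ ?n <= _ ^ ?n => apply pow_incr; split; [pos | mono]
      | |- exp _ < exp _ => apply exp_increasing; mono
      end ].

Lemma continuous_derive (f : R -> R) (x l : R) : is_derive f x l -> continuous f x.
Proof. intro H. apply (@ex_derive_continuous R_AbsRing R_NormedModule). now exists l. Qed.

Lemma is_RInt_cauchy (K a b : R) :
  is_RInt (fun y => K / (1 + y ^ 2)) a b (K * (atan b - atan a)).
Proof.
  replace (K * (atan b - atan a)) with (minus (K * atan b) (K * atan a))
    by (unfold minus, plus, opp; simpl; ring).
  apply (@is_RInt_derive R_CompleteNormedModule (fun y => K * atan y)).
  - intros y _. generalize (one_plus_sq_pos y); intro Hy. auto_derive; [easy|]. simpl. pos.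
  - intros y _. generalize (one_plus_sq_pos y); intro Hy.
    apply (continuous_derive _ _ (- K * (2 * y) / (1 + y ^ 2) ^ 2)).
    auto_derive; simpl in *; [lra|]. field. lra.
Qed.

Lemma continuous_mulR (f g : R -> R) (x : R) :
  continuous f x -> continuous g x -> continuous (fun y => f y * g y) x.
Proof. apply (@continuous_mult R_UniformSpace R_AbsRing). Qed.

Lemma continuous_exp (x : R) : continuous exp x.
Proof. apply (continuous_derive _ _ (exp x)), is_derive_Reals, derivable_pt_lim_exp. Qed.

Lemma cauchy_weight_ge_0 (y : R) : 0 <= / (1 + y ^ 2).
Proof. left. pos. Qed.

Lemma ex_RInt_cont (f : R -> R) (a b : R) : (forall y, continuous f y) -> ex_RInt f a b.
Proof. intro H. apply (@ex_RInt_continuous R_CompleteNormedModule). auto. Qed.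

Lemma dom_pos K f : dom K f -> 0 <= K.
Proof.
  intros [_ H]. generalize (H 0) (Rabs_pos (f 0)). pos.
Qed.

Lemma dom_RInt_le (K : R) (f : R -> R) (a b : R) :
  dom K f -> a <= b -> Rabs (RInt f a b) <= K * (atan b - atan a).
Proof.
  intros [Hc Hb] Hab.
  apply (norm_RInt_le f (fun y => K / (1 + y ^ 2)) a b); auto.
  - now apply (@RInt_correct R_CompleteNormedModule), ex_RInt_cont.
  - apply is_RInt_cauchy.
Qed.

Lemma atan_le_id x : 0 <= x -> atan x <= x.
Proof.
  intro Hx. destruct (Req_dec x 0) as [->|Hn]; [rewrite atan_0; lra|].
  destruct (MVT_gen atan 0 x (fun y => / (1 + y ^ 2))) as [c [_ Hc]].
  - intros y _. generalize (one_plus_sq_pos y); intro. auto_derive; [easy|]. simpl in *. field. lra.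
  - intros y _. apply continuity_pt_filterlim, (continuous_derive _ _ (/ (1 + y ^ 2))).
    generalize (one_plus_sq_pos y); intro. auto_derive; [easy|]. simpl in *. field. lra.
  - rewrite atan_0 in Hc.
    assert (/ (1 + c ^ 2) <= 1).
    { rewrite <- Rinv_1. apply Rinv_le_contravar; [lra|]. nra. }
    nra.
Qed.

(** Since [K * atan] is a primitive of the dominating function, this is the rate at which tails of
    dominated integrals decay. *)
Lemma atan_tail x : 0 < x -> PI / 2 - atan x <= / x.
Proof.
  intro Hx. rewrite <- atan_inv by easy. apply atan_le_id. pos.
Qed.

Lemma RInt_sum3 (f : R -> R) (a b c d : R) : (forall y, continuous f y) ->
  RInt f a d = RInt f a b + RInt f b c + RInt f c d.
Proof.
  intro H. assert (E := fun a b => ex_RInt_cont f a b H).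
  rewrite <- (RInt_Chasles f a c d) by auto. rewrite <- (RInt_Chasles f a b c) by auto. easy.
Qed.

(** Convergence by monotonicity: [K / (1 + y^2) - f] lies between 0 and [2 K / (1 + y^2)], so its
    window integrals increase and stay below [2 K PI]. Those of [K / (1 + y^2)] tend to [K PI], and
    [f] is the difference. *)
Lemma rint_lim (K : R) (f : R -> R) :
  dom K f -> is_lim_seq (fun n => RInt f (- INR n) (INR n)) (rint f).
Proof.
  intros Hd. unfold rint. apply Lim_seq_correct'.
  destruct Hd as [Hc Hb].
  assert (Hg : forall y, continuous (fun y => K / (1 + y ^ 2) - f y) y).
  { intro y. apply @continuous_minus; [|apply Hc].
    generalize (one_plus_sq_pos y); intro Hy.
    apply (continuous_derive _ _ (- K * (2 * y) / (1 + y ^ 2) ^ 2)).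
    auto_derive; simpl in *; [lra|]. field. lra. }
  assert (Hp : forall y, 0 <= K / (1 + y ^ 2) - f y).
  { intro y. generalize (Hb y) (Rle_abs (f y)); lra. }
  assert (H1 : ex_finite_lim_seq (fun n => RInt (fun y => K / (1 + y ^ 2) - f y) (- INR n) (INR n))).
  { apply ex_finite_lim_seq_incr with (M := 2 * K * PI).
    - intro n. rewrite (RInt_sum3 _ (- INR (S n)) (- INR n) (INR n) (INR (S n))) by easy.
      rewrite S_INR.
      assert (0 <= RInt (fun y => K / (1 + y ^ 2) - f y) (- (INR n + 1)) (- INR n)).
      { apply RInt_ge_0; [lra|now apply ex_RInt_cont|auto]. }
      assert (0 <= RInt (fun y => K / (1 + y ^ 2) - f y) (INR n) (INR n + 1)).
      { apply RInt_ge_0; [lra|now apply ex_RInt_cont|auto]. }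
      lra.
    - intro n.
      assert (HK : 0 <= K) by (apply (dom_pos K f); split; auto).
      apply Rle_trans with (RInt (fun y => 2 * K / (1 + y ^ 2)) (- INR n) (INR n)).
      + apply RInt_le; [generalize (pos_INR n); lra|now apply ex_RInt_cont| |].
        * eexists; apply is_RInt_cauchy.
        * intros y _. generalize (Hb y). unfold Rabs; destruct Rcase_abs; unfold Rdiv; lra.
      + rewrite (is_RInt_unique _ _ _ _ (is_RInt_cauchy (2 * K) (- INR n) (INR n))).
        apply Rmult_le_compat_l; [lra|]. generalize (atan_bound (INR n)) (atan_bound (- INR n)). lra. }
  destruct H1 as [l Hl].
  assert (H2 : is_lim_seq (fun n => K * (atan (INR n) - atan (- INR n))) (K * PI)).
  { apply (is_lim_seq_scal_l _ K PI).
    apply is_lim_seq_ext with (fun n => 2 * atan (INR n)).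
    - intro n. rewrite atan_opp. ring.
    - replace (Finite PI) with (Rbar_mult 2 (PI / 2)) by (simpl; f_equal; field).
      apply is_lim_seq_scal_l.
      apply is_lim_seq_le_le_loc with (fun n => PI / 2 - / INR n) (fun _ => PI / 2).
      + exists 1%nat. intros n Hn. split.
        * generalize (atan_tail (INR n)). assert (0 < INR n) by (apply lt_0_INR; lia). lra.
        * generalize (atan_bound (INR n)); lra.
      + replace (Finite (PI / 2)) with (Rbar_minus (PI / 2) 0) by (simpl; f_equal; ring).
        apply is_lim_seq_minus'; [apply is_lim_seq_const|].
        apply (is_lim_seq_inv _ p_infty); [apply is_lim_seq_INR|easy].
      + apply is_lim_seq_const. }
  exists (K * PI - l).
  apply is_lim_seq_ext with
    (fun n => K * (atan (INR n) - atan (- INR n)) - RInt (fun y => K / (1 + y ^ 2) - f y) (- INR n) (INR n)).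
  - intro n. rewrite (RInt_minus (fun y => K / (1 + y ^ 2)) f).
    + rewrite (is_RInt_unique _ _ _ _ (is_RInt_cauchy K (- INR n) (INR n))).
      unfold minus, plus, opp; simpl. ring.
    + eexists; apply is_RInt_cauchy.
    + now apply ex_RInt_cont.
  - now apply is_lim_seq_minus'.
Qed.

Lemma rint_unique (K : R) (f : R -> R) (l : R) :
  dom K f -> is_lim_seq (fun n => RInt f (- INR n) (INR n)) l -> rint f = l.
Proof.
  intros Hd Hl. generalize (is_lim_seq_unique _ _ (rint_lim K f Hd)) (is_lim_seq_unique _ _ Hl).
  intros H1 H2. rewrite H1 in H2. now injection H2.
Qed.

Lemma rint_ext (f g : R -> R) : (forall y, f y = g y) -> rint f = rint g.
Proof.
  intro H. unfold rint. f_equal. apply Lim_seq_ext. intro n. apply RInt_ext. auto.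
Qed.

Lemma dom_ext K f g : (forall y, f y = g y) -> dom K f -> dom K g.
Proof.
  intros H [Hc Hb]. split.
  - intro y. apply continuous_ext with f; auto.
  - intro y. rewrite <- H. auto.
Qed.

Lemma dom_le K K' f : K <= K' -> dom K f -> dom K' f.
Proof.
  intros HK [Hc Hb]. split; auto. intro y. apply Rle_trans with (1 := Hb y).
  mono.
Qed.

Lemma dom_plus K1 K2 f g : dom K1 f -> dom K2 g -> dom (K1 + K2) (fun y => f y + g y).
Proof.
  intros [Hc Hb] [Hc' Hb']. split.
  - intro y. now apply @continuous_plus.
  - intro y. apply Rle_trans with (1 := Rabs_triang _ _). unfold Rdiv. rewrite Rmult_plus_distr_r.
    mono.
Qed.

Lemma dom_scal K c f : dom K f -> dom (Rabs c * K) (fun y => c * f y).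
Proof.
  intros [Hc Hb]. split.
  - intro y. apply (@continuous_scal_r R_UniformSpace R_AbsRing R_NormedModule c f y). auto.
  - intro y. rewrite Rabs_mult. unfold Rdiv. rewrite Rmult_assoc.
    mono.
Qed.

Lemma dom_minus K1 K2 f g : dom K1 f -> dom K2 g -> dom (K1 + K2) (fun y => f y - g y).
Proof.
  intros H1 H2. apply dom_ext with (fun y => f y + (-1) * g y). { intro; ring. }
  apply dom_plus; auto. replace K2 with (Rabs (-1) * K2). { now apply dom_scal. }
  rewrite Rabs_left by lra. ring.
Qed.

Lemma rint_plus K1 K2 f g : dom K1 f -> dom K2 g -> rint (fun y => f y + g y) = rint f + rint g.
Proof.
  intros H1 H2. apply rint_unique with (K1 + K2). { now apply dom_plus. }
  apply is_lim_seq_ext with (fun n => RInt f (- INR n) (INR n) + RInt g (- INR n) (INR n)).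
  - intro n. rewrite (RInt_plus f g); [easy| |]; apply ex_RInt_cont; [apply H1|apply H2].
  - apply is_lim_seq_plus'; [apply (rint_lim K1)|apply (rint_lim K2)]; auto.
Qed.

Lemma rint_scal K c f : dom K f -> rint (fun y => c * f y) = c * rint f.
Proof.
  intros H1. apply rint_unique with (Rabs c * K). { now apply dom_scal. }
  apply is_lim_seq_ext with (fun n => c * RInt f (- INR n) (INR n)).
  - intro n. rewrite (RInt_scal f); [easy|]. apply ex_RInt_cont; apply H1.
  - apply (is_lim_seq_scal_l _ c (rint f)). now apply (rint_lim K1) || apply (rint_lim K).
Qed.

Lemma rint_minus K1 K2 f g : dom K1 f -> dom K2 g -> rint (fun y => f y - g y) = rint f - rint g.
Proof.
  intros H1 H2. transitivity (rint (fun y => f y + (-1) * g y)). { apply rint_ext; intro; ring. }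
  rewrite (rint_plus K1 (Rabs (-1) * K2)); auto using dom_scal.
  rewrite (rint_scal K2); auto. ring.
Qed.

Lemma rint_bound K f : dom K f -> Rabs (rint f) <= K * PI.
Proof.
  intro H.
  assert (HL := is_lim_seq_abs _ _ (rint_lim K f H)).
  apply (is_lim_seq_le _ _ _ _) with (2 := HL) (3 := is_lim_seq_const (K * PI)).
  intro n. apply Rle_trans with (1 := dom_RInt_le K f (- INR n) (INR n) H ltac:(generalize (pos_INR n); lra)).
  apply Rmult_le_compat_l; [now apply dom_pos with f|].
  generalize (atan_bound (INR n)) (atan_bound (- INR n)). lra.
Qed.

(** The windows are neither symmetric nor bounded by integers: translation of the variable requires
    the first freedom, the real cut-offs of [moment_is] the second. *)
Lemma rint_tail K f (X : R) : dom K f -> 0 < X -> forall a b, a <= - X -> X <= b ->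
  Rabs (rint f - RInt f a b) <= 2 * K / X.
Proof.
  intros H HX a b Ha Hb.
  assert (HK := dom_pos _ _ H).
  assert (HL : is_lim_seq (fun n => Rabs (RInt f (- INR n) (INR n) - RInt f a b)) (Rabs (rint f - RInt f a b))).
  { apply (is_lim_seq_abs _ (Finite (rint f - RInt f a b))).
    apply is_lim_seq_minus'; [now apply (rint_lim K)|apply is_lim_seq_const]. }
  apply (is_lim_seq_le_loc _ _ (Finite (Rabs (rint f - RInt f a b))) (Finite (2 * K / X)))
   with (2 := HL) (3 := is_lim_seq_const (2 * K / X)).
  destruct (nfloor_ex (Rabs a + Rabs b)) as [N [_ HN]]. { pos. }
  exists (S N). intros n Hn.
  assert (Hn' : INR N + 1 <= INR n) by (rewrite <- S_INR; now apply le_INR).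
  assert (b <= INR n) by (generalize (Rle_abs b) (Rabs_pos a); lra).
  assert (- INR n <= a) by (generalize (Rle_abs (- a)) (Rabs_pos b); rewrite Rabs_Ropp; lra).
  rewrite (RInt_sum3 f (- INR n) a b (INR n)) by apply H.
  replace (RInt f (- INR n) a + RInt f a b + RInt f b (INR n) - RInt f a b)
    with (RInt f (- INR n) a + RInt f b (INR n)) by ring.
  apply Rle_trans with (1 := Rabs_triang _ _).
  apply dom_RInt_le with (1 := H) in H1. apply dom_RInt_le with (1 := H) in H0. rename H0 into H2.
  assert (HT := atan_tail X HX).
  assert (atan a <= - atan X).
  { rewrite <- atan_opp. destruct (Req_dec a (- X)) as [->|]; [lra|]. left. apply atan_increasing. lra. }
  assert (atan X <= atan b).
  { destruct (Req_dec X b) as [->|]; [lra|]. left. apply atan_increasing. lra. }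
  generalize (atan_bound (INR n)) (atan_bound (- INR n)); intros.
  replace (2 * K / X) with (K * / X + K * / X) by (field; lra).
  apply Rplus_le_compat.
  - nra.
  - nra.
Qed.

(** Integrations by parts over the line reduce to this: [|F y| <= C / |y|] removes the boundary
    terms at [-n] and [n]. *)
Lemma rint_derive K C (F f : R -> R) : dom K f -> (forall y, is_derive F y (f y)) ->
  (forall y, Rabs (F y) * Rabs y <= C) -> rint f = 0.
Proof.
  intros H HF HC. apply rint_unique with K; auto.
  assert (HC0 : 0 <= C). { generalize (HC 0). rewrite Rabs_R0. lra. }
  apply is_lim_seq_abs_0.
  apply is_lim_seq_le_le_loc with (fun _ => 0) (fun n => (2 * C) * / INR n).
  - exists 1%nat. intros n Hn. split; [apply Rabs_pos|].
    assert (Hn' : 0 < INR n) by (apply lt_0_INR; lia).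
    rewrite (is_RInt_unique f _ _ (minus (F (INR n)) (F (- INR n)))).
    2:{ apply (@is_RInt_derive R_CompleteNormedModule F); intros; auto. apply H. }
    apply Rmult_le_reg_r with (INR n); auto.
    rewrite Rmult_assoc, Rinv_l, Rmult_1_r by lra.
    generalize (HC (INR n)) (HC (- INR n)). rewrite Rabs_Ropp. rewrite (Rabs_right (INR n)) by lra.
    unfold minus, plus, opp; simpl. generalize (Rabs_triang (F (INR n)) (- F (- INR n))).
    rewrite Rabs_Ropp. nra.
  - apply is_lim_seq_const.
  - replace (Finite 0) with (Rbar_mult (2 * C) 0) by (simpl; f_equal; ring).
    apply is_lim_seq_scal_l. apply (is_lim_seq_inv _ p_infty); [apply is_lim_seq_INR|easy].
Qed.

(** Two mean value steps instead of a Lagrange remainder, hence [D] where [D / 2] would be sharp. *)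
Lemma taylor2 (g g1 g2 : R -> R) (x e D : R) : 0 < e ->
  (forall s, Rabs (s - x) < e -> is_derive g s (g1 s) /\ is_derive g1 s (g2 s) /\ Rabs (g2 s) <= D) ->
  forall s, Rabs (s - x) < e -> Rabs (g s - g x - (s - x) * g1 x) <= D * (s - x) ^ 2.
Proof.
  intros He H s Hs.
  assert (HD : 0 <= D).
  { destruct (H x) as [_ [_ Hx]]. { rewrite Rminus_diag, Rabs_R0. lra. } generalize (Rabs_pos (g2 x)); lra. }
  assert (Hin : forall c, Rmin x s <= c <= Rmax x s -> Rabs (c - x) <= Rabs (s - x)).
  { intros c Hc. revert Hc. unfold Rmin, Rmax. destruct Rle_dec; intros;
    unfold Rabs; repeat destruct Rcase_abs; lra. }
  assert (H1 : forall c, Rabs (c - x) <= Rabs (s - x) -> Rabs (g1 c - g1 x) <= D * Rabs (s - x)).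
  { intros c Hc.
    assert (Hin' : forall d, Rmin x c <= d <= Rmax x c -> Rabs (d - x) <= Rabs (c - x)).
    { intros d Hd. revert Hd. unfold Rmin, Rmax. destruct Rle_dec; intros;
      unfold Rabs; repeat destruct Rcase_abs; lra. }
    destruct (MVT_gen g1 x c g2) as [d [Hd E]].
    - intros d Hd. apply H. apply Rle_lt_trans with (Rabs (c - x)); [apply Hin'|]; lra.
    - intros d Hd. apply continuity_pt_filterlim, (continuous_derive _ _ (g2 d)).
      apply H. apply Rle_lt_trans with (Rabs (c - x)); [apply Hin'|]; lra.
    - rewrite E, Rabs_mult. apply Rmult_le_compat; auto using Rabs_pos.
      apply H. apply Rle_lt_trans with (Rabs (c - x)); [apply Hin'|]; lra. }
  destruct (MVT_gen (fun c => g c - c * g1 x) x s (fun c => g1 c - g1 x)) as [d [Hd E]].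
  - intros d Hd. destruct (H d) as [Hg _].
    { apply Rle_lt_trans with (Rabs (s - x)); [apply Hin|]; lra. }
    apply @is_derive_minus; [exact Hg|]. auto_derive; [easy|ring].
  - intros d Hd. destruct (H d) as [Hg _].
    { apply Rle_lt_trans with (Rabs (s - x)); [apply Hin|]; lra. }
    apply continuity_pt_minus.
    + apply continuity_pt_filterlim, (continuous_derive _ _ (g1 d)), Hg.
    + apply continuity_pt_mult; [apply continuity_pt_id|apply continuity_pt_const; easy].
  - replace (g s - g x - (s - x) * g1 x) with (g s - s * g1 x - (g x - x * g1 x)) by ring.
    rewrite E, Rabs_mult.
    apply Rle_trans with (D * Rabs (s - x) * Rabs (s - x)).
    + mono.
    + rewrite <- Rsqr_pow2, Rsqr_abs. unfold Rsqr. lra.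
Qed.

Lemma is_derive_quadratic (g : R -> R) (x l C e : R) : 0 < e ->
  (forall s, Rabs (s - x) < e -> Rabs (g s - g x - (s - x) * l) <= C * (s - x) ^ 2) ->
  is_derive g x l.
Proof.
  intros He H. apply is_derive_Reals. intros eps Heps.
  assert (Hd : 0 < Rmin e (eps / (Rabs C + 1))).
  { pos. }
  exists (mkposreal _ Hd). intros h Hh0 Hh. simpl in Hh.
  assert (Hh1 : Rabs h < e) by (apply Rlt_le_trans with (1 := Hh), Rmin_l).
  assert (Hh2 : Rabs h < eps / (Rabs C + 1)) by (apply Rlt_le_trans with (1 := Hh), Rmin_r).
  specialize (H (x + h)). replace (x + h - x) with h in H by ring. specialize (H Hh1).
  replace ((g (x + h) - g x) / h - l) with ((g (x + h) - g x - h * l) / h) by (field; auto).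
  unfold Rdiv. rewrite Rabs_mult, Rabs_inv.
  assert (Hp : 0 < Rabs h) by now apply Rabs_pos_lt.
  apply Rmult_lt_reg_r with (Rabs h); auto. rewrite Rmult_assoc, Rinv_l, Rmult_1_r by lra.
  apply Rle_lt_trans with (1 := H). rewrite <- Rsqr_pow2, Rsqr_abs. unfold Rsqr.
  rewrite <- Rmult_assoc. apply Rmult_lt_compat_r; auto.
  apply Rle_lt_trans with (Rabs C * Rabs h).
  - apply Rmult_le_compat_r; [lra|apply Rle_abs].
  - apply Rle_lt_trans with ((Rabs C + 1) * Rabs h).
    + pos.
    + apply Rmult_lt_reg_r with (/ (Rabs C + 1)).
      * pos.
      * replace ((Rabs C + 1) * Rabs h * / (Rabs C + 1)) with (Rabs h); auto.
        field. generalize (Rabs_pos C); lra.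
Qed.

(* The bound on the second derivative dispenses with any joint continuity of [f1]. *)
Lemma rint_diff (f f1 f2 : R -> R -> R) (t e K0 K1 K2 : R) : 0 < e ->
  (forall s, Rabs (s - t) < e -> dom K0 (f s)) -> dom K1 (f1 t) ->
  (forall s y, Rabs (s - t) < e -> is_derive (fun s => f s y) s (f1 s y)) ->
  (forall s y, Rabs (s - t) < e -> is_derive (fun s => f1 s y) s (f2 s y)) ->
  (forall s y, Rabs (s - t) < e -> Rabs (f2 s y) <= K2 / (1 + y ^ 2)) ->
  is_derive (fun s => rint (f s)) t (rint (f1 t)).
Proof.
  intros He H0 H1 Hd Hd1 H2.
  apply is_derive_quadratic with (K2 * PI) e; auto. intros s Hs.
  assert (Ht : Rabs (t - t) < e) by (rewrite Rminus_diag, Rabs_R0; auto).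
  assert (E : rint (f s) - rint (f t) - (s - t) * rint (f1 t) = rint (fun y => f s y - f t y - (s - t) * f1 t
    y)).
  { rewrite (rint_minus (K0 + K0) (Rabs (s - t) * K1)), (rint_minus K0 K0), (rint_scal K1);
      auto using dom_minus, dom_scal. }
  rewrite E. replace (K2 * PI * (s - t) ^ 2) with (K2 * (s - t) ^ 2 * PI) by ring.
  apply rint_bound. split.
  - eapply (proj1 (dom_minus (K0 + K0) (Rabs (s - t) * K1) _ _ (dom_minus _ _ _ _ (H0 s Hs) (H0 t Ht))
      (dom_scal _ _ _ H1))).
  - intro y. replace (K2 * (s - t) ^ 2 / (1 + y ^ 2)) with (K2 / (1 + y ^ 2) * (s - t) ^ 2)
      by pos.
    apply (taylor2 (fun s => f s y) (fun s => f1 s y) (fun s => f2 s y) t e); auto.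
Qed.

(** * Derivatives of complex curves *)

(** Componentwise, because the mean value theorem and [rint] are real. *)
Definition cderive (g : R -> C) (s : R) (l : C) : Prop :=
  is_derive (fun s => Re (g s)) s (Re l) /\ is_derive (fun s => Im (g s)) s (Im l).

Definition cexp (z : C) : C := (exp (Re z) * cos (Im z), exp (Re z) * sin (Im z)).

Lemma C_eq (a b : C) : Re a = Re b -> Im a = Im b -> a = b.
Proof. destruct a, b; simpl; intros -> ->; easy. Qed.

Ltac Cext := apply C_eq; unfold Re, Im; simpl; try ring.

Lemma im_le_Cmod (c : C) : Rabs (Im c) <= Cmod c.
Proof. apply Rle_trans with (2 := Rmax_Cmod c). apply Rmax_r. Qed.

Lemma Cmod_le_sum (c : C) : Cmod c <= Rabs (Re c) + Rabs (Im c).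
Proof.
  unfold Cmod. apply Rsqr_incr_0_var; [|generalize (Rabs_pos (Re c)) (Rabs_pos (Im c)); lra].
  rewrite Rsqr_sqrt by pos.
  rewrite <- (pow2_abs (fst c)), <- (pow2_abs (snd c)). unfold Rsqr, Re, Im.
  generalize (Rmult_le_pos _ _ (Rabs_pos (fst c)) (Rabs_pos (snd c))). nra.
Qed.

Lemma cexp_add a b : cexp (a + b) = (cexp a * cexp b)%C.
Proof.
  unfold cexp, Re, Im. Cext; rewrite exp_plus, ?cos_plus, ?sin_plus; ring.
Qed.

Lemma Cmod_cexp z : Cmod (cexp z) = exp (Re z).
Proof.
  unfold Cmod, cexp; simpl.
  replace (_ + _) with (exp (Re z) * exp (Re z)).
  - apply sqrt_square. pos.
  - generalize (sin2_cos2 (Im z)); unfold Rsqr. nra.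
Qed.

Lemma cexp_0 : cexp 0 = 1%C.
Proof. unfold cexp; Cext; rewrite exp_0, ?cos_0, ?sin_0; ring. Qed.

(** With no division by [h], the estimates of two components combine into one modulus, as in
    [cderive_eps]. *)
Lemma is_derive_eps (g : R -> R) (s l : R) :
  is_derive g s l <-> forall eps, 0 < eps -> exists d, 0 < d /\
    forall h, Rabs h < d -> Rabs (g (s + h) - g s - h * l) <= eps * Rabs h.
Proof.
  split.
  - intros H eps He. apply is_derive_Reals in H. destruct (H eps He) as [d Hd].
    exists d; split; [apply cond_pos|]. intros h Hh.
    destruct (Req_dec h 0) as [->|Hn].
    + rewrite Rplus_0_r, Rminus_diag, Rmult_0_l, Rminus_0_r, Rabs_R0. lra.
    + specialize (Hd h Hn Hh).
      replace (g (s + h) - g s - h * l) with (((g (s + h) - g s) / h - l) * h) by (field; auto).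
      rewrite Rabs_mult. mono.
  - intro H. apply is_derive_Reals. intros eps He. destruct (H (eps / 2)) as [d [Hd0 Hd]]; [lra|].
    exists (mkposreal d Hd0). intros h Hn Hh. simpl in Hh. specialize (Hd h Hh).
    assert (Hp : 0 < Rabs h) by now apply Rabs_pos_lt.
    replace ((g (s + h) - g s) / h - l) with ((g (s + h) - g s - h * l) / h) by (field; auto).
    unfold Rdiv. rewrite Rabs_mult, Rabs_inv.
    apply Rmult_lt_reg_r with (Rabs h); auto. rewrite Rmult_assoc, Rinv_l by lra. nra.
Qed.

Lemma cderive_eps (g : R -> C) (s : R) (l : C) :
  cderive g s l <-> forall eps, 0 < eps -> exists d, 0 < d /\
    forall h, Rabs h < d -> Cmod (g (s + h)%R - g s - h * l) <= eps * Rabs h.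
Proof.
  unfold cderive. rewrite 2!is_derive_eps. split.
  - intros [H1 H2] eps He. destruct (H1 (eps / 2)) as [d1 [Hd1 H1']]; [lra|].
    destruct (H2 (eps / 2)) as [d2 [Hd2 H2']]; [lra|].
    exists (Rmin d1 d2); split; [now apply Rmin_pos|]. intros h Hh.
    specialize (H1' h (Rlt_le_trans _ _ _ Hh (Rmin_l _ _))).
    specialize (H2' h (Rlt_le_trans _ _ _ Hh (Rmin_r _ _))).
    apply Rle_trans with (1 := Cmod_le_sum _). simpl.
    replace (_ + - (h * _ - 0 * _)) with (Re (g (s + h)) - Re (g s) - h * Re l) by (unfold Re, Im; ring).
    replace (snd (g (s + h)) + - snd (g s) + - _) with (Im (g (s + h)) - Im (g s) - h * Im l) by (unfold Re,
      Im; ring).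
    lra.
  - intro H; split; intros eps He; destruct (H eps He) as [d [Hd0 Hd]]; exists d; split; auto;
    intros h Hh; apply Rle_trans with (2 := Hd h Hh).
    + apply Rle_trans with (2 := re_le_Cmod _). simpl. right. f_equal. unfold Re, Im; ring.
    + apply Rle_trans with (2 := im_le_Cmod _). simpl. right. f_equal. unfold Re, Im; ring.
Qed.

Lemma cderive_ext f g s l : (forall s, f s = g s) -> cderive f s l -> cderive g s l.
Proof.
  intros H [H1 H2]; split.
  - apply is_derive_ext with (2 := H1). intro; now rewrite H.
  - apply is_derive_ext with (2 := H2). intro; now rewrite H.
Qed.

Lemma cderive_eq f s l l' : cderive f s l -> l = l' -> cderive f s l'.
Proof. now intros H <-. Qed.

Lemma cderive_const (c : C) s : cderive (fun _ => c) s 0.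
Proof. split; apply @is_derive_const. Qed.

Lemma cderive_plus f g s a b : cderive f s a -> cderive g s b -> cderive (fun s => f s + g s)%C s (a + b).
Proof. intros [] []; split; now apply @is_derive_plus. Qed.

Lemma cderive_mult f g s a b : cderive f s a -> cderive g s b ->
  cderive (fun s => f s * g s)%C s (a * g s + f s * b).
Proof.
  intros [H1 H2] [H3 H4]; split; simpl.
  - evar_last; [apply @is_derive_minus; apply Derive.is_derive_mult;[exact H1|exact H3|exact H2|exact H4]|].
    unfold minus, plus, opp, Re, Im; simpl. ring.
  - evar_last; [apply @is_derive_plus; apply Derive.is_derive_mult;[exact H1|exact H4|exact H2|exact H3]|].
    unfold minus, plus, opp, Re, Im; simpl. ring.
Qed.

Lemma cderive_scal (c : C) g s b : cderive g s b -> cderive (fun s => c * g s)%C s (c * b).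
Proof.
  intro H. apply cderive_eq with (1 := cderive_mult _ _ _ _ _ (cderive_const c s) H). ring.
Qed.

Lemma cderive_cexp g s b : cderive g s b -> cderive (fun s => cexp (g s)) s (cexp (g s) * b).
Proof.
  intros [H1 H2]. split; unfold cexp; simpl.
  - evar_last.
    + apply Derive.is_derive_mult.
      * apply (is_derive_comp exp); [apply is_derive_Reals, derivable_pt_lim_exp|exact H1].
      * apply (is_derive_comp cos); [apply is_derive_Reals, derivable_pt_lim_cos|exact H2].
    + unfold scal; simpl; unfold mult; simpl. unfold Re, Im. ring.
  - evar_last.
    + apply Derive.is_derive_mult.
      * apply (is_derive_comp exp); [apply is_derive_Reals, derivable_pt_lim_exp|exact H1].
      * apply (is_derive_comp sin); [apply is_derive_Reals, derivable_pt_lim_sin|exact H2].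
    + unfold scal; simpl; unfold mult; simpl. unfold Re, Im. ring.
Qed.

Lemma Csq_pos (c : C) : c <> 0 -> 0 < Re c ^ 2 + Im c ^ 2.
Proof.
  intro H. rewrite <- Cmod2_alt. apply pow_lt. now apply Cmod_gt_0.
Qed.

Lemma cderive_inv g s b : cderive g s b -> g s <> 0 -> cderive (fun s => / g s)%C s (- (b * / g s * / g s)).
Proof.
  intros [H1 H2] Hn. apply Csq_pos in Hn.
  assert (D : is_derive (fun s => Re (g s) ^ 2 + Im (g s) ^ 2) s (2 * Re (g s) * Re b + 2 * Im (g s) * Im b)).
  { evar_last. apply @is_derive_plus; apply is_derive_pow; eassumption. unfold plus; simpl. ring. }
  assert (Hn' : Re (g s) ^ 2 + Im (g s) ^ 2 <> 0) by lra.
  split; simpl; unfold Rdiv.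
  - evar_last. { apply Derive.is_derive_mult; [exact H1|]. apply is_derive_inv; [exact D|exact Hn']. }
    unfold Re, Im in *. field. pos.
  - evar_last. { apply Derive.is_derive_mult; [apply @is_derive_opp; exact H2|].
    apply is_derive_inv; [exact D|exact Hn']. }
    unfold opp; simpl. unfold Re, Im in *. field. pos.
Qed.

Lemma cderive_pow g s b (n : nat) : cderive g s b ->
  cderive (fun s => g s ^ n)%C s (INR n * g s ^ pred n * b).
Proof.
  intro H. induction n.
  - apply cderive_eq with (1 := cderive_const 1 s). simpl. ring.
  - apply cderive_eq with (1 := cderive_mult _ _ _ _ _ H IHn). simpl pred. rewrite S_INR, RtoC_plus.
    destruct n; simpl; ring.
Qed.

Lemma is_derive_C_eps (F : C -> C) (z l : C) :
  @is_derive C_AbsRing C_NormedModule F z l -> forall eps, 0 < eps -> exists d, 0 < d /\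
    forall h, Cmod h < d -> Cmod (F (z + h)%C - F z - h * l) <= eps * Cmod h.
Proof.
  intros [_ H] eps He. specialize (H z (fun P HP => HP)). specialize (H (mkposreal eps He)).
  destruct H as [d Hd]. exists d; split; [apply cond_pos|]. intros h Hh.
  specialize (Hd (z + h)%C).
  assert (B : @ball (AbsRing_UniformSpace C_AbsRing) z (pos d) (z + h)%C).
  { unfold ball; simpl. unfold AbsRing_ball. unfold abs, minus, plus, opp; simpl.
    replace (z + h + - z)%C with h by ring. exact Hh. }
  specialize (Hd B). simpl in Hd.
  change (Cmod (F (z + h)%C - F z - (z + h - z) * l) <= eps * Cmod (z + h - z)) in Hd.
  replace (z + h - z)%C with h in Hd by ring. exact Hd.
Qed.

Lemma is_derive_C_of_eps (F : C -> C) (z l : C) :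
  (forall eps, 0 < eps -> exists d, 0 < d /\
    forall h, Cmod h < d -> Cmod (F (z + h)%C - F z - h * l) <= eps * Cmod h) ->
  @is_derive C_AbsRing C_NormedModule F z l.
Proof.
  intro H. split.
  - apply @is_linear_scal_l.
  - intros x Hx.
    assert (Ex : z = x).
    { apply (@is_filter_lim_locally_unique C_AbsRing (AbsRing_NormedModule C_AbsRing) z x). exact Hx. }
    subst x. intro eps. destruct (H eps (cond_pos eps)) as [d [Hd0 Hd]].
    exists (mkposreal d Hd0). intros y B.
    unfold ball in B; simpl in B. unfold AbsRing_ball in B. unfold abs, minus, plus, opp in B; simpl in B.
    specialize (Hd (y + - z)%C B).
    assert (Ey : forall a b : C, (a + (b + - a))%C = b) by (intros; ring). rewrite Ey in Hd.
    auto.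
Qed.

(** The main way in which complex differentiability is used: along rays to 0 and along vertical or
    horizontal lines. *)
Lemma cderive_chain (F : C -> C) (l : C) (g : R -> C) s dg :
  @is_derive C_AbsRing C_NormedModule F (g s) l -> cderive g s dg -> cderive (fun s => F (g s)) s (l * dg).
Proof.
  intros HF Hg. apply cderive_eps. intros eps He. assert (Hg' := proj1 (cderive_eps _ _ _) Hg).
  assert (Hl := Cmod_ge_0 l). assert (Hdg := Cmod_ge_0 dg).
  destruct (is_derive_C_eps _ _ _ HF (eps / (2 * (Cmod dg + 1)))) as [d1 [Hd1 H1]].
  { pos. }
  (* The entry 1 yields [Cmod k <= (Cmod dg + 1) * Rabs h] for the increment [k] of [g]; the other
     absorbs the factor [l]. Each of the two error terms gets [eps / 2]. *)
  destruct (Hg' (Rmin 1 (eps / (2 * (Cmod l + 1))))) as [d2 [Hd2 H2]].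
  { pos. }
  exists (Rmin d2 (d1 / (Cmod dg + 1))). split.
  { pos. }
  intros h Hh.
  specialize (H2 h (Rlt_le_trans _ _ _ Hh (Rmin_l _ _))).
  assert (Hh1 := Rlt_le_trans _ _ _ Hh (Rmin_r _ _)).
  assert (Hp := Rabs_pos h).
  assert (H2a : Cmod (g (s + h)%R - g s - h * dg) <= Rabs h).
  { apply Rle_trans with (1 := H2). rewrite <- (Rmult_1_l (Rabs h)) at 2.
    apply Rmult_le_compat_r; auto. apply Rmin_l. }
  assert (H2b : Cmod (g (s + h)%R - g s - h * dg) <= eps / (2 * (Cmod l + 1)) * Rabs h).
  { apply Rle_trans with (1 := H2). apply Rmult_le_compat_r; auto. apply Rmin_r. }
  set (k := (g (s + h)%R - g s)%C) in *.
  assert (Hk : Cmod k <= (Cmod dg + 1) * Rabs h).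
  { replace k with ((k - h * dg) + h * dg)%C by ring.
    apply Rle_trans with (1 := Cmod_triangle _ _). rewrite Cmod_mult, Cmod_R. lra. }
  assert (Hk1 : Cmod k < d1).
  { apply Rle_lt_trans with (1 := Hk). rewrite Rmult_comm. apply Rmult_lt_reg_r with (/ (Cmod dg + 1)).
    - pos.
    - rewrite Rmult_assoc, Rinv_r, Rmult_1_r by lra. exact Hh1. }
  specialize (H1 k Hk1). replace (g s + k)%C with (g (s + h)%R) in H1 by (unfold k; ring).
  replace (F (g (s + h)%R) - F (g s) - h * (l * dg))%C
    with ((F (g (s + h)%R) - F (g s) - k * l) + l * (k - h * dg))%C by ring.
  apply Rle_trans with (1 := Cmod_triangle _ _). rewrite Cmod_mult.
  assert (A1 : eps / (2 * (Cmod dg + 1)) * Cmod k <= eps / 2 * Rabs h).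
  { apply Rle_trans with (eps / (2 * (Cmod dg + 1)) * ((Cmod dg + 1) * Rabs h)).
    - mono.
    - right. field. lra. }
  assert (A2 : Cmod l * Cmod (k - h * dg) <= eps / 2 * Rabs h).
  { apply Rle_trans with ((Cmod l + 1) * (eps / (2 * (Cmod l + 1)) * Rabs h)).
    - mono.
    - right. field. lra. }
  lra.
Qed.

Lemma cderive_line (z d : C) s : cderive (fun s => z + s * d)%C s d.
Proof.
  split; simpl; auto_derive; auto; unfold Re, Im; ring.
Qed.

(* Projecting on the direction of [g b - g a] gives the sharp constant. *)
Lemma Cmod_MVT (g dg : R -> C) (a b D : R) : a <= b ->
  (forall s, a <= s <= b -> cderive g s (dg s)) ->
  (forall s, a <= s <= b -> Cmod (dg s) <= D) -> Cmod (g b - g a) <= D * (b - a).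
Proof.
  intros Hab Hg HD. set (v := (g b - g a)%C).
  destruct (Req_dec (Cmod v) 0) as [->|Hv].
  { apply Rmult_le_pos; [|lra]. apply Rle_trans with (2 := HD a ltac:(lra)). pos. }
  assert (Hv0 := Cmod_ge_0 v).
  destruct (MVT_gen (fun s => Re v * Re (g s) + Im v * Im (g s)) a b
    (fun s => Re v * Re (dg s) + Im v * Im (dg s))) as [c [Hc E]].
  - rewrite Rmin_left, Rmax_right by auto. intros s Hs. destruct (Hg s) as [H1 H2]; [lra|].
    apply @is_derive_plus; apply is_derive_scal; auto.
  - rewrite Rmin_left, Rmax_right by auto. intros s Hs. destruct (Hg s) as [H1 H2]; [lra|].
    apply continuity_pt_filterlim.
    apply (continuous_derive (fun s => Re v * Re (g s) + Im v * Im (g s)) s (Re v * Re (dg s) + Im v * Im (dg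
      s))).
    apply @is_derive_plus; apply is_derive_scal; auto.
  - rewrite Rmin_left, Rmax_right in Hc by auto.
    assert (E1 : Cmod v ^ 2 = Re (Cconj v * dg c) * (b - a)).
    { rewrite Cmod2_alt. simpl in *. unfold v, Re, Im in *; simpl in *. lra. }
    assert (E2 : Re (Cconj v * dg c) <= Cmod v * D).
    { apply Rle_trans with (1 := Rle_abs _). apply Rle_trans with (1 := re_le_Cmod _).
      rewrite Cmod_mult, Cmod_conj. mono. }
    nra.
Qed.

(** The horizontal line through [z] stays in the half-plane, and along it the complex derivative is
    an ordinary real one. *)
Lemma is_derive_C_unique_at (F G : C -> C) (z a b : C) :
  @is_derive C_AbsRing C_NormedModule F z a -> @is_derive C_AbsRing C_NormedModule G z b ->
  UHP z -> (forall w, UHP w -> F w = G w) -> a = b.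
Proof.
  intros HF HG Hz H.
  assert (E : forall s : R, UHP (z + s * 1)%C).
  { intro s. unfold UHP in *. simpl. pos. }
  assert (Z : (z + 0%R * 1)%C = z) by ring.
  assert (H1 := cderive_chain F a (fun s => z + s * 1)%C 0 1).
  assert (H2 := cderive_chain G b (fun s => z + s * 1)%C 0 1).
  cbv beta in H1, H2. rewrite Z in H1, H2.
  specialize (H1 HF (cderive_line _ _ _)). specialize (H2 HG (cderive_line _ _ _)).
  apply cderive_ext with (g := fun s => G (z + s * 1)%C) in H1; [|intro; apply H; auto].
  destruct H1 as [H1 H1'], H2 as [H2 H2'].
  apply is_derive_unique in H1, H1', H2, H2'.
  rewrite Cmult_1_r in *.
  apply C_eq; congruence.
Qed.

(** * Bang's argument *)

(* A form of [|f b| <= |f a| + RInt |g| a b] tested only on exponential bounds for [g]. *)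
Definition growth_step (f g : R -> R) (L : R) : Prop :=
  forall a b C w, 0 <= a -> a <= b -> b <= L -> 0 <= C -> 0 < w ->
    (forall r, a <= r <= b -> Rabs (g r) <= C * exp (w * (r - a))) ->
    Rabs (f b) <= Rabs (f a) + C / w * (exp (w * (b - a)) - 1).

(** When [C <= A * w] the exponential profile of rate [w] reproduces itself, so one fixed rate can
    be passed down a whole chain of derivatives. *)
Lemma growth_step_exp (f g : R -> R) (L a b A C w : R) : growth_step f g L ->
  0 <= a -> a <= b -> b <= L -> 0 <= C -> 0 < w -> Rabs (f a) <= A -> C <= A * w ->
  (forall r, a <= r <= b -> Rabs (g r) <= C * exp (w * (r - a))) ->
  Rabs (f b) <= A * exp (w * (b - a)).
Proof.
  intros H Ha Hab Hb HC Hw HA HCA Hg.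
  apply Rle_trans with (1 := H a b C w Ha Hab Hb HC Hw Hg).
  assert (He : 1 <= exp (w * (b - a))).
  { rewrite <- exp_0. destruct (Req_dec (w * (b - a)) 0) as [->|]; [lra|].
    left. apply exp_increasing. nra. }
  assert (HC' : C / w <= A).
  { apply Rmult_le_reg_r with w; auto. unfold Rdiv. rewrite Rmult_assoc, Rinv_l by lra. lra. }
  nra.
Qed.

Section Bang.
Variables (E O : nat -> R -> R) (N v : nat -> R) (L : R).
Hypothesis HN : forall p, 0 < N p.
Hypothesis Hv : forall p, 0 < v p.
Hypothesis HNv : forall p, N (S p) = N p * v p ^ 2.
Hypothesis Hvi : forall p, v p <= v (S p).
Hypothesis Hdiv : is_lim_seq (sum_n (fun p => / v p)) p_infty.
Hypothesis Hbd : forall p s, 0 <= s <= L -> Rabs (E p s) <= N p.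
Hypothesis HEO : forall p, growth_step (E p) (O p) L.
Hypothesis HOE : forall p, growth_step (O p) (E (S p)) L.
Hypothesis HE0 : forall p, E p 0 = 0.
Hypothesis HO0 : forall p, O p 0 = 0.

Let th := exp (-1).

Let th_pos : 0 < th.
Proof. apply exp_pos. Qed.

(* [E p] and [O p] play the derivatives of order [2p] and [2p+1], with a priori bounds [N p] and
   [N p * v p]; at level [n] the derivative of order [k < 2n] beats its bound by [e^(k-2n)]. *)
Definition bang_at (n : nat) (x : R) : Prop := forall k, (k < n)%nat ->
  Rabs (E (n - S k) x) <= th ^ (2 * S k) * N (n - S k) /\
  Rabs (O (n - S k) x) <= th ^ (2 * k + 1) * N (n - S k) * v (n - S k).

Lemma v_mono p q : (p <= q)%nat -> v p <= v q.
Proof. induction 1; [lra|]. apply Rle_trans with (1 := IHle), Hvi. Qed.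

(** Integrating at rate [v n / th] divides by [v n] and gains one factor [th], whereas the a priori
    bounds differ by the factor [v p] at level [p]. One rate serves all levels since
    [v p <= v n]. *)
Lemma bang_odd n a k : 0 <= a -> bang_at (S n) a -> (k < S n)%nat ->
  (forall r, a <= r <= L ->
    Rabs (E (S n - k) r) <= th ^ (2 * k) * N (S n - k) * exp (v n / th * (r - a))) ->
  forall r, a <= r <= L ->
    Rabs (O (S n - S k) r) <=
      th ^ (2 * k + 1) * N (S n - S k) * v (S n - S k) * exp (v n / th * (r - a)).
Proof.
  intros Ha H Hk IH s Hs.
  assert (Hw : 0 < v n / th) by pos.
  destruct (H k Hk) as [_ H2].
  set (p := (S n - S k)%nat) in *.
  replace (S n - k)%nat with (S p) in IH by (unfold p; lia).
  assert (Hvp : v p <= v n) by (apply v_mono; unfold p; lia).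
  assert (Hp1 := HN p). assert (Hp2 := Hv p). assert (Hn2 := Hv n).
  assert (Ht : forall j, 0 < th ^ j) by (intro; now apply pow_lt).
  apply (growth_step_exp (O p) (E (S p)) L a s _ (th ^ (2 * k) * N (S p))); auto; try lra.
  - pos.
  - rewrite HNv. replace (th ^ (2 * k + 1) * N p * v p * (v n / th))
      with (th ^ (2 * k) * N p * v p * v n) by (rewrite pow_add; field; lra).
    replace (th ^ (2 * k) * (N p * v p ^ 2)) with (th ^ (2 * k) * N p * v p * v p) by ring.
    mono.
  - intros t Htt. apply IH. lra.
Qed.

(** Descent through the levels. [k = 0] is the top level [S n], where only the a priori bound [Hbd]
    is available; below it [bang_odd] and the even step alternate. *)
Lemma bang_even n a : 0 <= a -> bang_at (S n) a -> forall k, (k <= S n)%nat ->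
  forall r, a <= r <= L ->
  Rabs (E (S n - k) r) <= th ^ (2 * k) * N (S n - k) * exp (v n / th * (r - a)).
Proof.
  intros Ha H k.
  assert (Hw : 0 < v n / th) by pos.
  induction k as [|k IH]; intros Hk r Hr.
  - replace (2 * 0)%nat with 0%nat by lia. rewrite pow_O, Rmult_1_l.
    apply Rle_trans with (1 := Hbd _ r ltac:(lra)).
    rewrite <- (Rmult_1_r (N _)) at 1. apply Rmult_le_compat_l; [left; apply HN|].
    rewrite <- exp_0. destruct (Req_dec (v n / th * (r - a)) 0) as [->|]; [lra|].
    left. apply exp_increasing. nra.
  - assert (HO := bang_odd n a k Ha H ltac:(lia) (IH ltac:(lia))).
    destruct (H k ltac:(lia)) as [H1 _].
    set (p := (S n - S k)%nat) in *.
    assert (Hp1 := HN p). assert (Hp2 := Hv p). assert (Hn2 := Hv n).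
    assert (Ht : forall j, 0 < th ^ j) by (intro; now apply pow_lt).
    assert (Hvp : v p <= v n) by (apply v_mono; unfold p; lia).
    apply (growth_step_exp (E p) (O p) L a r _ (th ^ (2 * k + 1) * N p * v p)); auto; try lra.
    + pos.
    + replace (th ^ (2 * S k) * N p * (v n / th)) with (th ^ (2 * k + 1) * N p * v n).
      * mono.
      * replace (2 * S k)%nat with (S (2 * k + 1)) by lia. simpl. field. lra.
    + intros t Htt. apply HO. lra.
Qed.

(** Over a length [2 th / v n] the exponential grows by at most [e^2 = th^(-2)], which is exactly
    the gain of two orders, that is of one level. *)
Lemma bang_step n a b : 0 <= a -> a <= b -> b <= L -> b - a <= 2 * th / v n ->
  bang_at (S n) a -> bang_at n b.
Proof.
  intros Ha Hab Hb Hs H k Hk.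
  assert (Hn2 := Hv n).
  assert (He : exp (v n / th * (b - a)) <= / th ^ 2).
  { replace (/ th ^ 2) with (exp 2).
    - assert (X : v n / th * (b - a) <= 2).
      { apply Rle_trans with (v n / th * (2 * th / v n)).
        - mono.
        - right. field. lra. }
      destruct (Req_dec (v n / th * (b - a)) 2) as [->|]; [lra|]. left. mono.
    - unfold th. replace (exp (-1) ^ 2) with (exp (-2)).
      + rewrite <- exp_Ropp. f_equal; ring.
      + simpl. rewrite Rmult_1_r, <- exp_plus. f_equal; ring. }
  assert (Ht : forall j, 0 < th ^ j) by (intro; now apply pow_lt).
  assert (H1 := bang_even n a Ha H (S (S k)) ltac:(lia) b ltac:(lra)).
  assert (H2 := bang_odd n a (S k) Ha H ltac:(lia) (bang_even n a Ha H (S k) ltac:(lia)) b ltac:(lra)).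
  replace (S n - S (S k))%nat with (n - S k)%nat in * by lia.
  assert (Hp1 := HN (n - S k)). assert (Hp2 := Hv (n - S k)).
  split.
  - apply Rle_trans with (1 := H1).
    apply Rle_trans with (th ^ (2 * S (S k)) * N (n - S k) * / th ^ 2).
    + mono.
    + right. replace (2 * S (S k))%nat with (2 * S k + 2)%nat by lia. rewrite pow_add. field. lra.
  - apply Rle_trans with (1 := H2).
    apply Rle_trans with (th ^ (2 * S k + 1) * N (n - S k) * v (n - S k) * / th ^ 2).
    + mono.
    + right. replace (2 * S k + 1)%nat with (2 * k + 1 + 2)%nat by lia. rewrite pow_add. field. lra.
Qed.

(** Distance covered by [j] uses of [bang_step], descending from level [n + j] to level [n]. *)
Fixpoint vsum (n j : nat) : R :=
  match j with 0%nat => 0 | S j => 2 * th / v n + vsum (S n) j end.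

Lemma vsum_nonneg n j : 0 <= vsum n j.
Proof.
  revert n; induction j; intro n; simpl; [lra|]. pos.
Qed.

Lemma vsum_eq n j : vsum (S n) j = 2 * th * (sum_n (fun p => / v p) (n + j) - sum_n (fun p => / v p) n).
Proof.
  revert n; induction j; intro n; simpl.
  - rewrite Nat.add_0_r. ring.
  - rewrite IHj. rewrite sum_Sn. replace (n + S j)%nat with (S n + j)%nat by lia.
    unfold plus; simpl. pos.
Qed.

(** At the origin [bang_at] holds at every level, all derivatives being 0 there, so the start can be
    taken as high as desired. *)
Lemma bang_reach j : forall n y, 0 <= y <= L -> y <= vsum n j -> bang_at n y.
Proof.
  induction j; intros n y Hy Hj; simpl in Hj.
  - replace y with 0 by lra. intros k Hk. rewrite HE0, HO0, Rabs_R0.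
    assert (Ht : forall j, 0 < th ^ j) by (intro; now apply pow_lt).
    split; repeat apply Rmult_le_pos; left; auto.
  - assert (H0 := vsum_nonneg (S n) j).
    assert (H1 : 0 < 2 * th / v n) by pos.
    apply bang_step with (Rmin y (vsum (S n) j)).
    + apply Rmin_glb; lra.
    + apply Rmin_l.
    + lra.
    + unfold Rmin; destruct Rle_dec; lra.
    + apply IHj; [|apply Rmin_r]. split; [apply Rmin_glb; lra|].
      apply Rle_trans with (1 := Rmin_l _ _); lra.
Qed.

(** By divergence every level is reached at [y], and level [S n] gives
    [|E 0 y| <= th^(2 (n + 1)) N 0], which tends to 0. *)
Lemma bang_zero y : 0 <= y <= L -> E 0 y = 0.
Proof.
  intro Hy.
  assert (H : forall n, bang_at (S n) y).
  { intro n. assert (Hd := Hdiv). apply is_lim_seq_spec in Hd.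
    destruct (Hd (sum_n (fun p => / v p) n + y / (2 * th))) as [m Hm].
    apply bang_reach with m; auto. rewrite vsum_eq. specialize (Hm (n + m)%nat ltac:(lia)).
    assert (y / (2 * th) * (2 * th) = y) by (field; lra). nra. }
  assert (Ht : 0 <= th ^ 2 < 1).
  { unfold th. split; [apply pow2_ge_0|].
    assert (exp (-1) < 1) by (rewrite <- exp_0; apply exp_increasing; lra).
    generalize (exp_pos (-1)). simpl. nra. }
  apply Rabs_eq_0. apply Rle_antisym; [|apply Rabs_pos].
  apply (is_lim_seq_le (fun _ => Rabs (E 0 y)) (fun n => (th ^ 2) ^ (S n) * N 0) (Rabs (E 0 y)) 0).
  - intro n. destruct (H n n ltac:(lia)) as [H1 _]. rewrite Nat.sub_diag in H1.
    rewrite <- pow_mult. exact H1.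
  - apply is_lim_seq_const.
  - replace (Finite 0) with (Rbar_mult 0 (N 0)) by (simpl; f_equal; ring).
    apply is_lim_seq_scal_r. apply (is_lim_seq_incr_1 (fun n => (th ^ 2) ^ n)).
    apply is_lim_seq_geom. rewrite Rabs_right; lra.
Qed.
End Bang.

Lemma growth_step_derive (f g : R -> R) (L : R) :
  (forall s, 0 <= s <= L -> is_derive f s (g s)) -> growth_step f g L.
Proof.
  intros H a b C w Ha Hab Hb HC Hw Hg.
  assert (D : forall s, is_derive (fun s => C / w * exp (w * (s - a))) s (C * exp (w * (s - a)))).
  { intro s. auto_derive; auto. unfold Rminus. field. lra. }
  (* Compare [f] and [- f] with the primitive of the exponential bound; no integrability of [g] is
     involved. *)
  assert (K : forall e, e = 1 \/ e = -1 -> e * f b - e * f a <= C / w * (exp (w * (b - a)) - 1)).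
  { intros e He.
    destruct (MVT_gen (fun s => e * f s - C / w * exp (w * (s - a))) a b (fun s => e * g s - C * exp (w * (s -
      a)))) as [c [Hc Ec]].
    - rewrite Rmin_left, Rmax_right by auto. intros s Hs.
      apply @is_derive_minus; [apply is_derive_scal, H; lra|apply D].
    - rewrite Rmin_left, Rmax_right by auto. intros s Hs. apply continuity_pt_filterlim.
      apply (continuous_derive (fun s => e * f s - C / w * exp (w * (s - a))) s (e * g s - C * exp (w * (s -
        a)))).
      apply @is_derive_minus; [apply is_derive_scal, H; lra|apply D].
    - rewrite Rmin_left, Rmax_right in Hc by auto.
      assert (Hgc := Hg c Hc). rewrite Rminus_diag, Rmult_0_r, exp_0 in Ec.
      assert (e * g c <= Rabs (g c)).
      { destruct He as [-> | ->]; [rewrite Rmult_1_l; apply Rle_abs|].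
        rewrite <- Rabs_Ropp. replace (-1 * g c) with (- g c) by ring. apply Rle_abs. }
      nra. }
  generalize (K 1 (or_introl eq_refl)) (K (-1) (or_intror eq_refl)).
  unfold Rabs; repeat destruct Rcase_abs; lra.
Qed.

(** [b f(b)] is [a f(a)] plus the integral of [r g(r)]. After division by [b] the weights [a / b]
    and [r / b] are at most 1, so nothing is lost against the plain primitive. The value at 0 covers
    [b = 0]. *)
Lemma growth_step_radial (f g : R -> R) (L : R) : f 0 = 0 ->
  (forall s, 0 <= s <= L -> is_derive (fun s => s * f s) s (s * g s)) -> growth_step f g L.
Proof.
  intros H0 H a b C w Ha Hab Hb HC Hw Hg.
  destruct (Req_dec b 0) as [->|Hbn].
  { replace a with 0 by lra. rewrite Rminus_diag, Rmult_0_r, exp_0. lra. }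
  assert (B : 0 < b) by lra.
  assert (St := growth_step_derive (fun s => s * f s) (fun s => s * g s) L H a b (b * C) w Ha Hab Hb).
  assert (X : Rabs (b * f b) <= Rabs (a * f a) + b * C / w * (exp (w * (b - a)) - 1)).
  { apply St; auto. { pos. }
    intros r Hr. rewrite Rabs_mult, (Rabs_right r) by lra.
    rewrite Rmult_assoc. apply Rmult_le_compat; auto using Rabs_pos; lra. }
  rewrite 2!Rabs_mult, (Rabs_right b), (Rabs_right a) in X by lra.
  apply Rmult_le_reg_l with b; auto. apply Rle_trans with (1 := X).
  assert (a * Rabs (f a) <= b * Rabs (f a)) by mono.
  pos.
Qed.

(** * Fourier uniqueness *)

Lemma rint_ge_RInt K f a b : dom K f -> (forall y, 0 <= f y) -> a <= b -> RInt f a b <= rint f.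
Proof.
  intros H Hp Hab.
  destruct (nfloor_ex (Rabs a + Rabs b)) as [N [_ HN]]. { pos. }
  apply (is_lim_seq_le_loc _ _ (Finite (RInt f a b)) (Finite (rint f)))
    with (2 := is_lim_seq_const (RInt f a b)) (3 := rint_lim K f H).
  exists (S N). intros n Hn.
  assert (Hn' : INR N + 1 <= INR n) by (rewrite <- S_INR; now apply le_INR).
  assert (b <= INR n) by (generalize (Rle_abs b) (Rabs_pos a); lra).
  assert (- INR n <= a) by (generalize (Rle_abs (- a)) (Rabs_pos b); rewrite Rabs_Ropp; lra).
  rewrite (RInt_sum3 f (- INR n) a b (INR n)) by apply H.
  assert (X : forall u v, u <= v -> 0 <= RInt f u v).
  { intros u v Huv. apply RInt_ge_0; auto. apply ex_RInt_cont, H. }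
  generalize (X _ _ H0) (X _ _ H1). lra.
Qed.

Lemma continuous_eps (f : R -> R) (x : R) : continuous f x -> forall e, 0 < e ->
  exists d, 0 < d /\ forall y, Rabs (y - x) < d -> Rabs (f y - f x) < e.
Proof.
  intros H e He. apply continuity_pt_filterlim in H. destruct (H e He) as [d [Hd H']].
  exists d; split; auto. intros y Hy. destruct (Req_dec y x) as [->|Hn].
  - rewrite Rminus_diag, Rabs_R0; auto.
  - apply H'. split; [split; [easy|auto]|exact Hy].
Qed.

(** The kernel is the Poisson kernel in the variable [th]. If [r y0] were positive, the mass near
    [y0] would stay above a positive constant while the rest is of order [e]. *)
Lemma poisson_limit (K Lam y0 : R) (r th : R -> R) :
  dom K r -> (forall y, continuous th y) -> (forall x y, x < y -> th x < th y) ->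
  0 < Lam -> (exists d, 0 < d /\ forall y, Rabs (y - y0) < d -> Rabs (th y - th y0) <= Lam * Rabs (y - y0)) ->
  (forall e, 0 < e -> rint (fun y => r y * (e / (e ^ 2 + (th y - th y0) ^ 2))) = 0) ->
  r y0 <= 0.
Proof.
  intros Hr Hth Hinc HLam [d0 [Hd0 HL]] HI. apply Rnot_lt_le. intro Ha.
  set (a := r y0 / 2). assert (Ha' : 0 < a) by (unfold a; lra).
  destruct (continuous_eps r y0 (proj1 Hr y0) a Ha') as [d1 [Hd1 H1]].
  set (d := Rmin d0 d1 / 2). assert (Hd : 0 < d) by (unfold d; generalize (Rmin_pos _ _ Hd0 Hd1); lra).
  assert (Hdd0 : d < d0) by (unfold d; generalize (Rmin_l d0 d1) (Rmin_pos _ _ Hd0 Hd1); lra).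
  assert (Hdd1 : d < d1) by (unfold d; generalize (Rmin_r d0 d1) (Rmin_pos _ _ Hd0 Hd1); lra).
  assert (Hra : forall y, Rabs (y - y0) <= d -> a <= r y).
  { intros y Hy. specialize (H1 y ltac:(lra)). unfold Rabs in H1; destruct Rcase_abs in H1; unfold a in *; lra.
    }
  set (eta := Rmin (th (y0 + d) - th y0) (th y0 - th (y0 - d))).
  assert (Heta : 0 < eta).
  { unfold eta. apply Rmin_pos; generalize (Hinc y0 (y0 + d) ltac:(lra)) (Hinc (y0 - d) y0 ltac:(lra)); lra. }
  assert (Hmono : forall x y, x <= y -> th x <= th y).
  { intros x y [H| ->]; [left; auto|lra]. }
  assert (Hout : forall y, d < Rabs (y - y0) -> eta ^ 2 <= (th y - th y0) ^ 2).
  { intros y Hy. unfold Rabs in Hy; destruct Rcase_abs in Hy.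
    - assert (th y <= th (y0 - d)) by (apply Hmono; lra).
      assert (eta <= th y0 - th (y0 - d)) by apply Rmin_r.
      nra.
    - assert (th (y0 + d) <= th y) by (apply Hmono; lra).
      assert (eta <= th (y0 + d) - th y0) by apply Rmin_l.
      mono. }
  assert (HK := dom_pos _ _ Hr).
  (* The first entry keeps the interval of radius [e / Lam] inside the neighbourhood where [r >= a].
     The second forces [q * PI <= a / Lam / 2], below the mass [a / Lam] found on that interval. *)
  set (e := Rmin (Lam * d) (a / Lam / 2 / ((K / eta ^ 2 + 1) * 4))).
  assert (He2 : 0 < eta ^ 2) by (apply pow_lt; auto).
  assert (HKe : 0 <= K / eta ^ 2) by pos.
  assert (He : 0 < e).
  { apply Rmin_pos; [now apply Rmult_lt_0_compat|]. pos. }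
  specialize (HI e He).
  set (P := fun y => e / (e ^ 2 + (th y - th y0) ^ 2)).
  change (rint (fun y => r y * P y) = 0) in HI.
  assert (HP0 : forall y, 0 < e ^ 2 + (th y - th y0) ^ 2).
  { intro y. pos. }
  assert (HP1 : forall y, 0 < P y <= / e).
  { intro y. unfold P. split; [apply Rdiv_lt_0_compat; auto|].
    apply Rmult_le_reg_r with (e ^ 2 + (th y - th y0) ^ 2); auto.
    unfold Rdiv. rewrite Rmult_assoc, Rinv_l by pos.
    replace (/ e * (e ^ 2 + (th y - th y0) ^ 2)) with (e + / e * (th y - th y0) ^ 2) by (field; lra).
    assert (0 <= / e * (th y - th y0) ^ 2); [|lra].
    pos. }
  assert (HPc : forall y, continuous P y).
  { intro y. unfold P. apply continuity_pt_filterlim. apply continuity_pt_div.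
    - apply continuity_pt_const. easy.
    - apply continuity_pt_plus; [apply continuity_pt_const; easy|].
      apply continuity_pt_filterlim.
      apply (continuous_comp (fun y => th y - th y0) (fun x => x ^ 2)).
      + apply @continuous_minus; [apply Hth|apply continuous_const].
      + apply (continuous_derive _ _ (2 * (th y - th y0))). auto_derive; auto. ring.
    - pos. }
  assert (D1 : dom (K * / e) (fun y => r y * P y)).
  { split.
    - intro y. apply continuous_mulR; [apply Hr|apply HPc].
    - intro y. rewrite Rabs_mult.
      replace (K * / e / (1 + y ^ 2)) with (K / (1 + y ^ 2) * / e)
        by pos.
      apply Rmult_le_compat; auto using Rabs_pos; [apply Hr|].
      rewrite Rabs_right by (apply Rle_ge, Rlt_le, HP1). apply HP1. }
  (* Away from [y0] the integrand is at most [q / (1 + y^2)] in absolute value, so adding this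
     function makes it nonnegative everywhere. *)
  set (q := K / eta ^ 2 * e).
  assert (Hq : 0 <= q) by (apply Rmult_le_pos; lra).
  assert (D2 : dom q (fun y => q / (1 + y ^ 2))).
  { split.
    - intro y. generalize (one_plus_sq_pos y); intro Hy.
      apply (continuous_derive _ _ (- q * (2 * y) / (1 + y ^ 2) ^ 2)).
      auto_derive; simpl in *; [lra|]. field. lra.
    - intro y. rewrite Rabs_right; [lra|]. pos. }
  assert (Hpos : forall y, 0 <= r y * P y + q / (1 + y ^ 2)).
  { intro y. assert (Hy := one_plus_sq_pos y).
    assert (Hq' : 0 <= q / (1 + y ^ 2)) by pos.
    destruct (Rle_dec (Rabs (y - y0)) d) as [Hin|Hin].
    - assert (0 <= r y * P y); [|lra]. apply Rmult_le_pos; [|left; apply HP1].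
      apply Rle_trans with a; [lra|auto].
    - assert (X : Rabs (r y * P y) <= q / (1 + y ^ 2)).
      { rewrite Rabs_mult. replace (q / (1 + y ^ 2)) with (K / (1 + y ^ 2) * (e / eta ^ 2))
          by (unfold q; field; lra).
        apply Rmult_le_compat; auto using Rabs_pos; [apply Hr|].
        rewrite Rabs_right by (apply Rle_ge, Rlt_le, HP1).
        unfold P, Rdiv. apply Rmult_le_compat_l; [lra|]. apply Rinv_le_contravar; auto.
        generalize (Hout y ltac:(lra)) (pow_lt e 2 He). lra. }
      generalize (Rle_abs (- (r y * P y))). rewrite Rabs_Ropp. lra. }
  assert (D3 := dom_plus _ _ _ _ D1 D2).
  assert (HeL : 0 < e / Lam) by pos.
  assert (I1 := rint_ge_RInt _ _ (y0 - e / Lam) (y0 + e / Lam) D3 Hpos ltac:(lra)).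
  cbv beta in I1.
  rewrite (rint_plus _ _ _ _ D1 D2), HI, Rplus_0_l in I1.
  assert (I2 := rint_bound _ _ D2). apply Rle_trans with (1 := Rle_abs _) in I2.
  assert (I3 : a / Lam <= RInt (fun y => r y * P y + q / (1 + y ^ 2)) (y0 - e / Lam) (y0 + e / Lam)).
  { replace (a / Lam) with (RInt (fun _ => a / (2 * e)) (y0 - e / Lam) (y0 + e / Lam)).
    2:{ rewrite RInt_const. unfold scal; simpl; unfold mult; simpl. field. lra. }
    apply RInt_le; [lra|apply ex_RInt_const|apply ex_RInt_cont, D3|].
    intros y Hy.
    assert (Hyd : Rabs (y - y0) <= e / Lam) by (unfold Rabs; destruct Rcase_abs; lra).
    assert (Hed : e / Lam <= d).
    { apply Rmult_le_reg_r with Lam; auto. unfold Rdiv. rewrite Rmult_assoc, Rinv_l by lra.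
      generalize (Rmin_l (Lam * d) (a / Lam / 2 / ((K / eta ^ 2 + 1) * 4))). fold e. lra. }
    assert (Hthe : (th y - th y0) ^ 2 <= e ^ 2).
    { rewrite <- pow2_abs. apply pow_incr. split; [apply Rabs_pos|].
      apply Rle_trans with (1 := HL y ltac:(lra)).
      apply Rle_trans with (Lam * (e / Lam)); [apply Rmult_le_compat_l; lra|right; field; lra]. }
    assert (HPl : / (2 * e) <= P y).
    { replace (/ (2 * e)) with (e * / (e ^ 2 + e ^ 2)).
      2:{ field. nra. }
      unfold P, Rdiv. mono. }
    assert (0 <= q / (1 + y ^ 2)) by pos.
    assert (a * / (2 * e) <= r y * P y).
    { apply Rmult_le_compat; try lra. - left; apply Rinv_0_lt_compat; lra. - apply Hra; lra. }
    pos. }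
  assert (HPI := PI_4).
  assert (q * PI <= a / Lam / 2).
  { apply Rle_trans with (q * 4); [apply Rmult_le_compat_l; lra|].
    assert (e <= a / Lam / 2 / ((K / eta ^ 2 + 1) * 4)) by apply Rmin_r.
    apply Rle_trans with ((K / eta ^ 2 + 1) * 4 * e). { unfold q; nra. }
    apply Rle_trans with ((K / eta ^ 2 + 1) * 4 * (a / Lam / 2 / ((K / eta ^ 2 + 1) * 4))).
    - mono.
    - right. field. lra. }
  nra.
Qed.

Lemma cderive_Re g s l : cderive g s l -> is_derive (fun s => Re (g s)) s (Re l).
Proof. now intros []. Qed.

Definition ccont (g : R -> C) : Prop :=
  forall y, continuous (fun y => Re (g y)) y /\ continuous (fun y => Im (g y)) y.

Lemma ccont_const c : ccont (fun _ => c).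
Proof. intro y; split; apply continuous_const. Qed.

Lemma ccont_mult f g : ccont f -> ccont g -> ccont (fun y => f y * g y)%C.
Proof.
  intros Hf Hg y. destruct (Hf y), (Hg y). split; simpl.
  - apply @continuous_minus; apply continuous_mulR; auto.
  - apply @continuous_plus; apply continuous_mulR; auto.
Qed.

Lemma ccont_rder g dg : (forall y, cderive g y (dg y)) -> ccont g.
Proof. intros H y. destruct (H y). split; eapply continuous_derive; eauto. Qed.

Lemma ccont_Re g : ccont g -> forall y, continuous (fun y => Re (g y)) y.
Proof. intros H y; apply H. Qed.

Lemma ccont_pair (u v : R -> R) : (forall y, continuous u y) -> (forall y, continuous v y) ->
  ccont (fun y => (u y, v y)).
Proof. intros H1 H2 y; split; auto. Qed.

Lemma continuous_exp_comp (u : R -> R) y : continuous u y -> continuous (fun y => exp (u y)) y.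
Proof.
  intro H. apply (continuous_comp u exp); auto. apply continuous_exp.
Qed.

Lemma ccont_cexp g : ccont g -> ccont (fun y => cexp (g y)).
Proof.
  intros H y. destruct (H y) as [H1 H2]. unfold cexp. split; simpl.
  - apply continuous_mulR.
    + now apply continuous_exp_comp.
    + apply (continuous_comp (fun y => Im (g y)) cos); auto.
      apply (continuous_derive _ _ (- sin (Im (g y)))), is_derive_Reals, derivable_pt_lim_cos.
  - apply continuous_mulR.
    + now apply continuous_exp_comp.
    + apply (continuous_comp (fun y => Im (g y)) sin); auto.
      apply (continuous_derive _ _ (cos (Im (g y)))), is_derive_Reals, derivable_pt_lim_sin.
Qed.

Lemma continuous_Rinv_fun (u : R -> R) y : continuous u y -> u y <> 0 -> continuous (fun y => / u y) y.
Proof. intros H Hn. apply continuity_pt_filterlim. apply continuity_pt_inv; auto.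
now apply continuity_pt_filterlim in H. Qed.

Lemma ccont_inv g : ccont g -> (forall y, g y <> 0) -> ccont (fun y => / g y)%C.
Proof.
  intros H Hn y. destruct (H y) as [H1 H2]. assert (Hy := Csq_pos _ (Hn y)).
  assert (D : continuous (fun y => / (Re (g y) ^ 2 + Im (g y) ^ 2)) y).
  { apply continuous_Rinv_fun; [|lra]. simpl. apply @continuous_plus;
    apply continuous_mulR; auto;
    apply continuous_mulR; auto; apply continuous_const. }
  split; simpl; unfold Rdiv.
  - apply continuous_mulR; auto.
  - apply continuous_mulR; auto. apply @continuous_opp. auto.
Qed.

Lemma dom_Re (K : R) (g : R -> C) : ccont g -> (forall y, Cmod (g y) <= K / (1 + y ^ 2)) ->
  dom K (fun y => Re (g y)).
Proof.
  intros Hc Hb. split; [now apply ccont_Re|]. intro y. apply Rle_trans with (2 := Hb y), re_le_Cmod.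
Qed.

Lemma is_derive_0_const (f : R -> R) (a b : R) : a <= b ->
  (forall s, a <= s <= b -> is_derive f s 0) -> f b = f a.
Proof.
  intros Hab H. destruct (MVT_gen f a b (fun _ => 0)) as [c [_ E]].
  - rewrite Rmin_left, Rmax_right by auto. intros s Hs. apply H. lra.
  - rewrite Rmin_left, Rmax_right by auto. intros s Hs.
    apply continuity_pt_filterlim, (continuous_derive _ _ 0). auto.
  - lra.
Qed.

Lemma Re_opp_mult (k z : C) : Re (- k * z) = - Re (k * z).
Proof. unfold Re; simpl; ring. Qed.

(* [b t := rint Re (k e^{-tD} / D rho)], with [D = eps - i sg (th - th0)], has derivative 0 by the
   hypothesis and tends to 0, so [b 0 = 0]. *)
Lemma fourier_half_kernel (rho : R -> C) (th : R -> R) (K th0 eps sg : R) (k : C) :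
  ccont rho -> (forall y, continuous th y) ->
  (forall y, Cmod (rho y) <= K / (1 + y ^ 2)) ->
  (forall y, Cmod (rho y) * Rabs (th y) <= K / (1 + y ^ 2)) ->
  (forall (k : C) (t : R), rint (fun y => Re (k * (cexp (0, t * th y)%R * rho y))) = 0) ->
  0 < eps -> Rabs sg = 1 ->
  rint (fun y => Re (k * (/ (eps, - sg * (th y - th0))%R * rho y))%C) = 0.
Proof.
  intros Hc Hth Hb Hb' H He Hsg.
  set (D := fun y => (eps, - sg * (th y - th0)) : C).
  assert (HK : 0 <= K).
  { generalize (Hb 0) (Cmod_ge_0 (rho 0)). pos. }
  assert (HDc : ccont D).
  { apply ccont_pair; [intro; apply continuous_const|]. intro y.
    apply continuous_mulR; [apply continuous_const|].
    apply @continuous_minus; [auto|apply continuous_const]. }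
  assert (HD1 : forall y, eps <= Cmod (D y)).
  { intro y. apply Rle_trans with (2 := re_le_Cmod (D y)). simpl. apply Rle_abs. }
  assert (HD0 : forall y, D y <> 0).
  { intro y. apply Cmod_gt_0. specialize (HD1 y). lra. }
  assert (HD2 : forall y, Cmod (D y) <= eps + Rabs (th y) + Rabs th0).
  { intro y. apply Rle_trans with (1 := Cmod_le_sum _). simpl. rewrite (Rabs_right eps) by lra.
    rewrite Rabs_mult, Rabs_Ropp, Hsg. unfold Rminus. generalize (Rabs_triang (th y) (- th0)).
    rewrite Rabs_Ropp. lra. }
  assert (HE : forall (t : R) y, Cmod (cexp (- t * D y)) = exp (- (t * eps))).
  { intros t y. rewrite Cmod_cexp. f_equal. unfold Re; simpl. ring. }
  assert (Hec : forall t : R, ccont (fun y => cexp (- t * D y)%C)).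
  { intro t. apply ccont_cexp, ccont_mult; auto. apply ccont_const. }
  assert (Hic : ccont (fun y => / D y)%C) by now apply ccont_inv.
  assert (Hi : forall y, Cmod (/ D y) <= / eps).
  { intro y. rewrite Cmod_inv by auto. mono. }
  set (b := fun (t : R) y => (k * (cexp (- t * D y) * (/ D y * rho y)))%C).
  assert (Hbnd : forall (t : R) y, Cmod (b t y) <= (Cmod k * exp (- (t * eps)) * / eps * K) / (1 + y ^ 2)).
  { intros t y. unfold b. rewrite 3!Cmod_mult, HE.
    replace (Cmod k * exp (- (t * eps)) * / eps * K / (1 + y ^ 2)) with
      (Cmod k * (exp (- (t * eps)) * (/ eps * (K / (1 + y ^ 2)))))
      by pos.
    mono. }
  assert (Hdb : forall t : R, dom (Cmod k * exp (- (t * eps)) * / eps * K) (fun y => Re (b t y))).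
  { intros t. apply dom_Re; auto. unfold b. apply ccont_mult; [apply ccont_const|].
    apply ccont_mult; auto. now apply ccont_mult. }
  (* Differentiation in [t] cancels the denominator [D]. The part of [e^(-tD)] independent of [y]
     joins the multiplier, leaving the hypothesis at frequency [t * sg]. *)
  assert (Hder0 : forall t : R, rint (fun y => Re (- k * (cexp (- t * D y) * rho y))%C) = 0).
  { intro t. rewrite <- (H (- k * cexp (- t * (eps, sg * th0)%R))%C (t * sg)).
    apply rint_ext. intro y. f_equal.
    replace (cexp (- t * D y)) with (cexp (- t * (eps, sg * th0)%R) * cexp (0, t * sg * th y)%R)%C; [ring|].
    rewrite <- cexp_add. f_equal. unfold D. Cext. }
  assert (Hder : forall t, 0 <= t -> is_derive (fun t => rint (fun y => Re (b t y))) t 0).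
  { intros t Ht. rewrite <- (Hder0 t).
    apply (rint_diff (fun t y => Re (b t y)) (fun (t : R) y => Re (- k * (cexp (- t * D y) * rho y))%C)
       (fun (t : R) y => Re (k * (cexp (- t * D y) * (D y * rho y)))%C) t 1
       (Cmod k * exp eps * / eps * K) (Cmod k * exp eps * K) (Cmod k * exp eps * ((eps + Rabs th0) * K + K))).
    - lra.
    - intros s Hs. apply dom_le with (2 := Hdb s).
      apply Rmult_le_compat_r; auto. apply Rmult_le_compat_r; [left; now apply Rinv_0_lt_compat|].
      apply Rmult_le_compat_l; [apply Cmod_ge_0|].
      assert (- (s * eps) < eps) by (unfold Rabs in Hs; destruct Rcase_abs in Hs; nra).
      left. mono.
    - apply dom_Re.
      + apply ccont_mult; [apply ccont_const|]. now apply ccont_mult.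
      + intro y. rewrite 2!Cmod_mult, HE, Cmod_opp. unfold Rdiv. rewrite 2!Rmult_assoc.
        apply Rmult_le_compat_l; [apply Cmod_ge_0|]. apply Rmult_le_compat; auto using Cmod_ge_0.
        * pos.
        * assert (- (t * eps) <= eps) by nra.
          destruct H0 as [H0|H0]; [left; now apply exp_increasing|rewrite H0; lra].
    - intros s y _. apply cderive_Re. unfold b.
      eapply cderive_eq.
      + apply cderive_scal. apply cderive_mult; [|apply cderive_const].
        apply cderive_cexp. apply (cderive_ext (fun t : R => 0 + t * (- D y))%C); [intro; ring|].
        apply cderive_line.
      + cbv beta. field. auto.
    - intros s y _. apply cderive_Re. eapply cderive_eq.
      + apply cderive_scal. apply cderive_mult; [|apply cderive_const].
        apply cderive_cexp. apply (cderive_ext (fun t : R => 0 + t * (- D y))%C); [intro; ring|].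
        apply cderive_line.
      + cbv beta. ring.
    - intros s y Hs. apply Rle_trans with (1 := re_le_Cmod _). rewrite 3!Cmod_mult, HE. unfold Rdiv.
      rewrite 2!Rmult_assoc.
      apply Rmult_le_compat_l; [apply Cmod_ge_0|].
      assert (- (s * eps) < eps) by (unfold Rabs in Hs; destruct Rcase_abs in Hs; nra).
      apply Rmult_le_compat.
      + pos.
      + pos.
      + left; now apply exp_increasing.
      + rewrite Rmult_plus_distr_r. apply Rle_trans with ((eps + Rabs (th y) + Rabs th0) * Cmod (rho y)).
        * mono.
        * specialize (Hb y). specialize (Hb' y). unfold Rdiv in *.
          assert (0 <= eps + Rabs th0) by pos.
          nra. }
  assert (Hcst : forall t, 0 <= t -> rint (fun y => Re (b t y)) = rint (fun y => Re (b 0 y))).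
  { intros t Ht. apply (is_derive_0_const (fun t => rint (fun y => Re (b t y)))); auto.
    intros; apply Hder; lra. }
  assert (E0 : rint (fun y => Re (k * (/ D y * rho y))%C) = rint (fun y => Re (b 0 y))).
  { apply rint_ext. intro y. unfold b. f_equal. f_equal.
    replace (- 0%R * D y)%C with (RtoC 0) by ring. rewrite cexp_0. ring. }
  unfold D in E0. rewrite E0. fold D.
  apply Rabs_eq_0, Rle_antisym; [|apply Rabs_pos].
  set (A := Cmod k * / eps * K * PI).
  assert (HA : 0 <= A).
  { unfold A. pos. }
  apply Rnot_lt_le. intro Hn.
  set (r := Rabs (rint (fun y => Re (b 0 y)))) in *.
  (* The constant value [r] is at most [A e^(-t eps)] for every [t >= 0]. At [t = A / (r eps)] this
     contradicts [e^(-x) (1 + x) <= 1] with [x = A / r]. *)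
  assert (Ht : 0 <= A / r / eps).
  { pos. }
  assert (HB := rint_bound _ _ (Hdb (A / r / eps))). rewrite (Hcst _ Ht) in HB. fold r in HB.
  assert (X : exp (- (A / r / eps * eps)) * (1 + A / r) <= 1).
  { replace (A / r / eps * eps) with (A / r) by (field; lra).
    rewrite exp_Ropp. apply Rmult_le_reg_l with (exp (A / r)); [apply exp_pos|].
    rewrite <- Rmult_assoc, Rinv_r by pos.
    generalize (exp_ineq1_le (A / r)). lra. }
  replace (Cmod k * exp (- (A / r / eps * eps)) * / eps * K * PI) with
   (A * exp (- (A / r / eps * eps))) in HB by (unfold A; ring).
  set (x := exp (- (A / r / eps * eps))) in *.
  assert (r * (1 + A / r) = r + A) by (field; lra).
  assert (0 < x) by apply exp_pos.
  assert (0 <= A / r) by pos.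
  assert (r * (1 + A / r) <= A * (x * (1 + A / r))) by nra.
  nra.
Qed.

(** A general increasing phase covers both uses: [th y = y] on the lines [Re w = c], and [th = exp]
    for Laplace transforms in logarithmic variable. The bound on [rho * th] allows differentiation
    in [t]. *)
Lemma fourier_unique (rho : R -> C) (th dth : R -> R) (K : R) :
  ccont rho -> (forall y, is_derive th y (dth y)) -> (forall x y, x < y -> th x < th y) ->
  (forall y, Cmod (rho y) <= K / (1 + y ^ 2)) ->
  (forall y, Cmod (rho y) * Rabs (th y) <= K / (1 + y ^ 2)) ->
  (forall (k : C) (t : R), rint (fun y => Re (k * (cexp (0, t * th y)%R * rho y))) = 0) ->
  forall y, rho y = 0.
Proof.
  intros Hc Hth Hinc Hb Hb' H y0.
  assert (HK : 0 <= K).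
  { generalize (Hb 0) (Cmod_ge_0 (rho 0)). pos. }
  assert (Hthc : forall y, continuous th y) by (intro; eapply continuous_derive; eauto).
  assert (HR : forall k : C, Re (k * rho y0) <= 0).
  { intro k.
    assert (Hd := is_derive_eps th y0 (dth y0)). destruct Hd as [Hd _]. specialize (Hd (Hth y0) 1 Rlt_0_1).
    destruct Hd as [d [Hd0 Hd]].
    apply (poisson_limit (Cmod k * K) (Rabs (dth y0) + 1) y0 (fun y => Re (k * rho y)) th); auto.
    - apply dom_Re. { apply ccont_mult; auto. apply ccont_const. }
      intro y. rewrite Cmod_mult. unfold Rdiv. rewrite Rmult_assoc.
      mono.
    - pos.
    - exists d; split; auto. intros y Hy. specialize (Hd (y - y0) Hy).
      replace (y0 + (y - y0)) with y in Hd by ring.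
      replace (th y - th y0) with ((th y - th y0 - (y - y0) * dth y0) + (y - y0) * dth y0) by ring.
      apply Rle_trans with (1 := Rabs_triang _ _). rewrite Rabs_mult. lra.
    - intros e He.
      assert (H1 := fourier_half_kernel rho th K (th y0) e 1 k Hc Hthc Hb Hb' H He (Rabs_R1)).
      assert (Rm : Rabs (-1) = 1) by (rewrite Rabs_left; lra).
      assert (H2 := fourier_half_kernel rho th K (th y0) e (-1) k Hc Hthc Hb Hb' H He Rm).
      assert (HD : forall sg, Rabs sg = 1 -> dom (Cmod k * / e * K) (fun y => Re (k * (/ (e, - sg * (th y - th
        y0))%R * rho y))%C)).
      { intros sg Hsg.
        assert (Hne : forall y, ((e, - sg * (th y - th y0)) : C) <> 0).
        { intros y E. apply (f_equal Re) in E. simpl in E. lra. }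
        apply dom_Re.
        - apply ccont_mult; [apply ccont_const|]. apply ccont_mult; auto. apply ccont_inv; auto.
          apply ccont_pair; [intro; apply continuous_const|]. intro y.
          apply continuous_mulR; [apply continuous_const|].
          apply @continuous_minus; [auto|apply continuous_const].
        - intro y. rewrite 2!Cmod_mult. unfold Rdiv. rewrite 2!Rmult_assoc.
          apply Rmult_le_compat_l; [apply Cmod_ge_0|].
          apply Rmult_le_compat; auto using Cmod_ge_0.
          rewrite Cmod_inv by auto. apply Rinv_le_contravar; auto.
          apply Rle_trans with (2 := re_le_Cmod _). simpl. apply Rle_abs. }
      assert (H3 := rint_plus _ _ _ _ (HD 1 Rabs_R1) (HD (-1) Rm)). cbv beta in H3. rewrite H1, H2 in H3.
      rewrite Rplus_0_l in H3.
      assert (D3 := dom_plus _ _ _ _ (HD 1 Rabs_R1) (HD (-1) Rm)). cbv beta in D3.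
      (* The kernels for [sg = 1] and [sg = -1] add up to twice the Poisson kernel. *)
      replace 0 with (/ 2 * 0) by ring. rewrite <- H3. rewrite <- (rint_scal _ _ _ D3).
      apply rint_ext. intro y.
      assert (P : 0 < e ^ 2 + (th y - th y0) ^ 2).
      { pos. }
      unfold Re; simpl. simpl in P. field. lra. }
  assert (Z : forall k : C, Re (k * rho y0) = 0).
  { intro k. apply Rle_antisym; auto. generalize (HR (- k)%C). rewrite Re_opp_mult. lra. }
  apply C_eq.
  - rewrite <- (Z 1). simpl. unfold Re. ring.
  - generalize (Z Ci). unfold Re, Im; simpl. lra.
Qed.

(** * The Borel transform of a flat function *)

Definition vline (c y : R) : C := (c, y).

Lemma cderive_vline_y c y : cderive (vline c) y Ci.
Proof. split; unfold vline; simpl; auto_derive; auto. Qed.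

Lemma cderive_vline_c c y : cderive (fun c => vline c y) c 1.
Proof. split; unfold vline; simpl; auto_derive; auto. Qed.

Lemma vline_ne_0 c y : 0 < c -> vline c y <> 0.
Proof. intros H E. apply (f_equal Re) in E. simpl in E. lra. Qed.

Lemma Cmod_vline_ge c y : 0 < c -> c <= Cmod (vline c y).
Proof. intro H. apply Rle_trans with (2 := re_le_Cmod _). apply Rle_abs. Qed.

Lemma Cmod_vline_inv_sq c y : 0 < c -> (/ Cmod (vline c y)) ^ 2 <= (1 + / c ^ 2) / (1 + y ^ 2).
Proof.
  intro H. rewrite pow_inv. rewrite Cmod2_alt. simpl Re. simpl Im.
  assert (Hy := one_plus_sq_pos y). assert (Hc := pow_lt c 2 H). assert (Hy2 := pow2_ge_0 y).
  assert (0 < / c ^ 2) by now apply Rinv_0_lt_compat.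
  apply Rmult_le_reg_r with (c ^ 2 + y ^ 2); [lra|]. rewrite Rinv_l by lra.
  apply Rmult_le_reg_r with (1 + y ^ 2); auto.
  replace ((1 + / c ^ 2) / (1 + y ^ 2) * (c ^ 2 + y ^ 2) * (1 + y ^ 2)) with
    (c ^ 2 + y ^ 2 + (1 + / c ^ 2 * y ^ 2)) by (field; lra).
  nra.
Qed.

Lemma Re_inv_pos (w : C) : 0 < Re w -> 0 < Re (/ w).
Proof.
  intro H. simpl. assert (w <> 0). { intro E. rewrite E in H. simpl in H. lra. }
  apply Csq_pos in H0. pos.
Qed.

Section Flat.
Variables (F : nat -> C -> C) (B : nat -> R).
Hypothesis HF : forall p u, 0 < Re u -> @is_derive C_AbsRing C_NormedModule (F p) u (F (S p) u).
Hypothesis HB : forall p u, 0 < Re u -> Cmod (F p u) <= B p.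
Hypothesis H0 : forall p e, 0 < e -> exists d, 0 < d /\
  forall u, 0 < Re u -> Cmod u < d -> Cmod (F p u) <= e.

Lemma majorant_ge_0 p : 0 <= B p.
Proof. apply Rle_trans with (2 := HB p 1 Rlt_0_1). pos. Qed.

(** Mean value along the ray from [r u] to [u], with [r] so small that [F p (r u)] is negligible.
    The [1 / k!] of Taylor's formula is given up. *)
Lemma flat k : forall p u, 0 < Re u -> Cmod (F p u) <= Cmod u ^ k * B (p + k)%nat.
Proof.
  induction k as [|k IH]; intros p u Hu.
  - rewrite Nat.add_0_r. simpl. rewrite Rmult_1_l. auto.
  - apply le_epsilon. intros e He. destruct (H0 p e He) as [d [Hd Hsm]].
    assert (Hu0 := Cmod_ge_0 u).
    set (r := Rmin 1 (d / (Cmod u + 1) / 2)).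
    assert (Hr : 0 < r). { apply Rmin_pos; [lra|]. pos. }
    assert (Hr1 : r <= 1) by apply Rmin_l.
    assert (Hrd : r * Cmod u < d).
    { apply Rle_lt_trans with (d / (Cmod u + 1) / 2 * (Cmod u + 1)).
      - apply Rmult_le_compat; try lra. apply Rmin_r.
      - replace (d / (Cmod u + 1) / 2 * (Cmod u + 1)) with (d / 2) by (field; lra). lra. }
    assert (HR : forall s, r <= s <= 1 -> 0 < Re (0 + s * u)%C).
    { intros s Hs. unfold Re in *; simpl. nra. }
    assert (HM := Cmod_MVT (fun s => F p (0 + s * u)%C) (fun s => F (S p) (0 + s * u)%C * u)%C r 1
      (Cmod u ^ k * B (p + S k)%nat * Cmod u) Hr1).
    cbv beta in HM.
    assert (X : Cmod (F p (0 + 1%R * u) - F p (0 + r * u)) <= Cmod u ^ k * B (p + S k)%nat * Cmod u * (1 - r)).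
    { apply HM.
      - intros s Hs. apply cderive_chain; [apply HF; auto|apply cderive_line].
      - intros s Hs. rewrite Cmod_mult. apply Rmult_le_compat_r; auto.
        apply Rle_trans with (1 := IH (S p) _ (HR s Hs)).
        replace (S p + k)%nat with (p + S k)%nat by lia. apply Rmult_le_compat_r; [apply majorant_ge_0|].
        apply pow_incr. split; [apply Cmod_ge_0|]. rewrite Cplus_0_l, Cmod_mult, Cmod_R, Rabs_right by lra.
        nra. }
    replace (0 + 1%R * u)%C with u in X by ring.
    replace (F p u) with ((F p u - F p (0 + r * u)) + F p (0 + r * u))%C by ring.
    apply Rle_trans with (1 := Cmod_triangle _ _). apply Rplus_le_compat.
    + apply Rle_trans with (1 := X). simpl.
      assert (0 <= Cmod u ^ k * B (p + S k)%nat * Cmod u).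
      { apply Rmult_le_pos; auto. apply Rmult_le_pos; [now apply pow_le|apply majorant_ge_0]. }
      nra.
    + apply Hsm. { apply HR; lra. } rewrite Cplus_0_l, Cmod_mult, Cmod_R, Rabs_right by lra. auto.
Qed.

(* [w] runs over a line [Re w = c], so that [/ w] runs over a circle tangent to the imaginary axis at [0]. *)
Definition bker (t : R) (a b : nat) (w : C) : C := (cexp (t * w) * ((/ w) ^ a * F b (/ w)))%C.

(** Flatness of order [k] at [/ w] buys [k] further powers of [/ w] at the price [B (b + k)]. *)
Lemma bker_bound t a b k w : 0 < Re w ->
  Cmod (bker t a b w) <= exp (t * Re w) * (/ Cmod w) ^ (a + k) * B (b + k)%nat.
Proof.
  intro Hw. assert (w <> 0). { intro E. rewrite E in Hw. simpl in Hw. lra. }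
  unfold bker. rewrite 2!Cmod_mult, Cmod_cexp, Cmod_pow, Cmod_inv by auto.
  replace (Re (t * w)) with (t * Re w) by (unfold Re; simpl; ring).
  rewrite Rmult_assoc. apply Rmult_le_compat_l; [left; apply exp_pos|].
  rewrite pow_add, Rmult_assoc. apply Rmult_le_compat_l.
  { apply pow_le. left. apply Rinv_0_lt_compat. now apply Cmod_gt_0. }
  rewrite <- Cmod_inv by auto. apply flat. now apply Re_inv_pos.
Qed.

(** Two powers of [/ w] pay for integrability over the line; the other [j] are bounded by
    [c^(-j)]. *)
Lemma bker_line t a b k j c y : 0 < c -> (a + k = 2 + j)%nat ->
  Cmod (bker t a b (vline c y)) <= exp (t * c) * (/ c) ^ j * B (b + k)%nat * (1 + / c ^ 2) / (1 + y ^ 2).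
Proof.
  intros Hc Hj. apply Rle_trans with (1 := bker_bound t a b k (vline c y) Hc).
  rewrite Hj. simpl Re. unfold Rdiv.
  replace (exp (t * c) * (/ c) ^ j * B (b + k)%nat * (1 + / c ^ 2) * / (1 + y ^ 2)) with
    (exp (t * c) * (((1 + / c ^ 2) / (1 + y ^ 2)) * (/ c) ^ j) * B (b + k)%nat) by (unfold Rdiv; ring).
  apply Rmult_le_compat_r; [apply majorant_ge_0|]. apply Rmult_le_compat_l; [left; apply exp_pos|].
  assert (HL := Cmod_vline_ge c y Hc).
  assert (0 <= / Cmod (vline c y)) by pos.
  rewrite pow_add. apply Rmult_le_compat.
  - pos.
  - pos.
  - now apply Cmod_vline_inv_sq.
  - mono.
Qed.

(** The derivative of [bker t a b] in [w]; the last term contains the inner derivative [- w^(-2)] of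
    [F b (/ w)]. *)
Definition bker_der (t : R) (a b : nat) (w : C) : C :=
  (t * bker t a b w - INR a * bker t (S a) b w - bker t (S (S a)) (S b) w)%C.

Lemma cderive_bker t a b w s d : cderive w s d -> 0 < Re (w s) ->
  cderive (fun s => bker t a b (w s)) s (bker_der t a b (w s) * d).
Proof.
  intros Hw Hp. assert (w s <> 0). { intro E. rewrite E in Hp. simpl in Hp. lra. }
  assert (Hi := cderive_inv w s d Hw H).
  eapply cderive_eq.
  - unfold bker. apply cderive_mult; [apply cderive_cexp, cderive_scal, Hw|].
    apply cderive_mult; [apply cderive_pow, Hi|]. apply cderive_chain; [apply HF, Re_inv_pos, Hp|exact Hi].
  - cbv beta. unfold bker_der, bker. destruct a; simpl; field; auto.
Qed.

Lemma ccont_bker t a b c : 0 < c -> ccont (fun y => bker t a b (vline c y)).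
Proof.
  intro Hc. apply ccont_rder with (fun y => bker_der t a b (vline c y) * Ci)%C. intro y.
  apply cderive_bker; [apply cderive_vline_y|exact Hc].
Qed.

Lemma ccont_vline c : ccont (vline c).
Proof. apply ccont_rder with (fun _ => Ci). intro; apply cderive_vline_y. Qed.

Lemma dom_scal_Re (kap : C) K g : ccont g -> (forall y, Cmod (g y) <= K / (1 + y ^ 2)) ->
  dom (Cmod kap * K) (fun y => Re (kap * g y)).
Proof.
  intros Hc Hb. apply dom_Re.
  - apply ccont_mult; auto. apply ccont_const.
  - intro y. rewrite Cmod_mult. unfold Rdiv. rewrite Rmult_assoc.
    mono.
Qed.

Section Line.
Variables (kap : C) (c : R).
Hypothesis Hc : 0 < c.

(** [G_p], tested against [kap], which also absorbs the [i] of [dw = i dy]. [btrans1] and [btrans2]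
    turn out to be its first and second derivatives in [t]. *)
Definition btrans (p : nat) (t : R) : R := rint (fun y => Re (kap * bker t 1 p (vline c y))).
Definition btrans1 (p : nat) (t : R) : R := rint (fun y => Re (kap * bker t 0 p (vline c y))).
Definition btrans2 (p : nat) (t : R) : R := rint (fun y => Re (kap * (vline c y * bker t 0 p (vline c y)))).

(** Each derivative in [t] brings down a factor [w], paid for by one more order of flatness; two
    orders are kept for convergence. *)
Lemma bker_w t p m : forall k y, (k = 2 + m)%nat ->
  Cmod (vline c y ^ m * bker t 0 p (vline c y)) <= exp (t * c) * B (p + k)%nat * (1 + / c ^ 2) / (1 + y ^ 2).
Proof.
  intros k y Hk. rewrite Cmod_mult, Cmod_pow.
  assert (HL := Cmod_vline_ge c y Hc).
  assert (HLp : 0 < Cmod (vline c y)) by lra.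
  apply Rle_trans with (Cmod (vline c y) ^ m * (exp (t * c) * (/ Cmod (vline c y)) ^ (0 + k) * B (p + k)%nat)).
  - apply Rmult_le_compat_l; [apply pow_le; lra|]. apply (bker_bound t 0 p k (vline c y) Hc).
  - replace (0 + k)%nat with (m + 2)%nat by lia. rewrite pow_add.
    replace (Cmod (vline c y) ^ m * (exp (t * c) * ((/ Cmod (vline c y)) ^ m * (/ Cmod (vline c y)) ^ 2) * B
      (p + k)%nat))
     with (exp (t * c) * ((Cmod (vline c y) * / Cmod (vline c y)) ^ m * (/ Cmod (vline c y)) ^ 2) * B (p +
       k)%nat)
     by (rewrite Rpow_mult_distr; ring).
    rewrite Rinv_r, pow1, Rmult_1_l by lra.
    replace (exp (t * c) * B (p + k)%nat * (1 + / c ^ 2) / (1 + y ^ 2)) with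
      (exp (t * c) * ((1 + / c ^ 2) / (1 + y ^ 2)) * B (p + k)%nat) by (unfold Rdiv; ring).
    apply Rmult_le_compat_r; [apply majorant_ge_0|]. apply Rmult_le_compat_l; [left; apply exp_pos|].
    now apply Cmod_vline_inv_sq.
Qed.

Lemma cderive_bker_t a b (w : C) (t : R) : w <> 0 -> cderive (fun t => bker t (S a) b w) t (bker t a b w).
Proof.
  intro Hw. eapply cderive_eq.
  - unfold bker. apply cderive_mult; [|apply cderive_const]. apply cderive_cexp.
    apply (cderive_ext (fun t : R => 0 + t * w)%C); [intro; ring|apply cderive_line].
  - cbv beta. unfold bker. simpl. field. exact Hw.
Qed.

Lemma cderive_bker_t0 b w (t : R) : cderive (fun t => bker t 0 b w) t (w * bker t 0 b w).
Proof.
  eapply cderive_eq.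
  - unfold bker. apply cderive_mult; [|apply cderive_const]. apply cderive_cexp.
    apply (cderive_ext (fun t : R => 0 + t * w)%C); [intro; ring|apply cderive_line].
  - cbv beta. unfold bker. simpl. ring.
Qed.

Lemma exp_le_near (t s : R) : Rabs (s - t) < 1 -> exp (s * c) <= exp ((t + 1) * c).
Proof.
  intro H. left. apply exp_increasing. apply Rmult_lt_compat_r; auto.
  unfold Rabs in H; destruct Rcase_abs in H; lra.
Qed.

Lemma one_inv_pos : 0 < 1 + / c ^ 2.
Proof. assert (0 < / c ^ 2) by pos. lra. Qed.

Lemma bound_near (t s X y : R) : Rabs (s - t) < 1 -> 0 <= X ->
  exp (s * c) * X * (1 + / c ^ 2) / (1 + y ^ 2) <= exp ((t + 1) * c) * X * (1 + / c ^ 2) / (1 + y ^ 2).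
Proof.
  intros H HX. unfold Rdiv. apply Rmult_le_compat_r.
  - pos.
  - apply Rmult_le_compat_r; [left; apply one_inv_pos|]. apply Rmult_le_compat_r; auto.
    now apply exp_le_near.
Qed.

Lemma dom_btrans p t : dom (Cmod kap * (exp (t * c) * B (p + 1)%nat * (1 + / c ^ 2)))
  (fun y => Re (kap * bker t 1 p (vline c y))).
Proof.
  apply dom_scal_Re; [now apply ccont_bker|]. intro y.
  apply Rle_trans with (1 := bker_line t 1 p 1 0 c y Hc eq_refl). pos.
Qed.

Lemma btrans_derive p t : is_derive (btrans p) t (btrans1 p t).
Proof.
  unfold btrans, btrans1.
  apply (rint_diff (fun t y => Re (kap * bker t 1 p (vline c y))) (fun t y => Re (kap * bker t 0 p (vline c y)))
    (fun t y => Re (kap * (vline c y * bker t 0 p (vline c y)))) t 1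
    (Cmod kap * (exp ((t + 1) * c) * B (p + 1)%nat * (1 + / c ^ 2)))
    (Cmod kap * (exp (t * c) * B (p + 2)%nat * (1 + / c ^ 2)))
    (Cmod kap * (exp ((t + 1) * c) * B (p + 3)%nat * (1 + / c ^ 2)))).
  - lra.
  - intros s Hs. apply dom_le with (2 := dom_btrans p s). apply Rmult_le_compat_l; [apply Cmod_ge_0|].
    apply Rmult_le_compat_r; [left; apply one_inv_pos|]. apply Rmult_le_compat_r; [apply majorant_ge_0|].
    now apply exp_le_near.
  - apply dom_scal_Re; [now apply ccont_bker|]. intro y.
    generalize (bker_w t p 0 2 y eq_refl). simpl (vline c y ^ 0)%C. rewrite Cmult_1_l. auto.
  - intros s y _. apply cderive_Re, cderive_scal, cderive_bker_t, vline_ne_0, Hc.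
  - intros s y _. apply cderive_Re, cderive_scal, cderive_bker_t0.
  - intros s y Hs. apply Rle_trans with (1 := re_le_Cmod _). rewrite Cmod_mult. unfold Rdiv.
    rewrite Rmult_assoc.
    apply Rmult_le_compat_l; [apply Cmod_ge_0|].
    generalize (bker_w s p 1 3 y eq_refl). rewrite Cpow_1_r. intro X.
    apply Rle_trans with (1 := X). apply bound_near; auto. apply majorant_ge_0.
Qed.

Lemma btrans1_derive p t : is_derive (btrans1 p) t (btrans2 p t).
Proof.
  unfold btrans2, btrans1.
  assert (W : forall s y, Cmod (bker s 0 p (vline c y)) <= exp (s * c) * B (p + 2)%nat * (1 + / c ^ 2) / (1 +
    y ^ 2)).
  { intros s y. generalize (bker_w s p 0 2 y eq_refl). simpl (vline c y ^ 0)%C. rewrite Cmult_1_l. auto. }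
  apply (rint_diff (fun t y => Re (kap * bker t 0 p (vline c y))) (fun t y => Re (kap * (vline c y * bker t 0
    p (vline c y))))
    (fun t y => Re (kap * (vline c y * (vline c y * bker t 0 p (vline c y))))) t 1
    (Cmod kap * (exp ((t + 1) * c) * B (p + 2)%nat * (1 + / c ^ 2)))
    (Cmod kap * (exp (t * c) * B (p + 3)%nat * (1 + / c ^ 2)))
    (Cmod kap * (exp ((t + 1) * c) * B (p + 4)%nat * (1 + / c ^ 2)))).
  - lra.
  - intros s Hs. apply dom_scal_Re; [now apply ccont_bker|]. intro y. apply Rle_trans with (1 := W s y).
    apply bound_near; auto. apply majorant_ge_0.
  - apply dom_scal_Re. { apply ccont_mult; [apply ccont_vline|now apply ccont_bker]. } intro y.
    generalize (bker_w t p 1 3 y eq_refl). now rewrite Cpow_1_r.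
  - intros s y _. apply cderive_Re, cderive_scal, cderive_bker_t0.
  - intros s y _. apply cderive_Re, cderive_scal, cderive_scal, cderive_bker_t0.
  - intros s y Hs. apply Rle_trans with (1 := re_le_Cmod _). rewrite Cmod_mult. unfold Rdiv.
    rewrite Rmult_assoc.
    apply Rmult_le_compat_l; [apply Cmod_ge_0|].
    generalize (bker_w s p 2 4 y eq_refl). replace (vline c y ^ 2 * bker s 0 p (vline c y))%C with
     (vline c y * (vline c y * bker s 0 p (vline c y)))%C by (simpl; ring). intro X.
    apply Rle_trans with (1 := X). apply bound_near; auto. apply majorant_ge_0.
Qed.

Lemma Re_mult_Ci (a z : C) : Im (a * (z * Ci)) = Re (a * z).
Proof. unfold Re, Im; simpl; ring. Qed.

(* Integration by parts: [d/dw (w e^{tw} F_p(1/w)) = (1 + t w) e^{tw} F_p(1/w) - w^{-1} e^{tw} F_{p+1}(1/w)]. *)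
Lemma btrans_recurrence p t : btrans1 p t + t * btrans2 p t = btrans (S p) t.
Proof.
  assert (W : forall y, Cmod (bker t 0 p (vline c y)) <= exp (t * c) * B (p + 2)%nat * (1 + / c ^ 2) / (1 + y
    ^ 2)).
  { intros y. generalize (bker_w t p 0 2 y eq_refl). simpl (vline c y ^ 0)%C. rewrite Cmult_1_l. auto. }
  assert (D1 : dom (Cmod kap * (exp (t * c) * B (p + 2)%nat * (1 + / c ^ 2))) (fun y => Re (kap * bker t 0 p
    (vline c y)))).
  { apply dom_scal_Re; [now apply ccont_bker|auto]. }
  assert (D2 : dom (Cmod kap * (exp (t * c) * B (p + 3)%nat * (1 + / c ^ 2))) (fun y => Re (kap * (vline c y *
    bker t 0 p (vline c y))))).
  { apply dom_scal_Re. { apply ccont_mult; [apply ccont_vline|now apply ccont_bker]. } intro y.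
    generalize (bker_w t p 1 3 y eq_refl). now rewrite Cpow_1_r. }
  assert (D3 := dom_btrans (S p) t).
  unfold btrans1, btrans2, btrans.
  assert (D4 := dom_scal _ t _ D2).
  apply Rminus_diag_uniq. rewrite <- (rint_scal _ t _ D2), <- (rint_plus _ _ _ _ D1 D4).
  assert (D5 := dom_plus _ _ _ _ D1 D4). rewrite <- (rint_minus _ _ _ _ D5 D3).
  (* Along the line [dw = i dy], so the real part of the [w]-derivative is the [y]-derivative of an
     imaginary part. *)
  apply (rint_derive _ (Cmod kap * (exp (t * c) * B (p + 2)%nat))
    (fun y => Im (kap * (vline c y * bker t 0 p (vline c y))))%C _ (dom_minus _ _ _ _ D5 D3)).
  - intro y.
    assert (HD := cderive_scal kap _ y _ (cderive_mult _ _ _ _ _ (cderive_vline_y c y) (cderive_bker t 0 p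
      (vline c) y _ (cderive_vline_y c y) Hc))).
    destruct HD as [_ HD]. evar_last; [exact HD|].
    assert (Hn := vline_ne_0 c y Hc).
    replace (Ci * bker t 0 p (vline c y) + vline c y * (bker_der t 0 p (vline c y) * Ci))%C with
      ((bker t 0 p (vline c y) + vline c y * (t * bker t 0 p (vline c y)) - bker t 1 (S p) (vline c y)) * Ci)%C.
    2:{ unfold bker_der, bker. simpl. field. auto. }
    rewrite Re_mult_Ci. unfold Re; simpl. ring.
  - intro y. assert (HL := Cmod_vline_ge c y Hc).
    apply Rle_trans with ((Cmod kap * (Cmod (vline c y) * Cmod (bker t 0 p (vline c y)))) * Cmod (vline c y)).
    + apply Rmult_le_compat; auto using Rabs_pos.
      * rewrite <- 2!Cmod_mult. apply im_le_Cmod.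
      * apply (im_le_Cmod (vline c y)).
    + rewrite 2!Rmult_assoc. apply Rmult_le_compat_l; [apply Cmod_ge_0|].
      replace (exp (t * c) * B (p + 2)%nat) with (Cmod (vline c y) * ((exp (t * c) * (/ Cmod (vline c y)) ^ (0
        + 2) * B (p + 2)%nat) * Cmod (vline c y))).
      * apply Rmult_le_compat_l; [lra|]. apply Rmult_le_compat_r; [lra|].
        apply (bker_bound t 0 p 2 (vline c y) Hc).
      * simpl. field. lra.
Qed.
End Line.

(* Moving the line of integration to the right: [btrans] does not depend on [c], and is small for [c] large. *)
Lemma btrans_shift kap c p t : 0 < c -> t <= 0 -> btrans kap c p t = 0.
Proof.
  intros Hc Ht.
  (* This is where [t <= 0] enters: [e^(ts) <= 1] however far to the right the line is. *)
  assert (HE : forall s a b y, 0 < s -> Cmod (bker t a b (vline s y)) <= (/ s) ^ a * B (b + 2)%nat * (1 + / s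
    ^ 2) / (1 + y ^ 2)).
  { intros s a b y Hs. apply Rle_trans with (1 := bker_line t a b 2 a s y Hs ltac:(lia)).
    unfold Rdiv. apply Rmult_le_compat_r; [apply cauchy_weight_ge_0|].
    apply Rmult_le_compat_r; [left; now apply one_inv_pos|]. apply Rmult_le_compat_r; [apply majorant_ge_0|].
    rewrite <- (Rmult_1_l ((/ s) ^ a)) at 2. apply Rmult_le_compat_r.
    - pos.
    - rewrite <- exp_0. destruct (Req_dec (t * s) 0) as [->|]; [lra|]. left. apply exp_increasing. nra. }
  set (Edd := fun a b w => (t * bker_der t a b w - INR a * bker_der t (S a) b w - bker_der t (S (S a)) (S b)
    w)%C).
  assert (Hrd : forall a b w s d, cderive w s d -> 0 < Re (w s) -> cderive (fun s => bker_der t a b (w s)) s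
    (Edd a b (w s) * d)%C).
  { intros a b w s d Hw Hp. unfold bker_der, Edd.
    apply (cderive_ext (fun s => t * bker t a b (w s) + (- INR a * bker t (S a) b (w s) + - (1) * bker t (S (S
      a)) (S b) (w s)))%C); [intro; ring|].
    eapply cderive_eq.
    - apply cderive_plus; [apply cderive_scal, cderive_bker; eauto|].
      apply cderive_plus; apply cderive_scal, cderive_bker; eauto.
    - ring. }
  (* In place of Cauchy's theorem: the derivative of the kernel in the abscissa is [bker_der], its
     derivative in [y] is [i] times that, so the integral of [bker_der] is a vanishing boundary
     term. *)
  assert (Hder : forall s, 0 < s -> is_derive (fun s => btrans kap s p t) s 0).
  { intros s Hs.
    (* Uniform for [|r - s| < s / 2], where [/ r <= 2 / s]. *)
    set (M := fun a b => (2 / s) ^ a * B (b + 2)%nat * (1 + / (s / 2) ^ 2)).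
    assert (HM : forall r a b y, Rabs (r - s) < s / 2 -> Cmod (bker t a b (vline r y)) <= M a b / (1 + y ^ 2)).
    { intros r a b y Hr. assert (Hr' : s / 2 <= r) by (unfold Rabs in Hr; destruct Rcase_abs in Hr; lra).
      apply Rle_trans with (1 := HE r a b y ltac:(lra)). unfold M, Rdiv.
      apply Rmult_le_compat_r; [apply cauchy_weight_ge_0|].
      apply Rmult_le_compat.
      - apply Rmult_le_pos; [|apply majorant_ge_0]. pos.
      - pos.
      - apply Rmult_le_compat_r; [apply majorant_ge_0|]. apply pow_incr. split.
        + pos.
        + replace (2 * / s) with (/ (s / 2)) by (field; lra). mono.
      - mono. }
    assert (Hcomb : forall (n : nat) (z1 z2 z3 : C) (B1 B2 B3 y : R), Cmod z1 <= B1 / (1 + y ^ 2) ->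
      Cmod z2 <= B2 / (1 + y ^ 2) -> Cmod z3 <= B3 / (1 + y ^ 2) ->
      Cmod (t * z1 - INR n * z2 - z3) <= (Rabs t * B1 + INR n * B2 + B3) / (1 + y ^ 2)).
    { intros n z1 z2 z3 B1 B2 B3 y H1 H2 H3. unfold Cminus. apply Rle_trans with (1 := Cmod_triangle _ _).
      unfold Rdiv. rewrite Rmult_plus_distr_r, Cmod_opp. apply Rplus_le_compat; auto.
      apply Rle_trans with (1 := Cmod_triangle _ _).
      rewrite Rmult_plus_distr_r, Cmod_opp, 2!Cmod_mult, 2!Cmod_R.
      rewrite (Rabs_right (INR n)) by (apply Rle_ge, pos_INR). rewrite 2!Rmult_assoc.
      mono. }
    set (M1 := fun a b => Rabs t * M a b + INR a * M (S a) b + M (S (S a)) (S b)).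
    assert (HM1 : forall r a b y, Rabs (r - s) < s / 2 -> Cmod (bker_der t a b (vline r y)) <= M1 a b / (1 + y
      ^ 2)).
    { intros r a b y Hr. unfold bker_der. apply Hcomb; apply HM; auto. }
    set (M2 := fun a b => Rabs t * M1 a b + INR a * M1 (S a) b + M1 (S (S a)) (S b)).
    assert (HM2 : forall r a b y, Rabs (r - s) < s / 2 -> Cmod (Edd a b (vline r y)) <= M2 a b / (1 + y ^ 2)).
    { intros r a b y Hr. unfold Edd. apply Hcomb; apply HM1; auto. }
    assert (Hss : Rabs (s - s) < s / 2) by (rewrite Rminus_diag, Rabs_R0; lra).
    assert (HcEd : ccont (fun y => bker_der t 1 p (vline s y))).
    { apply ccont_rder with (fun y => Edd 1%nat p (vline s y) * Ci)%C. intro y.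
      apply Hrd; [apply cderive_vline_y|exact Hs]. }
    assert (D1 : dom (Cmod kap * M1 1%nat p) (fun y => Re (kap * bker_der t 1 p (vline s y)))).
    { apply dom_scal_Re; auto. }
    assert (Z : rint (fun y => Re (kap * bker_der t 1 p (vline s y))) = 0).
    { apply (rint_derive _ (Cmod kap * (exp (t * s) * B (p + 2)%nat * / s ^ 2)) (fun y => Im (kap * bker t 1 p
        (vline s y))%C) _ D1).
      - intro y. destruct (cderive_scal kap _ _ _ (cderive_bker t 1 p (vline s) y _ (cderive_vline_y s y) Hs))
          as [_ X].
        rewrite Re_mult_Ci in X. exact X.
      - intro y. assert (HL := Cmod_vline_ge s y Hs).
        apply Rle_trans with ((Cmod kap * Cmod (bker t 1 p (vline s y))) * Cmod (vline s y)).
        + apply Rmult_le_compat; auto using Rabs_pos.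
          * rewrite <- Cmod_mult. apply im_le_Cmod.
          * apply (im_le_Cmod (vline s y)).
        + rewrite Rmult_assoc. apply Rmult_le_compat_l; [apply Cmod_ge_0|].
          apply Rle_trans with ((exp (t * s) * (/ Cmod (vline s y)) ^ (1 + 2) * B (p + 2)%nat) * Cmod (vline s
            y)).
          * apply Rmult_le_compat_r; [lra|]. apply (bker_bound t 1 p 2 (vline s y) Hs).
          * replace (exp (t * s) * (/ Cmod (vline s y)) ^ (1 + 2) * B (p + 2)%nat * Cmod (vline s y)) with
             (exp (t * s) * B (p + 2)%nat * / Cmod (vline s y) ^ 2) by (simpl; field; lra).
            apply Rmult_le_compat_l. { apply Rmult_le_pos; [left; apply exp_pos|apply majorant_ge_0]. }
            mono. }
    rewrite <- Z. unfold btrans.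
    apply (rint_diff (fun s y => Re (kap * bker t 1 p (vline s y))) (fun s y => Re (kap * bker_der t 1 p
      (vline s y)))
      (fun s y => Re (kap * Edd 1%nat p (vline s y))) s (s / 2) (Cmod kap * M 1%nat p) (Cmod kap * M1 1%nat p)
        (Cmod kap * M2 1%nat p)); auto; try lra.
    - intros r Hr. assert (Hr' : s / 2 < r) by (unfold Rabs in Hr; destruct Rcase_abs in Hr; lra).
      apply dom_scal_Re; auto. apply ccont_bker. lra.
    - intros r y Hr. assert (Hr' : s / 2 < r) by (unfold Rabs in Hr; destruct Rcase_abs in Hr; lra).
      apply cderive_Re, cderive_scal.
      eapply cderive_eq; [apply (cderive_bker t 1 p (fun r => vline r y)); [apply cderive_vline_c|simpl;
        lra]|ring].
    - intros r y Hr. assert (Hr' : s / 2 < r) by (unfold Rabs in Hr; destruct Rcase_abs in Hr; lra).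
      apply cderive_Re, cderive_scal.
      eapply cderive_eq; [apply (Hrd 1%nat p (fun r => vline r y)); [apply cderive_vline_c|simpl; lra]|ring].
    - intros r y Hr. apply Rle_trans with (1 := re_le_Cmod _). rewrite Cmod_mult. unfold Rdiv.
      rewrite Rmult_assoc.
      mono. }
  assert (Hcst : forall s, c <= s -> btrans kap s p t = btrans kap c p t).
  { intros s Hs. apply (is_derive_0_const (fun s => btrans kap s p t)); auto. intros; apply Hder; lra. }
  set (A := Cmod kap * (B (p + 2)%nat * (1 + / c ^ 2)) * PI).
  assert (HPI := PI_RGT_0).
  assert (Hcp := one_inv_pos c Hc).
  assert (HA : 0 <= A).
  { unfold A. apply Rmult_le_pos; [|lra]. apply Rmult_le_pos; [apply Cmod_ge_0|].
    apply Rmult_le_pos; [apply majorant_ge_0|lra]. }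
  assert (HX : forall s, c <= s -> Rabs (btrans kap c p t) <= A / s).
  { intros s Hs. rewrite <- (Hcst s Hs). unfold btrans.
    replace (A / s) with (Cmod kap * (/ s * B (p + 2)%nat * (1 + / c ^ 2)) * PI) by (unfold A, Rdiv; ring).
    apply rint_bound, dom_scal_Re; [apply ccont_bker; lra|]. intro y.
    apply Rle_trans with (1 := HE s 1%nat p y ltac:(lra)). rewrite pow_1. unfold Rdiv.
    apply Rmult_le_compat_r; [apply cauchy_weight_ge_0|].
    apply Rmult_le_compat_l. { apply Rmult_le_pos; [left; apply Rinv_0_lt_compat; lra|apply majorant_ge_0]. }
    mono. }
  apply Rabs_eq_0, Rle_antisym; [|apply Rabs_pos]. apply Rnot_lt_le. intro Hn.
  set (r := Rabs (btrans kap c p t)) in *.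
  assert (H1 : 0 <= A / r) by pos.
  (* At this abscissa the bound [A / s] falls below [r]. *)
  specialize (HX (c + A / r + 1) ltac:(lra)).
  assert (r * (c + A / r + 1) <= A).
  { apply Rmult_le_reg_r with (/ (c + A / r + 1)); [apply Rinv_0_lt_compat; lra|].
    rewrite Rmult_assoc, Rinv_r by lra. pos. }
  assert (r * (c + A / r + 1) = r * (c + 1) + A) by (field; lra). nra.
Qed.
End Flat.

(** * Quasianalyticity in the half-plane *)

Section Flat_zero.
Variables (F : nat -> C -> C) (B v : nat -> R).
Hypothesis HF : forall p u, 0 < Re u -> @is_derive C_AbsRing C_NormedModule (F p) u (F (S p) u).
Hypothesis HB : forall p u, 0 < Re u -> Cmod (F p u) <= B p.
Hypothesis H0 : forall p e, 0 < e -> exists d, 0 < d /\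
  forall u, 0 < Re u -> Cmod u < d -> Cmod (F p u) <= e.
Hypothesis HBpos : forall p, 0 < B p.
Hypothesis Hv : forall p, 0 < v p.
Hypothesis HBv : forall p, B (S (S p)) = B (S p) * v p ^ 2.
Hypothesis Hvi : forall p, v p <= v (S p).
Hypothesis Hdiv : is_lim_seq (sum_n (fun p => / v p)) p_infty.

Lemma btrans_zero kap c t : 0 < c -> btrans F kap c 0 t = 0.
Proof.
  intro Hc. destruct (Rle_dec t 0) as [Ht|Ht]; [now apply (btrans_shift F B)|].
  set (L := 2 * sqrt t).
  assert (HL : L ^ 2 / 4 = t). { unfold L. rewrite Rpow_mult_distr, pow2_sqrt; lra. }
  assert (HL0 : 0 <= L) by (unfold L; generalize (sqrt_pos t); lra).
  (* Uniform for [s] in [[0, L]], where [s^2 / 4 <= t]. The summand 1 keeps the majorants positive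
     when [kap = 0]. *)
  set (D := Cmod kap * exp (t * c) * (1 + / c ^ 2) * PI + 1).
  assert (HPI := PI_RGT_0). assert (Hcp := one_inv_pos c Hc).
  assert (HD : 1 <= D).
  { unfold D. assert (0 <= Cmod kap * exp (t * c) * (1 + / c ^ 2) * PI); [|lra].
    pos. }
  assert (Hsq : forall s, is_derive (fun s => s ^ 2 / 4) s (s / 2)).
  { intro s. auto_derive; auto. field. }
  replace (btrans F kap c 0 t) with (btrans F kap c 0 (L ^ 2 / 4)) by now rewrite HL.
  apply (bang_zero (fun p s => btrans F kap c p (s ^ 2 / 4)) (fun p s => s / 2 * btrans1 F kap c p (s ^ 2 / 4))
    (fun p => D * B (S p)) v L); auto.
  - intro p. pos.
  - intro p. rewrite HBv. ring.
  - intros p s Hs. unfold btrans.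
    apply Rle_trans with (1 := rint_bound _ _ (dom_btrans F B HF HB H0 kap c Hc p (s ^ 2 / 4))).
    replace (p + 1)%nat with (S p) by lia. specialize (HBpos (S p)).
    apply Rle_trans with (Cmod kap * (exp (t * c) * B (S p) * (1 + / c ^ 2)) * PI).
    + apply Rmult_le_compat_r; [lra|]. apply Rmult_le_compat_l; [apply Cmod_ge_0|].
      apply Rmult_le_compat_r; [lra|]. apply Rmult_le_compat_r; [lra|].
      assert (s ^ 2 / 4 <= t). { nra. }
      destruct H as [H|H]; [|rewrite H; lra]. left. apply exp_increasing. now apply Rmult_lt_compat_r.
    + unfold D. nra.
  - intro p. apply growth_step_derive. intros s _. evar_last.
    + apply (is_derive_comp (btrans F kap c p) (fun s => s ^ 2 / 4)).
      * apply (btrans_derive F B); auto.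
      * apply Hsq.
    + auto.
  (* [s] times the odd function is [2 t G_p'] at [t = s^2 / 4], and [(t G_p')' = G_(p+1)] with
     [dt = (s / 2) ds]. *)
  - intro p. apply growth_step_radial.
    + pos.
    + intros s _. apply (is_derive_ext (fun s => 2 * ((s ^ 2 / 4) * btrans1 F kap c p (s ^ 2 / 4)))).
      { intro r. pos. }
      evar_last.
      * apply is_derive_scal. apply (is_derive_comp (fun t => t * btrans1 F kap c p t) (fun s => s ^ 2 / 4)).
        -- apply Derive.is_derive_mult; [apply @is_derive_id|apply (btrans1_derive F B); auto].
        -- apply Hsq.
      * unfold scal; simpl; unfold mult, one; simpl. rewrite <- (btrans_recurrence F B HF HB H0 kap c Hc p).
        pos.
  - intro p. cbv beta. replace (0 ^ 2 / 4) with 0 by field. apply (btrans_shift F B); auto. lra.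
  - intro p. pos.
  - lra.
Qed.

(** Fourier uniqueness on the vertical line through [/ u], evaluated at [/ u] itself. *)
Lemma flat_zero u : 0 < Re u -> F 0%nat u = 0.
Proof.
  intro Hu. assert (Hu0 : u <> 0) by (intro E; rewrite E in Hu; simpl in Hu; lra).
  assert (Hw := Re_inv_pos u Hu). set (w := (/ u)%C) in *.
  assert (Hw0 : w <> 0) by (intro E; rewrite E in Hw; simpl in Hw; lra).
  set (c := Re w) in *.
  set (rho := fun y => (/ vline c y * F 0%nat (/ vline c y))%C).
  assert (Hcp := one_inv_pos c Hw).
  assert (Hb : forall y, Cmod (F 0%nat (/ vline c y)) <= (/ Cmod (vline c y)) ^ 2 * B 2%nat).
  { intro y. rewrite <- Cmod_inv by now apply vline_ne_0.
    apply (flat F B HF HB H0 2 0 (/ vline c y)). now apply Re_inv_pos. }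
  assert (Hrho : forall y, rho y = 0).
  { apply (fourier_unique rho (fun y => y) (fun _ => 1) ((1 + / c) * ((1 + / c ^ 2) * B 2%nat))).
    - intro y. generalize (ccont_bker F HF 0 1 0 c Hw y). unfold bker.
      assert (E : forall y, (cexp (0%R * vline c y) * ((/ vline c y) ^ 1 * F 0%nat (/ vline c y)))%C = rho y).
      { intro z. replace (0%R * vline c z)%C with (RtoC 0) by ring. rewrite cexp_0, Cpow_1_r. unfold rho; ring.
        }
      intros [E1 E2]. split; [apply continuous_ext with (2 := E1)|apply continuous_ext with (2 := E2)];
      intro z; cbv beta; now rewrite E.
    - intro y. apply @is_derive_id.
    - auto.
    - intro y. unfold rho. rewrite Cmod_mult, Cmod_inv by now apply vline_ne_0.
      assert (HL := Cmod_vline_ge c y Hw).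
      assert (/ Cmod (vline c y) <= 1 + / c).
      { assert (/ Cmod (vline c y) <= / c) by mono. lra. }
      unfold Rdiv. rewrite Rmult_assoc. apply Rmult_le_compat; auto using Cmod_ge_0.
      + pos.
      + apply Rle_trans with (1 := Hb y).
        replace ((1 + / c ^ 2) * B 2%nat * / (1 + y ^ 2)) with ((1 + / c ^ 2) / (1 + y ^ 2) * B 2%nat) by
          (unfold Rdiv; ring).
        apply Rmult_le_compat_r; [left; auto|]. now apply Cmod_vline_inv_sq.
    - intro y. unfold rho. rewrite Cmod_mult, Cmod_inv by now apply vline_ne_0.
      assert (HL := Cmod_vline_ge c y Hw).
      assert (Hy : Rabs y <= Cmod (vline c y)) by apply (im_le_Cmod (vline c y)).
      apply Rle_trans with ((/ Cmod (vline c y)) ^ 2 * B 2%nat).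
      + apply Rle_trans with (/ Cmod (vline c y) * ((/ Cmod (vline c y)) ^ 2 * B 2%nat) * Cmod (vline c y)).
        * mono.
        * right. field. lra.
      + apply Rle_trans with ((1 + / c ^ 2) / (1 + y ^ 2) * B 2%nat).
        * apply Rmult_le_compat_r; [left; auto|]. now apply Cmod_vline_inv_sq.
        * assert (0 < / c) by now apply Rinv_0_lt_compat.
          replace ((1 + / c) * ((1 + / c ^ 2) * B 2%nat) / (1 + y ^ 2)) with ((1 + / c) * ((1 + / c ^ 2) / (1
            + y ^ 2) * B 2%nat)) by (unfold Rdiv; ring).
          rewrite <- (Rmult_1_l ((1 + / c ^ 2) / (1 + y ^ 2) * B 2%nat)) at 1.
          mono.
    (* On the line [e^(ity) = e^(-tc) e^(tw)]; the constant factor goes into the multiplier. *)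
    - intros k t. transitivity (btrans F (k * cexp (- t * c))%C c 0 t); [|now apply btrans_zero].
      unfold btrans. apply rint_ext. intro y.
      f_equal. unfold bker, rho. rewrite Cpow_1_r.
      replace (cexp (0, t * y)) with (cexp (- t * c) * cexp (t * vline c y))%C; [ring|].
      rewrite <- cexp_add. f_equal. unfold vline. Cext. }
  specialize (Hrho (Im w)). unfold rho in Hrho.
  assert (E : vline c (Im w) = w) by auto.
  rewrite E in Hrho. assert (E' : (/ w)%C = u) by (unfold w; field; auto).
  rewrite E' in Hrho.
  replace (F 0%nat u) with (w * (u * F 0%nat u))%C by (unfold w; field; auto).
  rewrite Hrho. ring.
Qed.
End Flat_zero.

Lemma C_derive_rotate (G : C -> C) (c u l : C) : c <> 0 ->
  @is_derive C_AbsRing C_NormedModule G (c * u)%C l ->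
  forall k : C, @is_derive C_AbsRing C_NormedModule (fun u => k * G (c * u))%C u (k * (l * c))%C.
Proof.
  intros Hc H k. apply is_derive_C_of_eps. intros eps He.
  assert (Hk := Cmod_ge_0 k). assert (Hcp : 0 < Cmod c) by now apply Cmod_gt_0.
  destruct (is_derive_C_eps _ _ _ H (eps / ((Cmod k + 1) * Cmod c))) as [d [Hd Hd']].
  { pos. }
  exists (d / Cmod c). split; [now apply Rdiv_lt_0_compat|]. intros h Hh.
  specialize (Hd' (c * h)%C). rewrite Cmod_mult in Hd'.
  assert (X : Cmod c * Cmod h < d).
  { apply Rmult_lt_reg_r with (/ Cmod c); [now apply Rinv_0_lt_compat|].
    replace (Cmod c * Cmod h * / Cmod c) with (Cmod h) by (field; lra). exact Hh. }
  specialize (Hd' X). replace (c * (u + h))%C with (c * u + c * h)%C by ring.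
  replace (k * G (c * u + c * h) - k * G (c * u) - h * (k * (l * c)))%C with
    (k * (G (c * u + c * h) - G (c * u) - c * h * l))%C by ring.
  rewrite Cmod_mult.
  apply Rle_trans with (Cmod k * (eps / ((Cmod k + 1) * Cmod c) * (Cmod c * Cmod h))).
  - mono.
  - replace (Cmod k * (eps / ((Cmod k + 1) * Cmod c) * (Cmod c * Cmod h))) with
     (Cmod k / (Cmod k + 1) * (eps * Cmod h)) by (field; lra).
    rewrite <- (Rmult_1_l (eps * Cmod h)) at 2. apply Rmult_le_compat_r.
    + pos.
    + apply Rmult_le_reg_r with (Cmod k + 1); [lra|]. unfold Rdiv. rewrite Rmult_assoc, Rinv_l by lra. lra.
Qed.

(** The class [A_N] and the relation [borel_is] each provide their own tower of derivatives; this
    identifies them. *)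
Lemma tower_unique f F G : cderiv_tower f F -> cderiv_tower f G ->
  forall p z, UHP z -> F p z = G p z.
Proof.
  intros HF HG p. induction p as [|p IH]; intros z Hz.
  - destruct (HF z Hz) as [-> _], (HG z Hz) as [-> _]. easy.
  - apply (is_derive_C_unique_at (F p) (G p) z); auto; [apply HF|apply HG]; auto.
Qed.

(** Neighbourhoods in [C] are products of intervals, hence [e / 2] in each coordinate. *)
Lemma filterlim_UHP_eps (F : C -> C) (c : C) :
  filterlim F (within UHP (locally (0 : C))) (locally c) ->
  forall e, 0 < e -> exists d, 0 < d /\ forall z, UHP z -> Cmod z < d -> Cmod (F z - c) <= e.
Proof.
  intros H e He.
  assert (He' : 0 < e / 2) by lra.
  destruct (H _ (locally_ball c (mkposreal _ He'))) as [d Hd].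
  exists d; split; [apply cond_pos|]. intros z Hz Hzd.
  assert (Hb : ball (0 : C) d z).
  { apply C_NormedModule_mixin_compat1. change (Cmod (z - 0)%C < d). now replace (z - 0)%C with z by ring. }
  specialize (Hd z Hb Hz). simpl in Hd.
  destruct Hd as [H1 H2]. unfold ball in H1, H2; simpl in H1, H2.
  unfold AbsRing_ball, abs, minus, plus, opp in H1, H2; simpl in H1, H2.
  apply Rle_trans with (1 := Cmod_le_sum _). unfold Re, Im; simpl. lra.
Qed.

Lemma quot_pos M p : pos_seq M -> 0 < quot M p.
Proof. intros [_ H]. apply Rdiv_lt_0_compat; apply H. Qed.

Lemma quot_incr M p : weight_seq M -> quot M p <= quot M (S p).
Proof.
  intros [HM [Hl _]]. assert (H := Hl (S p) ltac:(lia)).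
  replace (S p - 1)%nat with p in H by lia. destruct HM as [_ HM].
  assert (H0 := HM p). assert (H1 := HM (S p)). unfold quot.
  apply Rmult_le_reg_r with (M p * M (S p)); [now apply Rmult_lt_0_compat|].
  replace (M (S p) / M p * (M p * M (S p))) with (M (S p) ^ 2) by (field; lra).
  replace (M (S (S p)) / M (S p) * (M p * M (S p))) with (M p * M (S (S p))) by (field; lra). lra.
Qed.

Lemma is_lim_seq_scal_p_infty (w : nat -> R) (a : R) : 0 < a ->
  is_lim_seq w p_infty -> is_lim_seq (fun n => a * w n) p_infty.
Proof.
  intros Ha H. apply is_lim_seq_spec in H. apply is_lim_seq_spec. intro M.
  destruct (H (M / a)) as [N HN]. exists N. intros n Hn. specialize (HN n Hn).
  replace M with (a * (M / a)) by (field; lra). mono.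
Qed.

(** The convergence of the transforms costs indices and the class costs a factor [h^p]: Bang's
    argument sees [/ sqrt (h m_(p+2))]. *)
Lemma div_tail (u : nat -> R) (k : nat) (a : R) : 0 < a ->
  is_lim_seq (sum_n u) p_infty -> is_lim_seq (sum_n (fun p => a * u (p + k)%nat)) p_infty.
Proof.
  intros Ha H. destruct k as [|k].
  - apply is_lim_seq_ext with (fun n => a * sum_n u n).
    + intro n. rewrite <- (sum_n_mult_l (K := R_Ring) a). apply sum_n_ext. intro; now rewrite Nat.add_0_r.
    + now apply is_lim_seq_scal_p_infty.
  - apply is_lim_seq_ext with (fun n => a * (sum_n u (n + S k) - sum_n u k)).
    + intro n. rewrite (sum_n_mult_l (K := R_Ring) a (fun p => u (p + S k)%nat)). unfold mult; simpl. f_equal.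
      induction n.
      * rewrite Nat.add_0_l, sum_Sn, sum_O. unfold plus; simpl. ring.
      * rewrite (sum_Sn _ n), <- IHn. replace (S n + S k)%nat with (S (n + S k)) by lia.
        rewrite sum_Sn. unfold plus; simpl. ring.
    + apply is_lim_seq_scal_p_infty; auto. apply (is_lim_seq_minus _ _ p_infty (sum_n u k)).
      * now apply is_lim_seq_incr_n.
      * apply is_lim_seq_const.
      * easy.
Qed.

Lemma pow_bound_weaken (K k h m : R) (p : nat) : 0 <= k <= h -> 0 <= m ->
  K * k ^ p * m <= Rabs K * h ^ p * m.
Proof.
  intros Hk Hm. apply Rmult_le_compat_r; auto. apply Rle_trans with (Rabs K * k ^ p).
  - apply Rmult_le_compat_r; [apply pow_le; lra|apply Rle_abs].
  - mono.
Qed.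

Lemma div_imp_borel_injective M : weight_seq M ->
  is_lim_seq (sum_n (fun p => / sqrt (quot M p))) p_infty -> borel_injective (shift1 M).
Proof.
  intros HM Hdiv f g c [h1 [Hh1 [F1 [HF1 [K1 HK1]]]]] [h2 [Hh2 [F2 [HF2 [K2 HK2]]]]]
    [G1 [HG1 HL1]] [G2 [HG2 HL2]] z Hz.
  assert (HMp : forall p, 0 < M p) by apply HM.
  set (h := Rmax h1 h2). assert (Hh : 0 < h) by (unfold h; apply Rlt_le_trans with (1 := Hh1), Rmax_l).
  set (K := Rabs K1 + Rabs K2 + 1).
  assert (HK : 0 < K) by (unfold K; generalize (Rabs_pos K1) (Rabs_pos K2); lra).
  assert (HU : forall u, 0 < Re u -> UHP (Ci * u)).
  { intros u Hu. unfold UHP. replace (Im (Ci * u)) with (Re u); auto. unfold Re, Im; simpl; ring. }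
  assert (HCi : Ci <> 0). { intro E. apply (f_equal Im) in E. simpl in E. lra. }
  (* Derivatives of [u -> (f - g)(i u)] on the right half-plane; each differentiation contributes a
     factor [i]. *)
  set (F := fun p u => (Ci ^ p * (F1 p (Ci * u) - F2 p (Ci * u)))%C).
  assert (Hq : forall p, 0 < quot M p) by (intro; apply quot_pos, HM).
  assert (Z : F 0%nat (- Ci * z)%C = 0).
  (* With [B p = K h^p M_(p+1)], the ratio [B (p+2) / B (p+1)] equals [h m_(p+2)]. *)
  { apply (flat_zero F (fun p => K * h ^ p * M (S p)) (fun p => sqrt (h * quot M (p + 2)))).
    - intros p u Hu. unfold F. specialize (HU u Hu).
      destruct (HF1 _ HU) as [_ D1], (HF2 _ HU) as [_ D2].
      assert (D := C_derive_rotate (fun z => F1 p z - F2 p z)%C Ci u (F1 (S p) (Ci * u) - F2 (S p) (Ci * u))%C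
        HCi).
      specialize (D (@is_derive_minus C_AbsRing C_NormedModule _ _ _ _ _ (D1 p) (D2 p)) (Ci ^ p)%C).
      cbv beta in D. simpl Cpow.
      replace (Ci * Ci ^ p * (F1 (S p) (Ci * u) - F2 (S p) (Ci * u)))%C with
       (Ci ^ p * ((F1 (S p) (Ci * u) - F2 (S p) (Ci * u)) * Ci))%C by ring. exact D.
    - intros p u Hu. unfold F. specialize (HU u Hu). rewrite Cmod_mult, Cmod_pow, Cmod_Ci, pow1, Rmult_1_l.
      unfold Cminus. apply Rle_trans with (1 := Cmod_triangle _ _). rewrite Cmod_opp.
      assert (X1 : Cmod (F1 p (Ci * u)%C) <= Rabs K1 * h ^ p * M (S p)).
      { apply Rle_trans with (1 := HK1 p _ HU), pow_bound_weaken; [split; [lra|apply Rmax_l]|left; auto]. }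
      assert (X2 : Cmod (F2 p (Ci * u)%C) <= Rabs K2 * h ^ p * M (S p)).
      { apply Rle_trans with (1 := HK2 p _ HU), pow_bound_weaken; [split; [lra|apply Rmax_r]|left; auto]. }
      unfold K. assert (0 <= h ^ p * M (S p)) by pos. lra.
    - intros p e He.
      destruct (filterlim_UHP_eps _ _ (HL1 p) (e / 2) ltac:(lra)) as [d1 [Hd1 E1]].
      destruct (filterlim_UHP_eps _ _ (HL2 p) (e / 2) ltac:(lra)) as [d2 [Hd2 E2]].
      exists (Rmin d1 d2). split; [now apply Rmin_pos|]. intros u Hu Hud. specialize (HU u Hu).
      unfold F. rewrite Cmod_mult, Cmod_pow, Cmod_Ci, pow1, Rmult_1_l.
      rewrite (tower_unique f F1 G1), (tower_unique g F2 G2); auto.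
      assert (Hu' : Cmod (Ci * u) = Cmod u) by (rewrite Cmod_mult, Cmod_Ci; ring).
      specialize (E1 _ HU). specialize (E2 _ HU). rewrite Hu' in E1, E2.
      specialize (E1 (Rlt_le_trans _ _ _ Hud (Rmin_l _ _))).
      specialize (E2 (Rlt_le_trans _ _ _ Hud (Rmin_r _ _))).
      replace (G1 p (Ci * u) - G2 p (Ci * u))%C with ((G1 p (Ci * u) - c p) + - (G2 p (Ci * u) - c p))%C by
        ring.
      apply Rle_trans with (1 := Cmod_triangle _ _). rewrite Cmod_opp. lra.
    - intro p. pos.
    - intro p. pos.
    - intro p. rewrite pow2_sqrt by pos. unfold quot.
      replace (p + 2)%nat with (S (S p)) by lia. simpl. specialize (HMp (S (S p))). field. lra.
    - intro p. apply sqrt_le_1_alt. apply Rmult_le_compat_l; [lra|]. apply quot_incr, HM.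
    - apply is_lim_seq_ext with (sum_n (fun p => / sqrt h * (fun p => / sqrt (quot M p)) (p + 2)%nat)).
      + intro n. apply sum_n_ext. intro p. rewrite sqrt_mult, Rinv_mult; auto; left; auto.
      + apply (div_tail (fun p => / sqrt (quot M p)) 2); auto. pos.
    - unfold UHP in Hz. replace (Re (- Ci * z)) with (Im z); auto. unfold Re, Im; simpl; ring. }
  unfold F in Z. replace (Ci * (- Ci * z))%C with z in Z by Cext.
  simpl in Z. rewrite Cmult_1_l in Z.
  destruct (HF1 z Hz) as [<- _], (HF2 z Hz) as [<- _].
  replace (F1 0%nat z) with ((F1 0%nat z - F2 0%nat z) + F2 0%nat z)%C by ring. rewrite Z. ring.
Qed.

(** * Laplace transforms *)

Definition cdom (K : R) (g : R -> C) : Prop :=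
  ccont g /\ forall y, Cmod (g y) <= K / (1 + y ^ 2).

Definition cint (g : R -> C) : C := (rint (fun y => Re (g y)), rint (fun y => Im (g y))).

Lemma cdom_Re K g : cdom K g -> dom K (fun y => Re (g y)).
Proof. intros []. now apply dom_Re. Qed.

Lemma cdom_Im K g : cdom K g -> dom K (fun y => Im (g y)).
Proof.
  intros [H1 H2]. split; [intro; apply H1|]. intro y. apply Rle_trans with (2 := H2 y), im_le_Cmod.
Qed.

Lemma Cmod_cint K g : cdom K g -> Cmod (cint g) <= 2 * PI * K.
Proof.
  intro H. apply Rle_trans with (1 := Cmod_le_sum _). simpl.
  generalize (rint_bound _ _ (cdom_Re _ _ H)) (rint_bound _ _ (cdom_Im _ _ H)). lra.
Qed.

Lemma cint_ext f g : (forall y, f y = g y) -> cint f = cint g.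
Proof. intro H. unfold cint. f_equal; apply rint_ext; intro; now rewrite H. Qed.

Lemma Re_scal_cint K g k : cdom K g -> Re (k * cint g) = rint (fun y => Re (k * g y)).
Proof.
  intro H. rewrite (rint_ext _ (fun y => Re k * Re (g y) - Im k * Im (g y))) by easy.
  rewrite (rint_minus _ _ _ _ (dom_scal _ _ _ (cdom_Re _ _ H)) (dom_scal _ _ _ (cdom_Im _ _ H))).
  rewrite (rint_scal _ _ _ (cdom_Re _ _ H)), (rint_scal _ _ _ (cdom_Im _ _ H)). easy.
Qed.

Lemma cint_scal K g k : cdom K g -> cint (fun y => k * g y)%C = (k * cint g)%C.
Proof.
  intro H. apply C_eq; [symmetry; now apply (Re_scal_cint K)|].
  assert (E := Re_scal_cint K g (- Ci * k) H).
  transitivity (Re (- Ci * k * cint g)); [rewrite E|].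
  - apply rint_ext. intro y. unfold Re, Im; simpl; ring.
  - unfold Re, Im; simpl; ring.
Qed.

Lemma cint_minus K1 K2 f g : cdom K1 f -> cdom K2 g -> cint (fun y => f y - g y)%C = (cint f - cint g)%C.
Proof.
  intros H1 H2. apply C_eq; simpl.
  - apply (rint_minus K1 K2 (fun y => Re (f y)) (fun y => Re (g y))); now apply cdom_Re.
  - apply (rint_minus K1 K2 (fun y => Im (f y)) (fun y => Im (g y))); now apply cdom_Im.
Qed.

Lemma cdom_scal K k g : cdom K g -> cdom (Cmod k * K) (fun y => k * g y)%C.
Proof.
  intros [H1 H2]. split. { apply ccont_mult; auto. apply ccont_const. }
  intro y. rewrite Cmod_mult. unfold Rdiv. rewrite Rmult_assoc. mono.
Qed.

Lemma cdom_minus K1 K2 f g : cdom K1 f -> cdom K2 g -> cdom (K1 + K2) (fun y => f y - g y)%C.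
Proof.
  intros [H1 H2] [H3 H4]. split.
  - intro y. destruct (H1 y), (H3 y). split; simpl; now apply @continuous_minus.
  - intro y. unfold Cminus. apply Rle_trans with (1 := Cmod_triangle _ _). rewrite Cmod_opp.
    unfold Rdiv. rewrite Rmult_plus_distr_r. mono.
Qed.

Lemma cexp_lip (z : C) : Cmod (cexp z - 1) <= Cmod z * exp (Cmod z).
Proof.
  assert (HM := Cmod_MVT (fun s => cexp (0 + s * z)%C) (fun s => cexp (0 + s * z) * z)%C 0 1 (Cmod z * exp
    (Cmod z)) ltac:(lra)).
  cbv beta in HM. replace (0 + 0%R * z)%C with (RtoC 0) in HM by ring.
  replace (0 + 1%R * z)%C with z in HM by ring.
  rewrite cexp_0, Rminus_0_r, Rmult_1_r in HM. apply HM.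
  - intros s _. apply cderive_cexp, cderive_line.
  - intros s Hs. rewrite Cmod_mult, Cmod_cexp, Rmult_comm. apply Rmult_le_compat_l; [apply Cmod_ge_0|].
    assert (X : Re (0 + s * z) <= Cmod z).
    { apply Rle_trans with (1 := Rle_abs _). apply Rle_trans with (1 := re_le_Cmod _).
      rewrite Cplus_0_l, Cmod_mult, Cmod_R, Rabs_right by lra. generalize (Cmod_ge_0 z). nra. }
    destruct X as [X|X]; [left; now apply exp_increasing|rewrite X; lra].
Qed.

Lemma cexp_taylor (z : C) : Cmod (cexp z - 1 - z) <= Cmod z ^ 2 * exp (Cmod z).
Proof.
  assert (HM := Cmod_MVT (fun s => cexp (0 + s * z) + - (1) * (0 + s * z))%C (fun s => cexp (0 + s * z) * z +
    - (1) * z)%C 0 1 (Cmod z ^ 2 * exp (Cmod z)) ltac:(lra)).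
  cbv beta in HM. replace (0 + 0%R * z)%C with (RtoC 0) in HM by ring.
  replace (0 + 1%R * z)%C with z in HM by ring.
  rewrite cexp_0, Rminus_0_r, Rmult_1_r in HM.
  replace (cexp z - 1 - z)%C with (cexp z + - (1) * z - (1 + - (1) * 0))%C by ring. apply HM.
  - intros s _. apply cderive_plus; [apply cderive_cexp, cderive_line|apply cderive_scal, cderive_line].
  - intros s Hs. replace (cexp (0 + s * z) * z + - (1) * z)%C with ((cexp (s * z) - 1) * z)%C.
    2:{ rewrite Cplus_0_l. ring. }
    assert (Hz := Cmod_ge_0 z).
    assert (Hsz : Cmod (s * z) <= Cmod z) by (rewrite Cmod_mult, Cmod_R, Rabs_right by lra; nra).
    rewrite Cmod_mult. apply Rle_trans with (Cmod z * exp (Cmod z) * Cmod z); [|right; ring].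
    apply Rmult_le_compat_r; auto. apply Rle_trans with (1 := cexp_lip _).
    apply Rmult_le_compat; auto using Cmod_ge_0. { left; apply exp_pos. }
    destruct Hsz as [X|X]; [left; now apply exp_increasing|rewrite X; lra].
Qed.

Lemma sq_exp_bound r : 0 <= r -> exp (- r) * (1 + r ^ 2) <= 5.
Proof.
  intro Hr. rewrite exp_Ropp.
  assert (H : exp r = exp (r / 2) ^ 2) by (simpl; rewrite Rmult_1_r, <- exp_plus; f_equal; field).
  assert (H1 : 1 + r / 2 <= exp (r / 2)) by apply exp_ineq1_le.
  assert (H2 : (1 + r / 2) ^ 2 <= exp (r / 2) ^ 2) by (apply pow_incr; lra).
  apply Rmult_le_reg_l with (exp r); [apply exp_pos|].
  rewrite <- Rmult_assoc, Rinv_r by pos.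
  nra.
Qed.

(** A plateau between [y1] and [y2] with exponential decay outside is dominated by [/ (1 + y^2)] at
    a cost quadratic in the endpoints. *)
Lemma min_exp_bound (G A y y1 y2 : R) : 0 <= A -> y1 <= y2 ->
  G <= A * exp (y - y1) -> G <= A -> G <= A * exp (y2 - y) ->
  G <= A * (10 * (1 + y1 ^ 2 + y2 ^ 2)) / (1 + y ^ 2).
Proof.
  intros HA H12 Ha Hb Hc. assert (Hy := one_plus_sq_pos y).
  apply Rmult_le_reg_r with (1 + y ^ 2); auto. unfold Rdiv. rewrite Rmult_assoc, Rinv_l, Rmult_1_r by lra.
  assert (P1 := pow2_ge_0 y1). assert (P2 := pow2_ge_0 y2).
  assert (K : forall u r, 0 <= r -> 1 + y ^ 2 <= 2 * (1 + u ^ 2) * (1 + r ^ 2) -> G <= A * exp (- r) ->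
    G * (1 + y ^ 2) <= A * (10 * (1 + u ^ 2))).
  { intros u r Hr H1 H2. apply Rle_trans with (A * exp (- r) * (1 + y ^ 2)).
    - mono.
    - apply Rle_trans with (A * exp (- r) * (2 * (1 + u ^ 2) * (1 + r ^ 2))).
      + mono.
      + replace (A * exp (- r) * (2 * (1 + u ^ 2) * (1 + r ^ 2))) with (A * (2 * (1 + u ^ 2)) * (exp (- r) *
          (1 + r ^ 2))) by ring.
        replace (A * (10 * (1 + u ^ 2))) with (A * (2 * (1 + u ^ 2)) * 5) by ring.
        apply Rmult_le_compat_l; [|now apply sq_exp_bound]. pos. }
  (* [u] is the nearer endpoint and [r] the distance to it: the weight at [y] is shared between the
     two. *)
  assert (W : forall u r, u = y + r \/ u = y - r -> 1 + y ^ 2 <= 2 * (1 + u ^ 2) * (1 + r ^ 2)).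
  { intros u r [-> | ->].
    - assert (0 <= (y + 2 * r) ^ 2) by apply pow2_ge_0. assert (0 <= (r * (y + r)) ^ 2) by apply pow2_ge_0. nra.
    - assert (0 <= (y - 2 * r) ^ 2) by apply pow2_ge_0. assert (0 <= (r * (y - r)) ^ 2) by apply pow2_ge_0.
      nra. }
  destruct (Rle_dec y y1) as [H1|H1].
  - apply Rle_trans with (A * (10 * (1 + y1 ^ 2))); [|apply Rmult_le_compat_l; lra].
    apply (K y1 (y1 - y)); [lra| |replace (- (y1 - y)) with (y - y1) by ring; auto].
    apply W. left; ring.
  - destruct (Rle_dec y y2) as [H2|H2].
    + apply Rle_trans with (A * (1 + y ^ 2)); [apply Rmult_le_compat_r; lra|].
      apply Rmult_le_compat_l; auto. destruct (Rle_dec 0 y); nra.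
    + apply Rle_trans with (A * (10 * (1 + y2 ^ 2))); [|apply Rmult_le_compat_l; lra].
      apply (K y2 (y - y2)); [lra| |replace (- (y - y2)) with (y2 - y) by ring; auto].
      apply W. right; ring.
Qed.

(** Telescoping (sm) gives [C0 (H + ... + H^p)], at most [C0 H / (H - 1)] times [H^p]. *)
Lemma ln_quot_bound M : weight_seq M -> cond_sm M ->
  exists D H, 0 < D /\ 1 < H /\ forall p, Rabs (ln (quot M p)) <= D * H ^ p.
Proof.
  intros HM [C0 [H [HC [HH Hsm]]]].
  exists (Rabs (ln (quot M 0)) + C0 * H / (H - 1)), H.
  assert (Hp : 0 < C0 * H / (H - 1)) by pos.
  assert (H0 := Rabs_pos (ln (quot M 0))).
  split; [lra|]. split; auto.
  induction p as [|p IH].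
  - pos.
  - assert (Hq1 := quot_pos M p (proj1 HM)). assert (Hq2 := quot_pos M (S p) (proj1 HM)).
    assert (Hi := quot_incr M p HM). specialize (Hsm p).
    rewrite ln_div in Hsm by auto.
    assert (ln (quot M p) <= ln (quot M (S p))).
    { destruct Hi as [Hi|Hi]; [left; now apply ln_increasing|rewrite Hi; lra]. }
    assert (X : Rabs (ln (quot M (S p))) <= Rabs (ln (quot M p)) + C0 * H ^ S p).
    { unfold Rabs; repeat destruct Rcase_abs; lra. }
    apply Rle_trans with (1 := X). simpl in *.
    assert (HHp : 0 < H ^ p) by (apply pow_lt; lra).
    set (D := Rabs (ln (quot M 0)) + C0 * H / (H - 1)) in *.
    assert (E : D * (H - 1) = Rabs (ln (quot M 0)) * (H - 1) + C0 * H) by (unfold D; field; lra).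
    assert (C0 * H <= D * (H - 1)) by (rewrite E; nra).
    nra.
Qed.

Section Laplace.
Variables (M : nat -> R) (chi : R -> C) (h K : R).
Hypothesis HM : weight_seq M.
Hypothesis Hsm : cond_sm M.
Hypothesis Hh : 0 < h.
Hypothesis HK : 0 <= K.
Hypothesis Hchi : forall p x, 0 < x -> x ^ p * Cmod (chi x) <= K * h ^ p * M p.
Hypothesis Hcc : ccont (fun y => chi (exp y)).

(** The bounds of orders [p], [p + 1], [p + 2], read in [y = ln x], form a plateau between
    [ln (h m_p)] and [ln (h m_(p+1))]. By (sm) the squares of these endpoints are [O(H^(2p))], so
    integrability costs only a geometric factor and the class of [M_(+1)] is kept. *)
Lemma moment_bound : exists D r, 0 <= D /\ 0 < r /\ forall p y,
  exp y ^ S p * Cmod (chi (exp y)) <= D * r ^ p * M (S p) / (1 + y ^ 2).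
Proof.
  destruct (ln_quot_bound M HM Hsm) as [D0 [H [HD0 [HH Hln]]]].
  set (D1 := Rabs (ln h) + D0).
  assert (HD1 : 0 < D1) by (unfold D1; generalize (Rabs_pos (ln h)); lra).
  assert (HMp : forall p, 0 < M p) by apply HM.
  assert (Hq : forall p, 0 < quot M p) by (intro; apply quot_pos, HM).
  assert (Hy : forall p, ln (h * quot M p) ^ 2 <= D1 ^ 2 * (H ^ 2) ^ p).
  { intro p. rewrite <- pow_mult, Nat.mul_comm, pow_mult, <- Rpow_mult_distr, <- pow2_abs. apply pow_incr.
    split; [apply Rabs_pos|]. rewrite ln_mult by auto. apply Rle_trans with (1 := Rabs_triang _ _).
    specialize (Hln p). unfold D1. assert (1 <= H ^ p) by (apply pow_R1_Rle; lra).
    generalize (Rabs_pos (ln h)). nra. }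
  exists (K * h * (10 * (1 + D1 ^ 2 + D1 ^ 2 * H ^ 2))), (h * H ^ 2).
  assert (HH2 : 1 < H ^ 2) by (simpl; nra).
  assert (HD2 : 0 < D1 ^ 2) by (apply pow_lt; auto).
  split. { pos. }
  split. { pos. }
  intros p y. set (X := exp y). assert (HX : 0 < X) by apply exp_pos.
  assert (Hy1 := Hy p). assert (Hy2 := Hy (S p)).
  set (y1 := ln (h * quot M p)) in *. set (y2 := ln (h * quot M (S p))) in *.
  set (A := K * h ^ S p * M (S p)).
  assert (HA : 0 <= A).
  { apply Rmult_le_pos; [|left; auto]. apply Rmult_le_pos; auto. apply pow_le; lra. }
  assert (E1 : exp (y - y1) = X / (h * quot M p)).
  { unfold Rminus. rewrite exp_plus, exp_Ropp. unfold y1. rewrite exp_ln by now apply Rmult_lt_0_compat. easy. }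
  assert (E2 : exp (y2 - y) = h * quot M (S p) / X).
  { unfold Rminus. rewrite exp_plus, exp_Ropp. unfold y2. rewrite exp_ln by now apply Rmult_lt_0_compat. easy. }
  assert (HMp0 := HMp p). assert (HMp1 := HMp (S p)). assert (HMp2 := HMp (S (S p))).
  assert (B := min_exp_bound (X ^ S p * Cmod (chi X)) A y y1 y2 HA).
  apply Rle_trans with (A * (10 * (1 + y1 ^ 2 + y2 ^ 2)) / (1 + y ^ 2)).
  - apply B.
    + unfold y1, y2. assert (Hi := quot_incr M p HM).
      destruct Hi as [Hi|Hi]; [left; apply ln_increasing|rewrite Hi; lra].
      * pos.
      * mono.
    + rewrite E1. unfold A.
      replace (K * h ^ S p * M (S p) * (X / (h * quot M p))) with (X * (K * h ^ p * M p)) by (unfold quot;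
        simpl; field; lra).
      simpl. rewrite Rmult_assoc. apply Rmult_le_compat_l; [lra|]. apply Hchi, HX.
    + apply Hchi, HX.
    + rewrite E2. unfold A. apply Rmult_le_reg_l with X; auto.
      replace (X * (K * h ^ S p * M (S p) * (h * quot M (S p) / X))) with (K * h ^ S (S p) * M (S (S p))) by
        (unfold quot; simpl; field; lra).
      rewrite <- Rmult_assoc. apply (Hchi (S (S p))), HX.
  - unfold Rdiv. apply Rmult_le_compat_r; [apply cauchy_weight_ge_0|].
    rewrite Rpow_mult_distr. unfold A.
    replace (K * h * (10 * (1 + D1 ^ 2 + D1 ^ 2 * H ^ 2)) * (h ^ p * (H ^ 2) ^ p) * M (S p)) with
      (K * h ^ S p * M (S p) * (10 * ((H ^ 2) ^ p * (1 + D1 ^ 2 + D1 ^ 2 * H ^ 2)))) by (simpl; ring).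
    apply Rmult_le_compat_l; auto. apply Rmult_le_compat_l; [lra|].
    assert (1 <= (H ^ 2) ^ p) by (apply pow_R1_Rle; lra).
    change ((H ^ 2) ^ S p) with (H ^ 2 * (H ^ 2) ^ p) in Hy2. lra.
Qed.

Variables (D r : R).
Hypothesis HD : 0 <= D.
Hypothesis Hr : 0 < r.
Hypothesis HDr : forall p y, exp y ^ S p * Cmod (chi (exp y)) <= D * r ^ p * M (S p) / (1 + y ^ 2).

Let Bp p := D * r ^ p * M (S p).

Let Bp_pos p : 0 <= Bp p.
Proof. apply Rmult_le_pos; [|left; apply HM]. pos. Qed.

(** Integrand of the [p]-th derivative of the integral of [chi(x) e^(ixz) dx] after [x = e^y]; the
    extra factor [e^y] is [dx]. *)
Definition lap_int (p : nat) (z : C) (y : R) : C :=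
  ((Ci * exp y) ^ p * (chi (exp y) * exp y) * cexp (Ci * exp y * z))%C.

Definition lap (p : nat) (z : C) : C := cint (lap_int p z).

Lemma Cmod_lap_weight p y : Cmod ((Ci * exp y) ^ p * (chi (exp y) * exp y)) <= Bp p / (1 + y ^ 2).
Proof.
  rewrite 2!Cmod_mult, Cmod_pow, Cmod_mult, Cmod_Ci, Cmod_R, Rmult_1_l.
  rewrite Rabs_right by pos.
  apply Rle_trans with (2 := HDr p y). right. simpl. ring.
Qed.

Lemma Re_Ci_exp y z : Re (Ci * exp y * z) = - (exp y * Im z).
Proof. unfold Re, Im; simpl; ring. Qed.

Lemma Cmod_osc y z : 0 <= Im z -> Cmod (cexp (Ci * exp y * z)) <= 1.
Proof.
  intro Hz. rewrite Cmod_cexp, Re_Ci_exp, <- exp_0.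
  assert (0 <= exp y * Im z) by pos.
  destruct (Req_dec (exp y * Im z) 0) as [->|Hn]; [rewrite Ropp_0; lra|]. left. mono.
Qed.

Lemma ccont_exp : ccont (fun y => RtoC (exp y)).
Proof.
  apply ccont_pair; [|intro; apply continuous_const]. intro y.
  apply continuous_exp.
Qed.

Lemma ccont_pow g (n : nat) : ccont g -> ccont (fun y => g y ^ n)%C.
Proof.
  intro H. induction n; simpl; [apply ccont_const|]. now apply ccont_mult.
Qed.

Lemma ccont_lap_weight p : ccont (fun y => (Ci * exp y) ^ p * (chi (exp y) * exp y))%C.
Proof.
  apply ccont_mult; [apply ccont_pow, ccont_mult; [apply ccont_const|apply ccont_exp]|].
  apply ccont_mult; auto. apply ccont_exp.
Qed.

Lemma ccont_osc z : ccont (fun y => cexp (Ci * exp y * z)).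
Proof. apply ccont_cexp, ccont_mult; [apply ccont_mult; [apply ccont_const|apply ccont_exp]|apply ccont_const].
Qed.

Lemma cdom_lap p z : 0 <= Im z -> cdom (Bp p) (lap_int p z).
Proof.
  intro Hz. split.
  - apply ccont_mult; [apply ccont_lap_weight|apply ccont_osc].
  - intro y. unfold lap_int. rewrite Cmod_mult. rewrite <- (Rmult_1_r (Bp p / (1 + y ^ 2))).
    apply Rmult_le_compat; auto using Cmod_ge_0, Cmod_lap_weight, Cmod_osc.
Qed.

Lemma lap_derive p z : UHP z -> @is_derive C_AbsRing C_NormedModule (lap p) z (lap (S p) z).
Proof.
  intro Hz. unfold UHP in Hz. apply is_derive_C_of_eps. intros eps He.
  assert (HPI := PI_RGT_0).
  assert (HA : 0 <= 2 * PI * Bp (S (S p))) by pos.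
  set (A := 2 * PI * Bp (S (S p))) in *.
  (* For [|u| < Im z] the decay [e^(-X Im z)] absorbs the growth [e^(X |u|)] of the Taylor
     remainder, leaving an error at most [A |u|^2]. *)
  exists (Rmin (Im z) (eps / (A + 1))). split. { pos. }
  intros u Hu. assert (Hu1 := Rlt_le_trans _ _ _ Hu (Rmin_l _ _)).
  assert (Hu2 := Rlt_le_trans _ _ _ Hu (Rmin_r _ _)).
  assert (Hzu : 0 <= Im (z + u)).
  { generalize (im_le_Cmod u). unfold Im in *; simpl. unfold Rabs; destruct Rcase_abs; lra. }
  assert (C1 := cdom_lap p (z + u)%C Hzu). assert (C2 := cdom_lap p z ltac:(lra)).
  assert (C3 := cdom_lap (S p) z ltac:(lra)).
  unfold lap. rewrite <- (cint_scal _ _ u C3), <- (cint_minus _ _ _ _ C1 C2).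
  rewrite <- (cint_minus _ _ _ _ (cdom_minus _ _ _ _ C1 C2) (cdom_scal _ u _ C3)).
  apply Rle_trans with (2 * PI * (Bp (S (S p)) * Cmod u ^ 2)).
  - apply Cmod_cint. split.
    + apply (proj1 (cdom_minus _ _ _ _ (cdom_minus _ _ _ _ C1 C2) (cdom_scal _ u _ C3))).
    + intro y. set (X := exp y). assert (HX : 0 < X) by apply exp_pos. unfold lap_int. fold X.
      replace ((Ci * X) ^ p * (chi X * X) * cexp (Ci * X * (z + u)) - (Ci * X) ^ p * (chi X * X) * cexp (Ci *
        X * z) -
        u * ((Ci * X) ^ S p * (chi X * X) * cexp (Ci * X * z)))%C with
        ((Ci * X) ^ p * (chi X * X) * (cexp (Ci * X * z) * (cexp (Ci * X * u) - 1 - Ci * X * u)))%C.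
      2:{ replace (Ci * X * (z + u))%C with (Ci * X * z + Ci * X * u)%C by ring. rewrite cexp_add. simpl. ring.
      }
      rewrite Cmod_mult.
      assert (Hm : Cmod (Ci * X * u) = X * Cmod u).
      { rewrite 2!Cmod_mult, Cmod_Ci, Cmod_R, Rabs_right by lra. ring. }
      assert (T : Cmod (cexp (Ci * X * z) * (cexp (Ci * X * u) - 1 - Ci * X * u)) <= X ^ 2 * Cmod u ^ 2).
      { rewrite Cmod_mult. apply Rle_trans with (exp (- (X * Im z)) * ((X * Cmod u) ^ 2 * exp (X * Cmod u))).
        - rewrite Cmod_cexp. unfold X at 1. rewrite Re_Ci_exp. fold X.
          apply Rmult_le_compat_l; [left; apply exp_pos|].
          rewrite <- Hm. apply cexp_taylor.
        - rewrite Rpow_mult_distr.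
          replace (exp (- (X * Im z)) * (X ^ 2 * Cmod u ^ 2 * exp (X * Cmod u))) with
            (X ^ 2 * Cmod u ^ 2 * (exp (- (X * Im z)) * exp (X * Cmod u))) by ring.
          rewrite <- exp_plus. rewrite <- (Rmult_1_r (X ^ 2 * Cmod u ^ 2)) at 2. apply Rmult_le_compat_l.
          + pos.
          + rewrite <- exp_0. left. apply exp_increasing. nra. }
      apply Rle_trans with (Cmod ((Ci * X) ^ p * (chi X * X)) * (X ^ 2 * Cmod u ^ 2)).
      * mono.
      * replace (Cmod ((Ci * X) ^ p * (chi X * X)) * (X ^ 2 * Cmod u ^ 2)) with
         (Cmod ((Ci * X) ^ S (S p) * (chi X * X)) * Cmod u ^ 2).
        -- replace (Bp (S (S p)) * Cmod u ^ 2 / (1 + y ^ 2)) with (Bp (S (S p)) / (1 + y ^ 2) * Cmod u ^ 2) by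
             (unfold Rdiv; ring).
           apply Rmult_le_compat_r; [apply pow2_ge_0|]. apply Cmod_lap_weight.
        -- rewrite (Cmod_mult (_ ^ p)), (Cmod_mult (_ ^ S (S p))), 2!Cmod_pow, (Cmod_mult Ci), Cmod_Ci,
             Cmod_R, (Rabs_right X) by lra. simpl. ring.
  - replace (2 * PI * (Bp (S (S p)) * Cmod u ^ 2)) with (A * Cmod u * Cmod u) by (unfold A; ring).
    apply Rmult_le_compat_r; [apply Cmod_ge_0|].
    apply Rle_trans with ((A + 1) * (eps / (A + 1))).
    + mono.
    + right. field. lra.
Qed.

Lemma lap_bound p z : 0 <= Im z -> Cmod (lap p z) <= 2 * PI * D * r ^ p * M (S p).
Proof.
  intro Hz. apply Rle_trans with (1 := Cmod_cint _ _ (cdom_lap p z Hz)). unfold Bp. right. ring.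
Qed.

Lemma osc_lip y (z u : C) : 0 <= Im z -> 0 <= Im u ->
  Cmod (cexp (Ci * exp y * z) - cexp (Ci * exp y * u)) <= exp y * Cmod (z - u).
Proof.
  intros Hz Hu. set (X := exp y). assert (HX : 0 < X) by apply exp_pos.
  assert (HM' := Cmod_MVT (fun s => cexp (Ci * X * (u + s * (z - u))))
    (fun s => cexp (Ci * X * (u + s * (z - u))) * (Ci * X * (z - u)))%C 0 1 (X * Cmod (z - u)) ltac:(lra)).
  cbv beta in HM'. replace (u + 0%R * (z - u))%C with u in HM' by ring.
  replace (u + 1%R * (z - u))%C with z in HM' by ring.
  rewrite Rminus_0_r, Rmult_1_r in HM'. apply HM'.
  - intros s _. apply cderive_cexp, cderive_scal, cderive_line.
  - intros s Hs. rewrite Cmod_mult. rewrite <- (Rmult_1_l (X * Cmod (z - u))).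
    apply Rmult_le_compat; auto using Cmod_ge_0.
    + apply Cmod_osc. unfold Im in *; simpl. nra.
    + rewrite 2!Cmod_mult, Cmod_Ci, Cmod_R, Rabs_right by lra. lra.
Qed.

(** Valid up to the real axis, whence the boundary values: at 0 for the Borel map, at every real
    point for injectivity. *)
Lemma lap_lip p z u : 0 <= Im z -> 0 <= Im u -> Cmod (lap p z - lap p u) <= 2 * PI * Bp (S p) * Cmod (z - u).
Proof.
  intros Hz Hu. assert (C1 := cdom_lap p z Hz). assert (C2 := cdom_lap p u Hu).
  unfold lap. rewrite <- (cint_minus _ _ _ _ C1 C2), Rmult_assoc. apply Cmod_cint. split.
  - apply (proj1 (cdom_minus _ _ _ _ C1 C2)).
  - intro y. unfold lap_int.
    replace ((Ci * exp y) ^ p * (chi (exp y) * exp y) * cexp (Ci * exp y * z) - (Ci * exp y) ^ p * (chi (exp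
      y) * exp y) * cexp (Ci * exp y * u))%C
     with ((Ci * exp y) ^ p * (chi (exp y) * exp y) * (cexp (Ci * exp y * z) - cexp (Ci * exp y * u)))%C by
       ring.
    rewrite Cmod_mult.
    apply Rle_trans with (Cmod ((Ci * exp y) ^ p * (chi (exp y) * exp y)) * (exp y * Cmod (z - u))).
    + apply Rmult_le_compat_l; [apply Cmod_ge_0|]. now apply osc_lip.
    + replace (Bp (S p) * Cmod (z - u) / (1 + y ^ 2)) with (Bp (S p) / (1 + y ^ 2) * Cmod (z - u)) by pos.
      rewrite <- Rmult_assoc. apply Rmult_le_compat_r; [apply Cmod_ge_0|].
      apply Rle_trans with (2 := Cmod_lap_weight (S p) y). right.
      rewrite (Cmod_mult (_ ^ p)), (Cmod_mult (_ ^ S p)), 2!Cmod_pow, (Cmod_mult Ci), Cmod_Ci, Cmod_R,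
        (Rabs_right (exp y)) by pos. simpl. ring.
Qed.

Lemma lap_filterlim p : lap p 0 = 0 -> filterlim (lap p) (within UHP (locally (0 : C))) (locally (0 : C)).
Proof.
  intros H0 P [e He].
  assert (HPI := PI_RGT_0).
  set (A := 2 * PI * Bp (S p)). assert (HA : 0 <= A) by (apply Rmult_le_pos; [lra|auto]).
  (* The 2 covers the [sqrt 2] between square neighbourhoods and the modulus. *)
  assert (Hd : 0 < e / (2 * (A + 1))) by (apply Rdiv_lt_0_compat; [apply cond_pos|lra]).
  exists (mkposreal _ Hd). intros z Hz HU. apply He.
  apply C_NormedModule_mixin_compat1. change (Cmod (lap p z - 0) < e).
  apply C_NormedModule_mixin_compat2 in Hz. change (Cmod (z - 0) < sqrt 2 * (e / (2 * (A + 1)))) in Hz.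
  rewrite <- H0. apply Rle_lt_trans with (1 := lap_lip p z 0 (Rlt_le _ _ HU) (Rle_refl 0)). fold A.
  assert (Hs2 : sqrt 2 < 2). { rewrite <- (sqrt_square 2) at 2 by lra. apply sqrt_lt_1; lra. }
  assert (He0 := cond_pos e).
  assert (Hz2 : Cmod (z - 0) < e / (A + 1)).
  { apply Rlt_trans with (1 := Hz). replace (e / (A + 1)) with (2 * (e / (2 * (A + 1)))) by (field; lra).
    auto. }
  apply Rle_lt_trans with (A * (e / (A + 1))).
  - mono.
  - apply Rmult_lt_reg_r with (A + 1); [lra|].
    replace (A * (e / (A + 1)) * (A + 1)) with (A * e) by (field; lra). nra.
Qed.

(** By continuity the transform also vanishes on the real axis, where it is a Fourier integral with
    phase [exp y]. *)
Lemma lap_injective : (forall z, UHP z -> lap 0 z = 0) -> forall y, chi (exp y) = 0.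
Proof.
  intros H y.
  assert (E : (chi (exp y) * exp y)%C = 0).
  (* [Bp 0] dominates the density, [Bp 1] the density times the phase. *)
  { apply (fourier_unique (fun y => chi (exp y) * exp y)%C exp exp (Bp 0 + Bp 1)).
    - apply ccont_mult; auto. apply ccont_exp.
    - intro x. apply is_derive_Reals, derivable_pt_lim_exp.
    - apply exp_increasing.
    - intro x. generalize (Cmod_lap_weight 0 x). simpl. rewrite Cmult_1_l. intro X.
      apply Rle_trans with (1 := X). apply Rmult_le_compat_r; [apply cauchy_weight_ge_0|].
      generalize (Bp_pos 1). lra.
    - intro x. generalize (Cmod_lap_weight 1 x). rewrite Cpow_1_r, 2!Cmod_mult, Cmod_Ci, Cmod_R. intro X.
      rewrite Rmult_comm. rewrite Rmult_1_l in X.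
      apply Rle_trans with (1 := X). apply Rmult_le_compat_r; [apply cauchy_weight_ge_0|].
      generalize (Bp_pos 0). lra.
    - intros k t. assert (Ct := cdom_lap 0 (RtoC t) (Rle_refl 0)).
      rewrite (rint_ext _ (fun y => Re (k * lap_int 0 (RtoC t) y))).
      2:{ intro x. f_equal. unfold lap_int. simpl.
      replace (Ci * exp x * t)%C with ((0, t * exp x)%R : C) by Cext. ring. }
      rewrite <- (Re_scal_cint _ _ k Ct). fold (lap 0 (RtoC t)).
      replace (lap 0 (RtoC t)) with (RtoC 0). { unfold Re; simpl; ring. }
      symmetry. apply Cmod_eq_0. apply Rle_antisym; [|apply Cmod_ge_0].
      apply le_epsilon. intros e He. rewrite Rplus_0_l.
      assert (HPI := PI_RGT_0).
      set (A := 2 * PI * Bp 1). assert (HA : 0 <= A) by (apply Rmult_le_pos; [lra|auto]).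
      assert (He' : 0 < e / (A + 1)) by pos.
      assert (L := lap_lip 0 (RtoC t) (t, e / (A + 1)) (Rle_refl 0) (Rlt_le _ _ He')).
      rewrite (H (t, e / (A + 1))) in L by exact He'.
      replace (lap 0 t - 0)%C with (lap 0 t) in L by ring. apply Rle_trans with (1 := L).
      fold A. replace (RtoC t - (t, e / (A + 1))%R)%C with (- (Ci * (e / (A + 1))%R))%C by Cext.
      rewrite Cmod_opp, Cmod_mult, Cmod_Ci, Cmod_R, Rabs_right by lra.
      apply Rmult_le_reg_r with (A + 1); [lra|].
      replace (A * (1 * (e / (A + 1))) * (A + 1)) with (A * e) by (field; lra). nra. }
  assert (Hx : RtoC (exp y) <> 0). { intro X. apply (f_equal Re) in X. simpl in X. generalize (exp_pos y). lra.
  }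
  replace (chi (exp y)) with (chi (exp y) * exp y * / exp y)%C by (field; auto). rewrite E. ring.
Qed.
End Laplace.

(** * Moments as derivatives of the Laplace transform at 0 *)

Lemma filterlim_exp_opp : filterlim (fun n => exp (- INR n)) eventually (at_right 0).
Proof.
  intros P [d Hd].
  destruct (nfloor_ex (/ d)) as [N [_ HN]]. { left. apply Rinv_0_lt_compat, cond_pos. }
  exists (S N). intros n Hn. apply le_INR in Hn. rewrite S_INR in Hn.
  apply Hd; [|apply exp_pos].
  unfold ball; simpl. unfold AbsRing_ball, abs, minus, plus, opp; simpl.
  rewrite Ropp_0, Rplus_0_r, Rabs_right by pos.
  rewrite exp_Ropp. assert (Hd0 := cond_pos d).
  assert (/ d < exp (INR n)) by (generalize (exp_ineq1_le (INR n)); lra).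
  apply Rmult_lt_reg_r with (exp (INR n)); [apply exp_pos|].
  rewrite Rinv_l by pos.
  apply Rmult_lt_reg_l with (/ d); [now apply Rinv_0_lt_compat|]. rewrite <- Rmult_assoc, Rinv_l by lra. lra.
Qed.

Lemma filterlim_exp_INR : filterlim (fun n => exp (INR n)) eventually (Rbar_locally p_infty).
Proof.
  intros P [A HA].
  destruct (nfloor_ex (Rmax A 0)) as [N [_ HN]]. { apply Rmax_r. }
  exists (S N). intros n Hn. apply le_INR in Hn. rewrite S_INR in Hn.
  apply HA. generalize (exp_ineq1_le (INR n)) (Rmax_l A 0). lra.
Qed.

(** The improper limit is restricted to the windows [[e^(-n), e^n]], which [exp] makes correspond to
    those of [rint]. *)
Lemma moment_is_eps phi p l : moment_is phi p l -> forall e, 0 < e ->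
  eventually (fun n => exists v : C, is_RInt (V := C_R_NormedModule) (fun x => scal (x ^ p) (phi x)) (exp (-
    INR n)) (exp (INR n)) v /\
    Rabs (Re v - Re l) < e /\ Rabs (Im v - Im l) < e).
Proof.
  intros H e He.
  destruct (H _ (locally_ball l (mkposreal e He))) as [Q R HQ HR HQR].
  apply filterlim_exp_opp in HQ. apply filterlim_exp_INR in HR.
  destruct HQ as [N1 HN1], HR as [N2 HN2]. exists (N1 + N2)%nat. intros n Hn.
  destruct (HQR (exp (- INR n)) (exp (INR n)) (HN1 n ltac:(lia)) (HN2 n ltac:(lia))) as [v [Hv [B1 B2]]].
  exists v. auto.
Qed.

Lemma RInt_exp_subst (q : R -> R) (n : nat) (v : R) :
  (forall y, continuous q (exp y)) ->
  is_RInt q (exp (- INR n)) (exp (INR n)) v -> RInt (fun y => exp y * q (exp y)) (- INR n) (INR n) = v.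
Proof.
  intros Hc Hv. apply is_RInt_unique. rewrite <- (is_RInt_unique _ _ _ _ Hv).
  apply (@is_RInt_comp R_CompleteNormedModule q exp exp).
  - auto.
  - intros y _. split; [apply is_derive_Reals, derivable_pt_lim_exp|].
    apply continuous_exp.
Qed.

Lemma moments_eq_lap (phi psi : R -> C) (p : nat) (l : C) (K : R) :
  (forall x, 0 < x -> continuous phi x) -> (forall x, 0 < x -> continuous psi x) ->
  cdom K (fun y => RtoC (exp y ^ p) * ((phi (exp y) - psi (exp y)) * exp y))%C ->
  moment_is phi p l -> moment_is psi p l ->
  cint (fun y => RtoC (exp y ^ p) * ((phi (exp y) - psi (exp y)) * exp y))%C = 0.
Proof.
  intros H1 H2 HD M1 M2.
  (* [part] stands for [Re] or [Im], so that both components are treated at once. *)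
  assert (X : forall (part : C -> R) , (forall v, part v = fst v) \/ (forall v, part v = snd v) ->
    dom K (fun y => part (RtoC (exp y ^ p) * ((phi (exp y) - psi (exp y)) * exp y))%C) ->
    rint (fun y => part (RtoC (exp y ^ p) * ((phi (exp y) - psi (exp y)) * exp y))%C) = 0).
  { intros part Hpart Hd. apply (rint_unique K _ _ Hd). apply is_lim_seq_spec. intros [e He].
    assert (He' : 0 < e / 2) by lra.
    generalize (filter_and _ _ (moment_is_eps _ _ _ M1 _ He') (moment_is_eps _ _ _ M2 _ He')).
    apply filter_imp. intros n [[v [Hv [Hv1 Hv2]]] [w [Hw [Hw1 Hw2]]]]. simpl. rewrite Rminus_0_r.
    set (q := fun x => part (minus (scal (x ^ p) (phi x)) (scal (x ^ p) (psi x) : C_R_NormedModule))).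
    assert (Hq : is_RInt q (exp (- INR n)) (exp (INR n)) (part (v - w)%C)).
    { assert (Y := @is_RInt_minus C_R_NormedModule _ _ _ _ _ _ Hv Hw).
      destruct Hpart as [Hp | Hp].
      - apply (is_RInt_ext (fun x => fst (minus (scal (x ^ p) (phi x)) (scal (x ^ p) (psi x) :
          C_R_NormedModule)))); [intros; unfold q; now rewrite Hp|].
        rewrite Hp. apply (is_RInt_fct_extend_fst (U := R_NormedModule) (V := R_NormedModule) _ _ _ _ Y).
      - apply (is_RInt_ext (fun x => snd (minus (scal (x ^ p) (phi x)) (scal (x ^ p) (psi x) :
          C_R_NormedModule)))); [intros; unfold q; now rewrite Hp|].
        rewrite Hp. apply (is_RInt_fct_extend_snd (U := R_NormedModule) (V := R_NormedModule) _ _ _ _ Y). }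
    assert (Hqc : forall y, continuous q (exp y)).
    { intro y. assert (Z : continuous (fun x => minus (scal (x ^ p) (phi x)) (scal (x ^ p) (psi x) :
        C_R_NormedModule)) (exp y)).
      { assert (Hpow : continuous (fun x : R => x ^ p) (exp y)).
        { apply (continuous_derive _ _ (INR p * exp y ^ pred p)). apply is_derive_Reals, derivable_pt_lim_pow. }
        apply (@continuous_minus R_UniformSpace R_AbsRing C_R_NormedModule);
        apply (@continuous_scal R_UniformSpace R_AbsRing C_R_NormedModule); auto; [apply H1|apply H2];
          apply exp_pos. }
      destruct Hpart as [Hp | Hp].
      - apply (continuous_ext (fun x => fst (minus (scal (x ^ p) (phi x)) (scal (x ^ p) (psi x) :
          C_R_NormedModule)))); [intros; unfold q; now rewrite Hp|].
        apply (continuous_comp _ fst); [exact Z|apply continuous_fst].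
      - apply (continuous_ext (fun x => snd (minus (scal (x ^ p) (phi x)) (scal (x ^ p) (psi x) :
          C_R_NormedModule)))); [intros; unfold q; now rewrite Hp|].
        apply (continuous_comp _ snd); [exact Z|apply continuous_snd]. }
    assert (E := RInt_exp_subst q n _ Hqc Hq).
    rewrite (RInt_ext _ (fun y => exp y * q (exp y))).
    - rewrite E. destruct Hpart as [Hp|Hp]; rewrite Hp; simpl; unfold Re, Im in *.
      + replace (fst v + - fst w) with ((fst v - fst l) - (fst w - fst l)) by ring.
        unfold Rminus at 1. apply Rle_lt_trans with (1 := Rabs_triang _ _). rewrite Rabs_Ropp. lra.
      + replace (snd v + - snd w) with ((snd v - snd l) - (snd w - snd l)) by ring.
        unfold Rminus at 1. apply Rle_lt_trans with (1 := Rabs_triang _ _). rewrite Rabs_Ropp. lra.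
    - intros y _. unfold q.
      destruct Hpart as [Hp|Hp]; rewrite 2!Hp; unfold minus, plus, opp, scal; simpl; unfold scal; simpl;
        unfold mult; simpl; unfold plus, opp; simpl; ring. }
  unfold cint. apply C_eq; simpl.
  - apply (X Re); [now left|now apply (cdom_Re K)].
  - apply (X Im); [now right|now apply (cdom_Im K)].
Qed.

Lemma borel_injective_moment_injective M : weight_seq M -> cond_sm M ->
  borel_injective (shift1 M) -> moment_injective (C_M M).
Proof.
  intros HM Hsm HB phi psi [Hc1 [h1 [K1 [Hh1 HK1]]]] [Hc2 [h2 [K2 [Hh2 HK2]]]] Hmom.
  set (chi := fun x => (phi x - psi x)%C).
  set (h := Rmax h1 h2). assert (Hh : 0 < h) by (unfold h; apply Rlt_le_trans with (1 := Hh1), Rmax_l).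
  assert (HMp : forall p, 0 < M p) by apply HM.
  assert (Hchi : forall p x, 0 < x -> x ^ p * Cmod (chi x) <= (Rabs K1 + Rabs K2) * h ^ p * M p).
  { intros p x Hx. unfold chi, Cminus. assert (Hxp : 0 < x ^ p) by now apply pow_lt.
    apply Rle_trans with (x ^ p * Cmod (phi x) + x ^ p * Cmod (psi x)).
    - rewrite <- Rmult_plus_distr_l. apply Rmult_le_compat_l; [lra|].
      apply Rle_trans with (1 := Cmod_triangle _ _). rewrite Cmod_opp. lra.
    - rewrite 2!Rmult_plus_distr_r. apply Rplus_le_compat.
      + apply Rle_trans with (1 := HK1 p x Hx), pow_bound_weaken; [split; [lra|apply Rmax_l]|left; auto].
      + apply Rle_trans with (1 := HK2 p x Hx), pow_bound_weaken; [split; [lra|apply Rmax_r]|left; auto]. }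
  assert (Hcc : ccont (fun y => chi (exp y))).
  { intro y.
    assert (He := continuous_exp y).
    assert (C1 := continuous_comp exp phi y He (Hc1 _ (exp_pos y))).
    assert (C2 := continuous_comp exp psi y He (Hc2 _ (exp_pos y))).
    split; simpl; apply @continuous_minus.
    - apply (continuous_comp (fun y => phi (exp y)) fst); [exact C1|apply continuous_fst].
    - apply (continuous_comp (fun y => psi (exp y)) fst); [exact C2|apply continuous_fst].
    - apply (continuous_comp (fun y => phi (exp y)) snd); [exact C1|apply continuous_snd].
    - apply (continuous_comp (fun y => psi (exp y)) snd); [exact C2|apply continuous_snd]. }
  assert (HK : 0 <= Rabs K1 + Rabs K2) by pos.
  destruct (moment_bound M chi h (Rabs K1 + Rabs K2) HM Hsm Hh HK Hchi) as [D [r [HD [Hr HDr]]]].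
  assert (HPI := PI_RGT_0).
  (* At 0 the oscillating factor is 1, so the value is [i^p] times the difference of the two
     moments. *)
  assert (Hlap0 : forall p, lap chi p 0 = 0).
  { intro p. destruct (Hmom p) as [l [Hl1 Hl2]].
    assert (CW : cdom (D * r ^ p * M (S p)) (fun y => RtoC (exp y ^ p) * ((phi (exp y) - psi (exp y)) * exp
      y))%C).
    { split.
      - apply ccont_mult.
        + apply ccont_pair; [|intro; apply continuous_const]. intro y.
          apply (continuous_derive _ _ (INR p * exp y ^ pred p * exp y)).
          evar_last. { apply is_derive_pow, is_derive_Reals, derivable_pt_lim_exp. } ring.
        + apply ccont_mult; [exact Hcc|apply ccont_exp].
      - intro y. apply Rle_trans with (2 := HDr p y). right.
        rewrite 2!Cmod_mult, 2!Cmod_R, (Rabs_right (exp y)) by pos.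
        rewrite Rabs_right by pos. unfold chi. simpl. ring. }
    assert (E := moments_eq_lap phi psi p l _ Hc1 Hc2 CW Hl1 Hl2).
    unfold lap. rewrite (cint_ext _ (fun y => Ci ^ p * (RtoC (exp y ^ p) * ((phi (exp y) - psi (exp y)) * exp
      y)))%C).
    - rewrite (cint_scal _ _ _ CW), E. ring.
    - intro y. unfold lap_int. rewrite Cmult_0_r, cexp_0.
      rewrite RtoC_pow. unfold chi. rewrite Cpow_mult_l. ring. }
  assert (HT : cderiv_tower (lap chi 0) (lap chi)).
  { intros z Hz. split; auto. intro p. now apply (lap_derive M chi HM Hcc D r HD Hr HDr). }
  assert (HT0 : cderiv_tower (fun _ => RtoC 0) (fun _ _ => RtoC 0)).
  { intros z Hz. split; auto. intro p. apply @is_derive_const. }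
  assert (Hzero : forall z, UHP z -> lap chi 0 z = 0).
  { apply (HB (lap chi 0) (fun _ => RtoC 0) (fun _ => RtoC 0)).
    - exists r. split; auto. exists (lap chi). split; auto. exists (2 * PI * D). intros p z Hz. unfold shift1.
      apply (lap_bound M chi Hcc D r HDr). now left.
    - exists r. split; auto. exists (fun _ _ => RtoC 0). split; auto. exists 0. intros p z Hz. rewrite Cmod_0.
      right; ring.
    - exists (lap chi). split; auto. intro p. apply (lap_filterlim M chi HM Hcc D r HD Hr HDr); auto.
    - exists (fun _ _ => RtoC 0). split; auto. intro p. apply filterlim_const. }
  intros x Hx. assert (Z := lap_injective M chi HM Hcc D r HD Hr HDr Hzero (ln x)). rewrite exp_ln in Z by auto.
  unfold chi in Z. replace (phi x) with ((phi x - psi x) + psi x)%C by ring. rewrite Z. ring.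
Qed.

(** * Infinite convolutions of box functions *)

Definition lip (L : R) (f : R -> R) : Prop := forall x y, Rabs (f x - f y) <= L * Rabs (x - y).

(** Convolution with [b] times the indicator of [[0, 1/b]], rescaled to a fixed interval: the mean
    of [f] over [[x - 1/b, x]]. *)
Definition boxavg (b : R) (f : R -> R) (x : R) : R := RInt (fun v => f (x - v / b)) 0 1.

Lemma lip_continuous L f : lip L f -> forall x, continuous f x.
Proof.
  intros H x. apply continuity_pt_filterlim. intros e He.
  assert (HL := Rabs_pos L).
  exists (e / (Rabs L + 1)). split; [apply Rdiv_lt_0_compat; lra|].
  intros y [_ Hy]. simpl in *. unfold R_dist in *. apply Rle_lt_trans with (1 := H y x).
  apply Rle_lt_trans with (Rabs L * Rabs (y - x)). { apply Rmult_le_compat_r; [apply Rabs_pos|apply Rle_abs]. }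
  apply Rmult_lt_compat_l with (r := Rabs L + 1) in Hy; [|lra].
  replace ((Rabs L + 1) * (e / (Rabs L + 1))) with e in Hy by (field; lra).
  nra.
Qed.

Lemma boxavg_cont (b : R) (f : R -> R) (x : R) : (forall y, continuous f y) -> forall v, continuous (fun v =>
  f (x - v / b)) v.
Proof.
  intros H v. apply (continuous_comp (fun v => x - v / b) f); auto.
  apply (continuous_derive _ _ (- / b)). auto_derive; auto. pos.
Qed.

Lemma boxavg_ex (b : R) (f : R -> R) (x : R) : (forall y, continuous f y) -> ex_RInt (fun v => f (x - v / b))
  0 1.
Proof. intro H. apply ex_RInt_cont, boxavg_cont, H. Qed.

Lemma boxavg_arg b x v : 0 < b -> 0 < v < 1 -> x - / b <= x - v / b <= x.
Proof.
  intros Hb Hv. assert (H : 0 < / b) by now apply Rinv_0_lt_compat. nra.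
Qed.

Lemma RInt_const01 (c : R) : RInt (fun _ => c) 0 1 = c.
Proof. rewrite RInt_const. unfold scal; simpl; unfold mult; simpl. ring. Qed.

Lemma boxavg_between (b : R) (f : R -> R) (x lo hi : R) : 0 < b -> (forall y, continuous f y) ->
  (forall y, x - / b <= y <= x -> lo <= f y <= hi) -> lo <= boxavg b f x <= hi.
Proof.
  intros Hb Hc H. unfold boxavg. split.
  - rewrite <- (RInt_const01 lo). apply RInt_le; [lra|apply ex_RInt_const|now apply boxavg_ex|].
    intros v Hv. apply H. now apply boxavg_arg.
  - rewrite <- (RInt_const01 hi). apply RInt_le; [lra|now apply boxavg_ex|apply ex_RInt_const|].
    intros v Hv. apply H. now apply boxavg_arg.
Qed.

Lemma boxavg_dist (b : R) (f g : R -> R) (x y e : R) : (forall y, continuous f y) -> (forall y, continuous g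
  y) ->
  (forall v, 0 <= v <= 1 -> Rabs (f (x - v / b) - g (y - v / b)) <= e) -> Rabs (boxavg b f x - boxavg b g y)
    <= e.
Proof.
  intros Hf Hg H. unfold boxavg.
  rewrite <- (RInt_minus (fun v => f (x - v / b)) (fun v => g (y - v / b))) by now apply boxavg_ex.
  apply (norm_RInt_le (fun v => minus (f (x - v / b)) (g (y - v / b))) (fun _ => e) 0 1); [lra|apply H| |].
  - apply (@RInt_correct R_CompleteNormedModule). apply @ex_RInt_minus; now apply boxavg_ex.
  - evar_last; [apply @is_RInt_const|]. unfold scal; simpl; unfold mult; simpl. ring.
Qed.

Lemma boxavg_lip b L f : lip L f -> lip L (boxavg b f).
Proof.
  intros H x y. assert (Hc := lip_continuous L f H). apply boxavg_dist; auto.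
  intros v _. apply Rle_trans with (1 := H _ _). right. f_equal. f_equal. ring.
Qed.

Lemma boxavg_near b L f x : 0 < b -> 0 <= L -> lip L f -> Rabs (boxavg b f x - f x) <= L / b.
Proof.
  intros Hb HL H. assert (Hc := lip_continuous L f H).
  assert (E : boxavg b (fun _ => f x) x = f x) by (unfold boxavg; apply (RInt_const01 (f x))).
  replace (boxavg b f x - f x) with (boxavg b f x - boxavg b (fun _ => f x) x) by now rewrite E.
  apply boxavg_dist; auto. { intro; apply continuous_const. }
  intros v Hv. apply Rle_trans with (1 := H _ _). unfold Rdiv at 2. apply Rmult_le_compat_l; auto.
  assert (0 < / b) by now apply Rinv_0_lt_compat.
  replace (x - v / b - x) with (- (v * / b)) by (unfold Rdiv; ring). rewrite Rabs_Ropp, Rabs_right; [nra|].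
  pos.
Qed.

(** The form in which averages are differentiated and their moments computed. *)
Lemma boxavg_prim (b : R) (f : R -> R) (x : R) : 0 < b -> (forall y, continuous f y) ->
  boxavg b f x = b * (RInt f 0 x - RInt f 0 (x - / b)).
Proof.
  intros Hb Hc. unfold boxavg. assert (E := fun a c => ex_RInt_cont f a c Hc).
  assert (R : RInt (fun v => (- / b) * f ((- / b) * v + x)) 0 1 = RInt f (- / b * 0 + x) (- / b * 1 + x)).
  { apply (RInt_comp_lin f (- / b) x 0 1). apply E. }
  rewrite (RInt_ext _ (fun v => scal (- b) ((- / b) * f ((- / b) * v + x)))).
  - rewrite (RInt_scal (fun v => (- / b) * f ((- / b) * v + x))).
    + rewrite R. rewrite <- (RInt_Chasles f (- / b * 0 + x) 0 (- / b * 1 + x)) by auto.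
      replace (- / b * 0 + x) with x by ring. replace (- / b * 1 + x) with (x - / b) by ring.
      rewrite <- (opp_RInt_swap f x 0) by auto. unfold scal, plus, opp; simpl; unfold mult; simpl. ring.
    + apply (ex_RInt_ext (fun v => scal (- / b) (f (x - v / b)))).
      * intros v _. unfold scal; simpl; unfold mult; simpl. f_equal. f_equal. pos.
      * apply @ex_RInt_scal. now apply boxavg_ex.
  - intros v _. unfold scal; simpl; unfold mult; simpl.
    replace (- / b * v + x) with (x - v / b) by (unfold Rdiv; ring). field. lra.
Qed.

Lemma RInt_0_derive (f : R -> R) (x : R) : (forall y, continuous f y) -> is_derive (fun x => RInt f 0 x) x (f
  x).
Proof.
  intro Hc. apply (@is_derive_RInt R_NormedModule f (fun x => RInt f 0 x) 0 x); [|apply Hc].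
  exists (mkposreal 1 Rlt_0_1). intros y _. apply (@RInt_correct R_CompleteNormedModule).
  now apply ex_RInt_cont.
Qed.

Lemma boxavg_derive (b : R) (f : R -> R) (x : R) : 0 < b -> (forall y, continuous f y) ->
  is_derive (boxavg b f) x (b * (f x - f (x - / b))).
Proof.
  intros Hb Hc. apply (is_derive_ext (fun x => b * (RInt f 0 x - RInt f 0 (x - / b)))).
  { intro t. symmetry. now apply boxavg_prim. }
  apply is_derive_scal. apply @is_derive_minus; [now apply RInt_0_derive|].
  evar_last.
  - apply (is_derive_comp (fun x => RInt f 0 x) (fun x => x - / b)); [now apply RInt_0_derive|].
    apply @is_derive_minus; [apply @is_derive_id|apply @is_derive_const].
  - unfold scal, minus, plus, opp, one, zero; simpl; unfold mult; simpl. ring.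
Qed.

Section Cascade.
Variables (b : nat -> R) (f : R -> R) (S L : R).

Fixpoint invsum (n : nat) : R := match n with 0%nat => 0 | Datatypes.S n => invsum n + / b n end.
Fixpoint prodb (n : nat) : R := match n with 0%nat => 1 | Datatypes.S n => prodb n * b n end.
(** Boxes of index [q] to [q + n - 1] with the lowest one outermost, so that peeling it off leaves
    [casc] at [q + 1]. *)
Fixpoint casc (q n : nat) : R -> R :=
  match n with 0%nat => f | Datatypes.S n => boxavg (b q) (casc (Datatypes.S q) n) end.
Definition casc_lim (q : nat) (x : R) : R := real (Lim_seq (fun n => casc q n x)).
(** The derivative of [boxavg (b k) g]. [bdiffs q] is what [q] differentiations make of the first
    [q] boxes. *)
Definition bdiff (k : nat) (g : R -> R) (x : R) : R := b k * (g x - g (x - / b k)).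
Fixpoint bdiffs (q : nat) (g : R -> R) : R -> R :=
  match q with 0%nat => g | Datatypes.S q => bdiffs q (bdiff q g) end.

Hypothesis Hb : forall k, 0 < b k.
Hypothesis HS : forall n, invsum n <= S.
Hypothesis HL : 0 <= L.
Hypothesis Hf : lip L f.

Lemma invsum_S_le n : invsum n <= invsum (Datatypes.S n).
Proof. simpl. generalize (Rinv_0_lt_compat _ (Hb n)). lra. Qed.

Lemma invsum_mono n m : (n <= m)%nat -> invsum n <= invsum m.
Proof. induction 1; [lra|]. apply Rle_trans with (1 := IHle), invsum_S_le. Qed.

Lemma casc_lip n : forall q, lip L (casc q n).
Proof. induction n; intro q; simpl; auto. now apply boxavg_lip. Qed.

Lemma casc_cont n q x : continuous (casc q n) x.
Proof. apply (lip_continuous L), casc_lip. Qed.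

(** Averages look only to the left, by the sum of the widths. Supremum bounds, supports and
    positivity all follow from this locality. *)
Lemma casc_between n : forall q x lo hi,
  (forall y, x - (invsum (q + n) - invsum q) <= y <= x -> lo <= f y <= hi) -> lo <= casc q n x <= hi.
Proof.
  induction n as [|n IH]; intros q x lo hi H; simpl.
  - apply H. rewrite Nat.add_0_r. lra.
  - apply boxavg_between; auto. { intro; apply casc_cont. }
    intros y Hy. apply IH. intros z Hz. apply H.
    replace (q + Datatypes.S n)%nat with (Datatypes.S q + n)%nat by lia.
    simpl invsum in Hz at 2. lra.
Qed.

(** The additional box is innermost and moves [f] by at most [L / b]; the outer averages do not
    enlarge that. *)
Lemma casc_step n : forall q x, Rabs (casc q (Datatypes.S n) x - casc q n x) <= L / b (q + n).
Proof.
  induction n as [|n IH]; intros q x.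
  - simpl. rewrite Nat.add_0_r. now apply boxavg_near.
  - change (casc q (Datatypes.S (Datatypes.S n))) with (boxavg (b q) (casc (Datatypes.S q) (Datatypes.S n))).
    change (casc q (Datatypes.S n)) with (boxavg (b q) (casc (Datatypes.S q) n)).
    apply boxavg_dist; try (intro; apply casc_cont).
    intros v _. replace (q + Datatypes.S n)%nat with (Datatypes.S q + n)%nat by lia. apply IH.
Qed.

Lemma casc_cauchy q x n m : (n <= m)%nat ->
  Rabs (casc q m x - casc q n x) <= L * (invsum (q + m) - invsum (q + n)).
Proof.
  induction 1 as [|m Hm IH].
  - rewrite 2!Rminus_diag, Rabs_R0. lra.
  - replace (casc q (Datatypes.S m) x - casc q n x) with
      ((casc q (Datatypes.S m) x - casc q m x) + (casc q m x - casc q n x)) by ring.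
    apply Rle_trans with (1 := Rabs_triang _ _). generalize (casc_step m q x).
    replace (q + Datatypes.S m)%nat with (Datatypes.S (q + m)) by lia. simpl invsum. pos.
Qed.

Lemma invsum_lim : exists l : R, is_lim_seq invsum l /\ forall n, invsum n <= l.
Proof.
  destruct (ex_finite_lim_seq_incr invsum S invsum_S_le HS) as [l Hl]. exists l. split; auto.
  intro n. apply (is_lim_seq_incr_compare invsum l Hl invsum_S_le).
Qed.

Definition tailb (n : nat) : R := real (Lim_seq invsum) - invsum n.

Lemma tailb_lim : is_lim_seq tailb 0.
Proof.
  destruct invsum_lim as [l [Hl _]]. unfold tailb. rewrite (is_lim_seq_unique _ _ Hl). simpl.
  replace (Finite 0) with (Finite (l - l)) by (f_equal; ring).
  apply is_lim_seq_minus'; [apply is_lim_seq_const|exact Hl].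
Qed.

Lemma tailb_ge n m : invsum m - invsum n <= tailb n.
Proof.
  destruct invsum_lim as [l [Hl H]]. unfold tailb. rewrite (is_lim_seq_unique _ _ Hl). simpl.
  specialize (H m). lra.
Qed.

Lemma tailb_0 n : 0 <= tailb n.
Proof. generalize (tailb_ge n n). lra. Qed.

Lemma casc_lim_correct q x : is_lim_seq (fun n => casc q n x) (casc_lim q x).
Proof.
  unfold casc_lim. apply Lim_seq_correct'. apply ex_lim_seq_cauchy_corr. intros e.
  assert (HT := tailb_lim). apply is_lim_seq_spec in HT.
  assert (He : 0 < e / (L + 1)) by (apply Rdiv_lt_0_compat; [apply cond_pos|lra]).
  destruct (HT (mkposreal _ He)) as [N HN]. simpl in HN.
  assert (W : forall n m, (N <= n)%nat -> (n <= m)%nat -> Rabs (casc q m x - casc q n x) < e).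
  { intros n m Hn Hm. apply Rle_lt_trans with (1 := casc_cauchy q x n m Hm).
    specialize (HN (q + n)%nat ltac:(lia)). rewrite Rminus_0_r, Rabs_right in HN by (apply Rle_ge, tailb_0).
    assert (X := tailb_ge (q + n) (q + m)). assert (X0 := tailb_0 (q + n)).
    apply Rle_lt_trans with (L * tailb (q + n)); [now apply Rmult_le_compat_l|].
    apply Rle_lt_trans with ((L + 1) * tailb (q + n)); [nra|].
    apply Rmult_lt_compat_l with (r := L + 1) in HN; [|lra].
    replace ((L + 1) * (e / (L + 1))) with (pos e) in HN by (field; lra). exact HN. }
  exists N. intros n m Hn Hm. destruct (Nat.le_ge_cases n m).
  - rewrite Rabs_minus_sym. now apply W.
  - now apply W.
Qed.

Lemma casc_lim_near q x n : Rabs (casc_lim q x - casc q n x) <= L * tailb (q + n).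
Proof.
  apply (is_lim_seq_le_loc (fun m => Rabs (casc q m x - casc q n x)) (fun _ => L * tailb (q + n))
    (Rabs (casc_lim q x - casc q n x)) (L * tailb (q + n))).
  - exists n. intros m Hm. apply Rle_trans with (1 := casc_cauchy q x n m Hm).
    apply Rmult_le_compat_l; auto. apply tailb_ge.
  - apply (is_lim_seq_abs _ (Finite (casc_lim q x - casc q n x))).
    apply is_lim_seq_minus'; [apply casc_lim_correct|apply is_lim_seq_const].
  - apply is_lim_seq_const.
Qed.

Lemma casc_lim_lip q : lip L (casc_lim q).
Proof.
  intros x y. apply (is_lim_seq_le (fun n => Rabs (casc q n x - casc q n y)) (fun _ => L * Rabs (x - y))
    (Rabs (casc_lim q x - casc_lim q y)) (L * Rabs (x - y))).
  - intro n. apply casc_lip.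
  - apply (is_lim_seq_abs _ (Finite (casc_lim q x - casc_lim q y))).
    apply is_lim_seq_minus'; apply casc_lim_correct.
  - apply is_lim_seq_const.
Qed.

Lemma casc_lim_between q x lo hi :
  (forall y, x - (S - invsum q) <= y <= x -> lo <= f y <= hi) -> lo <= casc_lim q x <= hi.
Proof.
  intro H. assert (X : forall n, lo <= casc q n x <= hi).
  { intro n. apply casc_between. intros y Hy. apply H. generalize (HS (q + n)). lra. }
  split.
  - apply (is_lim_seq_le (fun _ => lo) (fun n => casc q n x) lo (casc_lim q x));
     [intro; apply X|apply is_lim_seq_const|apply casc_lim_correct].
  - apply (is_lim_seq_le (fun n => casc q n x) (fun _ => hi) (casc_lim q x) hi);
     [intro; apply X|apply casc_lim_correct|apply is_lim_seq_const].
Qed.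

(** Both sides lie within [L] times a tail of the widths of the same finite cascade. *)
Lemma casc_lim_boxavg q x : casc_lim q x = boxavg (b q) (casc_lim (Datatypes.S q)) x.
Proof.
  apply Rminus_diag_uniq, Rabs_eq_0, Rle_antisym; [|apply Rabs_pos].
  apply (is_lim_seq_le (fun _ => Rabs (casc_lim q x - boxavg (b q) (casc_lim (Datatypes.S q)) x))
    (fun n => 2 * L * tailb (n + Datatypes.S q)) (Rabs (casc_lim q x - boxavg (b q) (casc_lim (Datatypes.S q))
      x)) 0).
  - intro n.
    replace (casc_lim q x - boxavg (b q) (casc_lim (Datatypes.S q)) x) with
      ((casc_lim q x - casc q (Datatypes.S n) x) - (boxavg (b q) (casc_lim (Datatypes.S q)) x - casc q
        (Datatypes.S n) x)) by ring.
    unfold Rminus at 1. apply Rle_trans with (1 := Rabs_triang _ _). rewrite Rabs_Ropp.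
    assert (H1 := casc_lim_near q x (Datatypes.S n)).
    assert (H2 : Rabs (boxavg (b q) (casc_lim (Datatypes.S q)) x - casc q (Datatypes.S n) x) <= L * tailb
      (Datatypes.S q + n)).
    { simpl casc. apply boxavg_dist.
      - intro; apply (lip_continuous L), casc_lim_lip.
      - intro; apply casc_cont.
      - intros v _. apply casc_lim_near. }
    replace (q + Datatypes.S n)%nat with (n + Datatypes.S q)%nat in H1 by lia.
    replace (Datatypes.S q + n)%nat with (n + Datatypes.S q)%nat in H2 by lia. lra.
  - apply is_lim_seq_const.
  - replace (Finite 0) with (Rbar_mult (2 * L) 0) by (simpl; f_equal; ring).
    apply is_lim_seq_scal_l. apply (is_lim_seq_incr_n tailb). apply tailb_lim.
Qed.

Lemma bdiffs_derive q : forall g dg, (forall x, is_derive g x (dg x)) ->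
  forall x, is_derive (bdiffs q g) x (bdiffs q dg x).
Proof.
  induction q as [|q IH]; intros g dg H x; simpl; auto.
  apply IH. intro y. unfold bdiff. apply is_derive_scal, @is_derive_minus; auto.
  evar_last.
  - apply (is_derive_comp g (fun x => x - / b q)); [apply H|].
    apply @is_derive_minus; [apply @is_derive_id|apply @is_derive_const].
  - unfold scal, minus, plus, opp, one, zero; simpl; unfold mult; simpl. ring.
Qed.

Lemma bdiffs_bound q : forall g x C, (forall y, x - invsum q <= y <= x -> Rabs (g y) <= C) ->
  Rabs (bdiffs q g x) <= 2 ^ q * prodb q * C.
Proof.
  induction q as [|q IH]; intros g x C H; simpl bdiffs.
  - simpl. rewrite 2!Rmult_1_l. apply H. simpl. lra.
  - apply Rle_trans with (2 ^ q * prodb q * (2 * b q * C)).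
    + apply IH. intros y Hy. unfold bdiff. assert (Hq := Hb q). assert (Hi := Rinv_0_lt_compat _ Hq).
      rewrite Rabs_mult, (Rabs_right (b q)) by lra.
      simpl in H.
      assert (H1 := H y ltac:(lra)). assert (H2 := H (y - / b q) ltac:(lra)).
      assert (Rabs (g y - g (y - / b q)) <= 2 * C).
      { unfold Rminus at 1. apply Rle_trans with (1 := Rabs_triang _ _). rewrite Rabs_Ropp. lra. }
      nra.
    + right. simpl. ring.
Qed.

(** The [q]-th derivative of [casc_lim 0]: the first [q] boxes have become difference operators,
    each costing [2 b_k], and the later ones still average. *)
Definition casc_tower (q : nat) : R -> R := bdiffs q (casc_lim q).

Lemma casc_tower_derive q x : is_derive (casc_tower q) x (casc_tower (Datatypes.S q) x).
Proof.
  unfold casc_tower. simpl bdiffs. apply bdiffs_derive. intro y.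
  apply (is_derive_ext (boxavg (b q) (casc_lim (Datatypes.S q)))). { intro; symmetry; apply casc_lim_boxavg. }
  apply boxavg_derive; auto. apply (lip_continuous L), casc_lim_lip.
Qed.

Lemma casc_tower_bound q x C : (forall y, x - S <= y <= x -> Rabs (f y) <= C) ->
  Rabs (casc_tower q x) <= 2 ^ q * prodb q * C.
Proof.
  intro H. apply bdiffs_bound. intros y Hy. apply Rabs_le. apply casc_lim_between.
  intros z Hz. apply Rabs_le_between, H. lra.
Qed.

Lemma casc_tower_between x lo hi : (forall y, x - S <= y <= x -> lo <= f y <= hi) ->
  lo <= casc_tower 0 x <= hi.
Proof. intro H. apply casc_lim_between. intros y Hy. apply H. simpl in Hy. lra. Qed.

(** For properties stable under each average whose passage to the limit takes an argument of its
    own, here vanishing moments. *)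
Lemma casc_tower_approx (Z : (R -> R) -> Prop) : Z f -> (forall k g, Z g -> Z (boxavg (b k) g)) ->
  forall e, 0 < e -> exists g, Z g /\ (forall x, Rabs (casc_tower 0 x - g x) <= e) /\
    forall x C, (forall y, x - S <= y <= x -> Rabs (f y) <= C) -> Rabs (g x) <= C.
Proof.
  intros Z0 ZT e He.
  assert (HZ : forall n q, Z (casc q n)). { induction n; intro q; simpl; auto. }
  assert (HT := tailb_lim). apply is_lim_seq_spec in HT.
  assert (He' : 0 < e / (L + 1)) by pos.
  destruct (HT (mkposreal _ He')) as [N HN]. specialize (HN N (Nat.le_refl N)). simpl in HN.
  exists (casc 0 N). split; [apply HZ|]. split.
  - intro x. apply Rle_trans with (1 := casc_lim_near 0 x N). simpl plus.
    rewrite Rminus_0_r, Rabs_right in HN by (apply Rle_ge, tailb_0).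
    assert (X0 := tailb_0 N).
    apply Rmult_lt_compat_l with (r := L + 1) in HN; [|lra].
    replace ((L + 1) * (e / (L + 1))) with e in HN by (field; lra). rewrite Nat.add_0_l. lra.
  - intros x C H. apply Rabs_le. apply casc_between. intros y Hy. apply Rabs_le_between, H.
    generalize (HS (0 + N)). simpl in *. lra.
Qed.
End Cascade.

(** * Functions with vanishing moments *)

(** Domination of every [x^k f] is included, as it gives [rint] its meaning. *)
Definition zero_moments (f : R -> R) : Prop :=
  (forall x, x <= 0 -> f x = 0) /\
  forall k, (exists C, dom C (fun x => x ^ k * f x)) /\ rint (fun x => x ^ k * f x) = 0.

Lemma one_plus_sq_shift (x s : R) : 1 + x ^ 2 <= 2 * (1 + s ^ 2) * (1 + (x - s) ^ 2).
Proof.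
  assert (0 <= (x - 2 * s) ^ 2) by apply pow2_ge_0.
  assert (0 <= (s * (x - s)) ^ 2) by apply pow2_ge_0. nra.
Qed.

Lemma dom_shift K f s : dom K f -> dom (2 * (1 + s ^ 2) * K) (fun x => f (x - s)).
Proof.
  intro H. assert (HK := dom_pos _ _ H). destruct H as [Hc Hb]. split.
  - intro x. apply (continuous_comp (fun x => x - s) f); auto.
    apply (continuous_derive _ _ 1). auto_derive; auto.
  - intro x. apply Rle_trans with (1 := Hb (x - s)).
    assert (H1 := one_plus_sq_pos x). assert (H2 := one_plus_sq_pos (x - s)).
    apply Rmult_le_reg_r with ((1 + x ^ 2) * (1 + (x - s) ^ 2)); [now apply Rmult_lt_0_compat|].
    replace (K / (1 + (x - s) ^ 2) * ((1 + x ^ 2) * (1 + (x - s) ^ 2))) with (K * (1 + x ^ 2)) by (field; lra).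
    replace (2 * (1 + s ^ 2) * K / (1 + x ^ 2) * ((1 + x ^ 2) * (1 + (x - s) ^ 2))) with
      (K * (2 * (1 + s ^ 2) * (1 + (x - s) ^ 2))) by (field; lra).
    apply Rmult_le_compat_l; auto. apply one_plus_sq_shift.
Qed.

Lemma is_lim_seq_inv_INR_shift (A c : R) : is_lim_seq (fun n => A / (INR n - c)) 0.
Proof.
  replace (Finite 0) with (Rbar_mult A (Rbar_inv p_infty)) by (simpl; f_equal; ring).
  apply is_lim_seq_scal_l. apply is_lim_seq_inv; [|easy].
  apply (is_lim_seq_minus _ _ p_infty c); [apply is_lim_seq_INR|apply is_lim_seq_const|easy].
Qed.

Lemma rint_shift K f s : dom K f -> rint (fun x => f (x - s)) = rint f.
Proof.
  intro H. apply (rint_unique _ _ _ (dom_shift K f s H)).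
  apply is_lim_seq_ext with (fun n => RInt f (- INR n - s) (INR n - s)).
  - intro n.
    replace (- INR n - s) with (1 * - INR n + - s) by ring. replace (INR n - s) with (1 * INR n + - s) by ring.
    rewrite <- (RInt_comp_lin f 1 (- s) (- INR n) (INR n)) by (apply ex_RInt_cont, H).
    apply RInt_ext. intros x _. unfold scal; simpl; unfold mult; simpl. rewrite !Rmult_1_l. easy.
  - apply is_lim_seq_ext with (fun n => rint f - (rint f - RInt f (- INR n - s) (INR n - s))); [intro; ring|].
    replace (Finite (rint f)) with (Finite (rint f - 0)) by (f_equal; ring).
    apply is_lim_seq_minus'; [apply is_lim_seq_const|].
    apply is_lim_seq_abs_0.
    apply is_lim_seq_le_le_loc with (fun _ => 0) (fun n => 2 * K / (INR n - Rabs s)).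
    + destruct (nfloor_ex (Rabs s) (Rabs_pos s)) as [N [_ HN]]. exists (S N). intros n Hn.
      apply le_INR in Hn. rewrite S_INR in Hn. split; [apply Rabs_pos|].
      apply (rint_tail K f (INR n - Rabs s) H); [lra| |]; generalize (Rle_abs s) (Rle_abs (- s));
        rewrite Rabs_Ropp; lra.
    + apply is_lim_seq_const.
    + apply is_lim_seq_inv_INR_shift.
Qed.

Lemma RInt_zero_left (f : R -> R) (x : R) : (forall y, y <= 0 -> f y = 0) -> x <= 0 -> RInt f 0 x = 0.
Proof.
  intros H Hx. rewrite (RInt_ext f (fun _ => 0)).
  - rewrite RInt_const. unfold scal; simpl; unfold mult; simpl. ring.
  - intros y Hy. apply H. rewrite Rmax_left in Hy by auto. lra.
Qed.

Section Primitive.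
Variable f : R -> R.
Hypothesis Hf : zero_moments f.

Let F (x : R) := RInt f 0 x.

Lemma zero_moments_cont x : continuous f x.
Proof.
  destruct Hf as [_ H]. destruct (H 0%nat) as [[C [HC _]] _].
  apply continuous_ext with (fun x => x ^ 0 * f x); [intro; simpl; ring|apply HC].
Qed.

Lemma prim_cont x : continuous F x.
Proof. apply (continuous_derive _ _ (f x)), RInt_0_derive, zero_moments_cont. Qed.

(** The vanishing moment of order 0 makes [F] tend to 0 at infinity, so [F x] is minus a tail
    integral of [f] and inherits its decay. *)
Lemma prim_decay k : exists C, 0 <= C /\ forall x, Rabs (x ^ k * F x) <= C.
Proof.
  destruct Hf as [Hneg H]. destruct (H k) as [[C HC] _]. assert (HC0 := dom_pos _ _ HC).
  assert (HPI := PI_RGT_0).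
  exists (C * PI). split; [apply Rmult_le_pos; lra|]. intro x.
  destruct (Rle_dec x 0) as [Hx|Hx].
  - unfold F. rewrite RInt_zero_left, Rmult_0_r, Rabs_R0 by auto. pos.
  - assert (Hx0 : 0 < x) by lra. assert (Hxk : 0 < x ^ k) by now apply pow_lt.
    destruct (H 0%nat) as [[C0 HC0'] Z0].
    assert (HF : is_lim_seq (fun n => F (INR n)) 0).
    { rewrite <- Z0. apply is_lim_seq_ext with (2 := rint_lim _ _ HC0'). intro n.
      rewrite (RInt_ext _ f) by (intros; simpl; ring). unfold F.
      rewrite <- (RInt_Chasles f (- INR n) 0 (INR n)) by (apply ex_RInt_cont, zero_moments_cont).
      rewrite <- (opp_RInt_swap f 0 (- INR n)) by (apply ex_RInt_cont, zero_moments_cont).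
      rewrite (RInt_zero_left f (- INR n)); auto; [|generalize (pos_INR n); lra].
      unfold plus, opp; simpl. ring. }
    apply (is_lim_seq_le_loc (fun n => Rabs (x ^ k * (F x - F (INR n)))) (fun _ => C * PI) (Rabs (x ^ k * F
      x)) (C * PI)).
    + destruct (nfloor_ex x (Rlt_le _ _ Hx0)) as [N [_ HN]]. exists (S N). intros n Hn.
      apply le_INR in Hn. rewrite S_INR in Hn.
      assert (E : F x - F (INR n) = - RInt f x (INR n)).
      { unfold F. rewrite <- (RInt_Chasles f 0 x (INR n)) by (apply ex_RInt_cont, zero_moments_cont).
        unfold plus; simpl. ring. }
      rewrite E, Ropp_mult_distr_r_reverse, Rabs_Ropp, Rabs_mult, (Rabs_right (x ^ k)) by lra.
      apply Rle_trans with (x ^ k * (C / x ^ k * (atan (INR n) - atan x))).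
      * apply Rmult_le_compat_l; [lra|].
        apply (norm_RInt_le f (fun y => C / x ^ k / (1 + y ^ 2)) x (INR n)); [lra| | |apply is_RInt_cauchy].
        -- intros y Hy. assert (Hy1 := one_plus_sq_pos y).
           assert (Hxy : x ^ k <= y ^ k) by (apply pow_incr; lra).
           destruct HC as [_ HC]. specialize (HC y).
           rewrite Rabs_mult, Rabs_right in HC by pos.
           change (Rabs (f y) <= C / x ^ k / (1 + y ^ 2)).
           replace (C / x ^ k / (1 + y ^ 2)) with (C / (1 + y ^ 2) / x ^ k) by (field; lra).
           apply Rmult_le_reg_r with (x ^ k); auto. unfold Rdiv at 1.
           rewrite (Rmult_assoc _ (/ x ^ k)), Rinv_l, Rmult_1_r by lra.
           apply Rle_trans with (2 := HC). rewrite Rmult_comm. mono.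
        -- apply (@RInt_correct R_CompleteNormedModule), ex_RInt_cont, zero_moments_cont.
      * replace (x ^ k * (C / x ^ k * (atan (INR n) - atan x))) with (C * (atan (INR n) - atan x)) by (field;
          lra).
        apply Rmult_le_compat_l; auto. generalize (atan_bound (INR n)) (atan_bound x). lra.
    + apply (is_lim_seq_abs _ (Finite (x ^ k * F x))). apply (is_lim_seq_scal_l _ (x ^ k) (F x)).
      replace (Finite (F x)) with (Finite (F x - 0)) by (f_equal; ring).
      apply is_lim_seq_minus'; [apply is_lim_seq_const|exact HF].
    + apply is_lim_seq_const.
Qed.

Lemma pow_continuous (k : nat) (x : R) : continuous (fun x : R => x ^ k) x.
Proof. apply (continuous_derive _ _ (INR k * x ^ pred k)). apply is_derive_Reals, derivable_pt_lim_pow. Qed.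

Lemma prim_dom k : exists C, dom C (fun x => x ^ k * F x).
Proof.
  destruct (prim_decay k) as [C1 [HC1 H1]]. destruct (prim_decay (2 + k)) as [C2 [HC2 H2]].
  exists (C1 + C2). split.
  - intro x. apply continuous_mulR; [apply pow_continuous|apply prim_cont].
  - intro x. assert (Hx := one_plus_sq_pos x). apply Rmult_le_reg_r with (1 + x ^ 2); auto.
    unfold Rdiv. rewrite (Rmult_assoc (C1 + C2)), Rinv_l, Rmult_1_r by lra.
    specialize (H1 x). specialize (H2 x). rewrite pow_add, Rmult_assoc, Rabs_mult in H2.
    rewrite (Rabs_right (x ^ 2)) in H2 by pos. lra.
Qed.

(** By parts with [x^(k+1) F]: [k + 1] times this moment is minus the moment of order [k + 1] of
    [f]. *)
Lemma prim_zero k : rint (fun x => x ^ k * F x) = 0.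
Proof.
  destruct (prim_dom k) as [C HC]. destruct Hf as [_ H]. destruct (H (S k)) as [[C' HC'] Z].
  destruct (prim_decay (2 + k)) as [C2 [HC2 H2]].
  assert (D := dom_plus _ _ _ _ (dom_scal _ (INR (S k)) _ HC) HC').
  assert (E : rint (fun x => INR (S k) * (x ^ k * F x) + x ^ S k * f x) = 0).
  { apply (rint_derive _ C2 (fun x => x ^ S k * F x) _ D).
    - intro x. evar_last.
      + apply Derive.is_derive_mult;
          [apply is_derive_Reals, derivable_pt_lim_pow|apply RInt_0_derive, zero_moments_cont].
      + simpl pred. pos.
    - intro x. rewrite <- Rabs_mult. apply Rle_trans with (2 := H2 x). right. f_equal. simpl. ring. }
  rewrite (rint_plus _ _ _ _ (dom_scal _ (INR (S k)) _ HC) HC'), Z, (rint_scal _ _ _ HC) in E.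
  assert (INR (S k) <> 0) by (apply not_0_INR; lia).
  nra.
Qed.

(** Moments about a shifted centre. Splitting off one factor [x + s] at a time replaces the binomial
    formula. *)
Lemma prim_shift_zero (s : R) q : forall k,
  (exists C, dom C (fun x => (x + s) ^ q * (x ^ k * F x))) /\ rint (fun x => (x + s) ^ q * (x ^ k * F x)) = 0.
Proof.
  induction q as [|q IH]; intro k.
  - destruct (prim_dom k) as [C HC]. split.
    + exists C. apply dom_ext with (2 := HC). intro; simpl; ring.
    + rewrite <- (prim_zero k). apply rint_ext. intro; simpl; ring.
  - destruct (IH (S k)) as [[C1 H1] Z1]. destruct (IH k) as [[C2 H2] Z2].
    assert (H3 := dom_scal _ s _ H2). split.
    + eexists. eapply dom_ext; [|apply (dom_plus _ _ _ _ H1 H3)]. intro; simpl; ring.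
    + transitivity (rint (fun x => (x + s) ^ q * (x ^ S k * F x) + s * ((x + s) ^ q * (x ^ k * F x)))).
      * apply rint_ext; intro; simpl; ring.
      * rewrite (rint_plus _ _ _ _ H1 H3), Z1, (rint_scal _ _ _ H2), Z2. ring.
Qed.

Lemma zero_moments_boxavg b : 0 < b -> zero_moments (boxavg b f).
Proof.
  intro Hb. assert (Hi := Rinv_0_lt_compat _ Hb).
  assert (E : forall x, boxavg b f x = b * (F x - F (x - / b))).
  { intro x. apply boxavg_prim; auto. apply zero_moments_cont. }
  split.
  - intros x Hx. rewrite E. unfold F. rewrite 2!RInt_zero_left; try apply Hf; try lra.
  - intro k. destruct (prim_dom k) as [C1 H1]. destruct (prim_shift_zero (/ b) k 0) as [[C2 H2] Z2].
    assert (H3 := dom_shift _ _ (/ b) H2).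
    assert (H4 : dom (2 * (1 + (/ b) ^ 2) * C2) (fun x => x ^ k * F (x - / b))).
    { apply dom_ext with (2 := H3). intro x. simpl pow at 2. replace (x - / b + / b) with x by ring. ring. }
    assert (Z4 : rint (fun x => x ^ k * F (x - / b)) = 0).
    { rewrite <- Z2, <- (rint_shift _ _ (/ b) H2). apply rint_ext. intro x. simpl pow at 3.
      replace (x - / b + / b) with x by ring. ring. }
    assert (H5 := dom_minus _ _ _ _ H1 H4).
    split.
    + eexists. eapply dom_ext; [|apply (dom_scal _ b _ H5)]. intro x. cbv beta. rewrite E. ring.
    + transitivity (rint (fun x => b * (x ^ k * F x - x ^ k * F (x - / b)))).
      * apply rint_ext. intro x. rewrite E. ring.
      * rewrite (rint_scal _ _ _ H5), (rint_minus _ _ _ _ H1 H4), prim_zero, Z4. ring.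
Qed.
End Primitive.

Lemma pow_add_le (y s : R) k : 0 <= y -> 0 <= s -> (y + s) ^ k <= 2 ^ k * (y ^ k + s ^ k).
Proof.
  intros Hy Hs. assert (H1 : (y + s) ^ k <= (2 * Rmax y s) ^ k).
  { apply pow_incr. generalize (Rmax_l y s) (Rmax_r y s). lra. }
  apply Rle_trans with (1 := H1). rewrite Rpow_mult_distr. apply Rmult_le_compat_l; [apply pow_le; lra|].
  assert (0 <= y ^ k) by now apply pow_le. assert (0 <= s ^ k) by now apply pow_le.
  unfold Rmax; destruct Rle_dec; lra.
Qed.

(** All that is retained of [g] arising from [f] by averages to the left of total width at most
    [S]. *)
Definition sup_near (S : R) (f g : R -> R) : Prop :=
  forall x C, (forall y, x - S <= y <= x -> Rabs (f y) <= C) -> Rabs (g x) <= C.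

Lemma sup_near_zero S f g x : 0 <= S -> sup_near S f g -> (forall y, y <= 0 -> f y = 0) -> x <= 0 -> g x = 0.
Proof.
  intros HS H Hf Hx. apply Rabs_eq_0, Rle_antisym; [|apply Rabs_pos]. apply H. intros y Hy.
  rewrite Hf by lra. rewrite Rabs_R0; lra.
Qed.

(** [C] does not depend on [g]: this is the common majorant for the passage to the limit. It comes
    from [x^k <= 2^k (y^k + S^k)] and [1 + x^2 <= 2 (1 + S^2) (1 + y^2)] for [x <= y + S]. *)
Lemma sup_near_decay S f k : 0 <= S -> (forall x, x <= 0 -> f x = 0) ->
  (forall j, exists C, dom C (fun x => x ^ j * f x)) ->
  exists C, 0 <= C /\ forall g, sup_near S f g -> forall x, Rabs (x ^ k * g x) <= C / (1 + x ^ 2).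
Proof.
  intros HS Hneg H. destruct (H k) as [Ck HCk]. destruct (H 0%nat) as [C0 HC0].
  assert (P1 := dom_pos _ _ HCk). assert (P0 := dom_pos _ _ HC0).
  destruct HCk as [_ HCk], HC0 as [_ HC0].
  assert (HSk : 0 <= S ^ k) by now apply pow_le.
  assert (H2k : 0 < 2 ^ k) by (apply pow_lt; lra).
  assert (HC : 0 <= 2 ^ k * (2 * (1 + S ^ 2)) * (Ck + S ^ k * C0)).
  { pos. }
  exists (2 ^ k * (2 * (1 + S ^ 2)) * (Ck + S ^ k * C0)). split; auto.
  intros g Hg x. assert (Hx1 := one_plus_sq_pos x).
  destruct (Rle_dec x 0) as [Hx|Hx].
  { rewrite (sup_near_zero S f g x), Rmult_0_r, Rabs_R0 by auto. now apply Rdiv_le_0_compat. }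
  assert (Hxk : 0 < x ^ k) by (apply pow_lt; lra).
  rewrite Rabs_mult, (Rabs_right (x ^ k)) by lra.
  apply Rmult_le_reg_l with (/ x ^ k); [now apply Rinv_0_lt_compat|].
  rewrite <- Rmult_assoc, Rinv_l, Rmult_1_l by lra. apply Hg. intros y Hy.
  apply Rmult_le_reg_l with (x ^ k); auto. rewrite <- (Rmult_assoc (x ^ k)), Rinv_r, Rmult_1_l by lra.
  apply Rmult_le_reg_r with (1 + x ^ 2); auto. unfold Rdiv.
  rewrite (Rmult_assoc _ (/ (1 + x ^ 2))), Rinv_l, Rmult_1_r by lra.
  destruct (Rle_dec y 0) as [Hy0|Hy0].
  { rewrite Hneg, Rabs_R0 by auto. rewrite Rmult_0_r, Rmult_0_l. exact HC. }
  assert (Hy1 := one_plus_sq_pos y).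
  specialize (HCk y). specialize (HC0 y). simpl pow at 1 in HC0. rewrite Rmult_1_l in HC0.
  assert (Hyk : 0 < y ^ k) by (apply pow_lt; lra).
  rewrite Rabs_mult, Rabs_right in HCk by lra.
  assert (HCk' : y ^ k * Rabs (f y) * (1 + y ^ 2) <= Ck).
  { apply Rmult_le_compat_r with (r := 1 + y ^ 2) in HCk; [|lra]. unfold Rdiv in HCk.
    rewrite (Rmult_assoc Ck), Rinv_l in HCk by lra. lra. }
  assert (HC0' : Rabs (f y) * (1 + y ^ 2) <= C0).
  { apply Rmult_le_compat_r with (r := 1 + y ^ 2) in HC0; [|lra]. unfold Rdiv in HC0.
    rewrite (Rmult_assoc C0), Rinv_l in HC0 by lra. lra. }
  assert (Hxy : x ^ k <= 2 ^ k * (y ^ k + S ^ k)).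
  { apply Rle_trans with ((y + S) ^ k); [apply pow_incr; lra|apply pow_add_le; lra]. }
  assert (Hx2 : 1 + x ^ 2 <= 2 * (1 + S ^ 2) * (1 + y ^ 2)).
  { assert (x ^ 2 <= (y + S) ^ 2) by (apply pow_incr; lra).
    assert (0 <= (y - S) ^ 2) by apply pow2_ge_0. assert (0 <= (y * S) ^ 2) by apply pow2_ge_0. nra. }
  assert (Hfy := Rabs_pos (f y)).
  apply Rle_trans with (2 ^ k * (y ^ k + S ^ k) * Rabs (f y) * (2 * (1 + S ^ 2) * (1 + y ^ 2))).
  - mono.
  - replace (2 ^ k * (y ^ k + S ^ k) * Rabs (f y) * (2 * (1 + S ^ 2) * (1 + y ^ 2))) with
     (2 ^ k * (2 * (1 + S ^ 2)) * (y ^ k * Rabs (f y) * (1 + y ^ 2) + S ^ k * (Rabs (f y) * (1 + y ^ 2)))) by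
       ring.
    apply Rmult_le_compat_l.
    + pos.
    + mono.
Qed.

(** Dominated convergence by hand: uniform closeness on [[-X, X]], and outside it the common decay
    with one more power of [x]. *)
Lemma zero_moments_limit (S : R) (f phi : R -> R) : 0 <= S -> zero_moments f ->
  (forall x, continuous phi x) -> sup_near S f phi ->
  (forall e, 0 < e -> exists g, zero_moments g /\ (forall x, Rabs (phi x - g x) <= e) /\ sup_near S f g) ->
  zero_moments phi.
Proof.
  intros HS [Hneg Hf] Hc Hn Ha.
  assert (Hd : forall j, exists C, dom C (fun x => x ^ j * f x)) by (intro j; apply Hf).
  split. { intros x Hx. now apply (sup_near_zero S f phi). }
  intro k. destruct (sup_near_decay S f k HS Hneg Hd) as [C [HC HCk]].
  destruct (sup_near_decay S f (Datatypes.S k) HS Hneg Hd) as [C' [HC' HCk']].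
  assert (D : dom C (fun x => x ^ k * phi x)).
  { split; [|intro; now apply HCk]. intro x.
    apply continuous_mulR; [apply pow_continuous|apply Hc]. }
  split; [now exists C|].
  apply Rabs_eq_0, Rle_antisym; [|apply Rabs_pos]. apply le_epsilon. intros eps Heps. rewrite Rplus_0_l.
  assert (HPI := PI_RGT_0). assert (HPI4 := PI_4).
  (* Beyond [X] the two tails satisfy [2 C' <= eps / 4 * |x|]; [g] is chosen afterwards, with an
     accuracy depending on [X]. *)
  set (X := 1 + 16 * C' / eps).
  assert (HX : 1 <= X). { unfold X. assert (0 <= 16 * C' / eps) by pos. lra. }
  assert (HX2 : 0 < X ^ k * (1 + X ^ 2)). { pos. }
  destruct (Ha (eps / 8 / (X ^ k * (1 + X ^ 2)))) as [g [Hg [He Hng]]]. { pos. }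
  destruct Hg as [_ Hg]. destruct (Hg k) as [[Cg HCg] Zg].
  replace (rint (fun x => x ^ k * phi x)) with (rint (fun x => x ^ k * phi x - x ^ k * g x)).
  2:{ rewrite (rint_minus _ _ _ _ D HCg), Zg. ring. }
  apply Rle_trans with (eps / 8 * 2 * PI); [|nra]. apply rint_bound. split.
  { apply (proj1 (dom_minus _ _ _ _ D HCg)). }
  intro x. assert (Hx1 := one_plus_sq_pos x).
  destruct (Rle_dec (Rabs x) X) as [Hx|Hx].
  - replace (x ^ k * phi x - x ^ k * g x) with (x ^ k * (phi x - g x)) by ring. rewrite Rabs_mult, <- RPow_abs.
    apply Rle_trans with (X ^ k * (eps / 8 / (X ^ k * (1 + X ^ 2)))).
    + mono.
    + replace (X ^ k * (eps / 8 / (X ^ k * (1 + X ^ 2)))) with (eps / 8 * / (1 + X ^ 2)).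
      2:{ field. split; [generalize (one_plus_sq_pos X); lra|]. assert (0 < X ^ k) by (apply pow_lt; lra). lra.
      }
      assert (/ (1 + X ^ 2) <= / (1 + x ^ 2)).
      { apply Rinv_le_contravar; auto. rewrite <- (pow2_abs x).
        assert (Rabs x ^ 2 <= X ^ 2) by mono. lra. }
      assert (0 < / (1 + x ^ 2)) by now apply Rinv_0_lt_compat. unfold Rdiv in *. nra.
  - apply Rmult_le_reg_r with (Rabs x); [lra|]. rewrite <- Rabs_mult.
    replace ((x ^ k * phi x - x ^ k * g x) * x) with (x ^ Datatypes.S k * phi x - x ^ Datatypes.S k * g x) by
      (simpl; ring).
    apply Rle_trans with (C' / (1 + x ^ 2) + C' / (1 + x ^ 2)).
    + unfold Rminus. apply Rle_trans with (1 := Rabs_triang _ _). rewrite Rabs_Ropp.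
      apply Rplus_le_compat; auto.
    + replace (C' / (1 + x ^ 2) + C' / (1 + x ^ 2)) with (2 * C' * / (1 + x ^ 2)) by (unfold Rdiv; ring).
      replace (eps / 8 * 2 / (1 + x ^ 2) * Rabs x) with (eps / 4 * Rabs x * / (1 + x ^ 2)) by (field; lra).
      apply Rmult_le_compat_r; [left; now apply Rinv_0_lt_compat|].
      assert (E : eps * X = eps + 16 * C') by (unfold X; field; lra).
      assert (eps * X <= eps * Rabs x) by mono. lra.
Qed.

Lemma zero_moments_moment_is (phi : R -> R) p : zero_moments phi ->
  moment_is (fun x => RtoC (phi x)) p 0.
Proof.
  intros [Hneg H]. destruct (H p) as [[C HC] Z]. assert (HC0 := dom_pos _ _ HC).
  set (G := fun x => x ^ p * phi x) in *.
  intros P [e HP]. assert (He := cond_pos e).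
  (* The missing pieces are at most [C a] near 0 and [2 C / b] at infinity; each is made at most
     [e / 4]. *)
  set (X := 1 + 8 * C / e).
  assert (HX : 1 <= X). { unfold X. assert (0 <= 8 * C / e) by pos. lra. }
  assert (Hd : 0 < e / (4 * (C + 1))) by pos.
  apply Filter_prod with (Q := fun a => 0 < a < e / (4 * (C + 1))) (R := fun b => X < b).
  - exists (mkposreal _ Hd). intros a Ha Ha0. split; auto.
    unfold ball in Ha; simpl in Ha. unfold AbsRing_ball, abs, minus, plus, opp in Ha; simpl in Ha.
    rewrite Ropp_0, Rplus_0_r, Rabs_right in Ha; lra.
  - exists X. auto.
  - intros a b [Ha1 Ha2] Hb. exists (RtoC (RInt G a b)). split.
    + simpl fst; simpl snd.
      apply (is_RInt_ext (V := C_R_NormedModule) (fun x => (G x, 0) : C_R_NormedModule)).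
      { intros x _.
        apply injective_projections; unfold scal; simpl; unfold scal; simpl; unfold mult; simpl; unfold G;
          ring. }
      apply (is_RInt_fct_extend_pair (U := R_NormedModule) (V := R_NormedModule)).
      * simpl. apply (@RInt_correct R_CompleteNormedModule), ex_RInt_cont, HC.
      * simpl. evar_last; [apply @is_RInt_const|]. unfold scal; simpl; unfold mult; simpl. ring.
    + apply HP.
      assert (T := rint_tail C G b HC ltac:(lra) (- b) b ltac:(lra) ltac:(lra)). rewrite Z in T.
      assert (Ec := fun u v => ex_RInt_cont G u v (proj1 HC)).
      assert (E : RInt G (- b) b = RInt G (- b) 0 + RInt G 0 a + RInt G a b) by (apply RInt_sum3, HC).
      assert (E0 : RInt G (- b) 0 = 0).
      { rewrite <- (opp_RInt_swap G 0 (- b)) by auto. rewrite RInt_zero_left; [unfold opp; simpl; ring| |lra].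
        intros y Hy. unfold G. rewrite Hneg by auto. ring. }
      assert (E1 : Rabs (RInt G 0 a) <= C * a).
      { apply Rle_trans with (1 := dom_RInt_le C G 0 a HC ltac:(lra)). rewrite atan_0, Rminus_0_r.
        apply Rmult_le_compat_l; auto. apply atan_le_id. lra. }
      rewrite E0, Rplus_0_l in E.
      assert (E2 : Rabs (RInt G a b) < e).
      { assert (Ca : C * a <= e / 4).
        { apply Rle_trans with ((C + 1) * (e / (4 * (C + 1)))); [apply Rmult_le_compat; lra|right; field; lra].
          }
        assert (Cb : 2 * C / b <= e / 4).
        { apply Rmult_le_reg_r with b; [lra|]. unfold Rdiv at 1. rewrite Rmult_assoc, Rinv_l by lra.
          assert (EX : e * X = e + 8 * C) by (unfold X; field; lra).
          nra. }
        rewrite Rminus_0_l, Rabs_Ropp in T.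
        replace (RInt G a b) with (RInt G (- b) b - RInt G 0 a) by lra.
        unfold Rminus. apply Rle_lt_trans with (1 := Rabs_triang _ _). rewrite Rabs_Ropp. lra. }
      split; unfold ball; simpl; unfold AbsRing_ball, abs, minus, plus, opp; simpl.
      * now rewrite Ropp_0, Rplus_0_r.
      * rewrite Ropp_0, Rplus_0_r, Rabs_R0. exact He.
Qed.

(** * A function with vanishing moments built from a bump *)

Lemma is_derive_sin_scal t s : is_derive (fun s => sin (t * s)) s (t * cos (t * s)).
Proof. auto_derive; auto. ring. Qed.

Lemma is_derive_cos_scal t s : is_derive (fun s => cos (t * s)) s (- t * sin (t * s)).
Proof. auto_derive; auto. ring. Qed.

Lemma Rabs_sin x : Rabs (sin x) <= 1.
Proof. apply Rabs_le, SIN_bound. Qed.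

Lemma Rabs_cos x : Rabs (cos x) <= 1.
Proof. apply Rabs_le, COS_bound. Qed.

Section Osc.
Variable Lc : R.
Hypothesis HLc : 1 < Lc.

(** The distance from 0 is what makes the later division by [s] harmless. *)
Definition supported (w : R -> R) : Prop := forall x, x <= 1 \/ Lc <= x -> w x = 0.

Lemma supp_dom w C : (forall x, continuous w x) -> supported w -> (forall x, Rabs (w x) <= C) ->
  dom (C * (1 + Lc ^ 2)) w.
Proof.
  intros Hc Hs Hb. split; auto. intro y.
  assert (HC : 0 <= C) by (apply Rle_trans with (2 := Hb 0), Rabs_pos).
  assert (Hy := one_plus_sq_pos y). assert (HL := one_plus_sq_pos Lc).
  apply Rmult_le_reg_r with (1 + y ^ 2); auto. unfold Rdiv.
  rewrite (Rmult_assoc (C * _)), Rinv_l, Rmult_1_r by lra.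
  destruct (Rle_dec y 1) as [H1|H1].
  { rewrite Hs by auto. rewrite Rabs_R0, Rmult_0_l. pos. }
  destruct (Rle_dec Lc y) as [H2|H2].
  { rewrite Hs by auto. rewrite Rabs_R0, Rmult_0_l. pos. }
  mono.
Qed.

Lemma supp_mult_dom w g C : (forall x, continuous w x) -> supported w -> (forall x, Rabs (w x) <= C) ->
  (forall x, continuous g x) -> forall D, 0 <= D -> (forall x, 1 < x < Lc -> Rabs (g x) <= D) ->
  dom (C * D * (1 + Lc ^ 2)) (fun x => w x * g x).
Proof.
  intros Hc Hs Hb Hg D HD Hgd. apply supp_dom.
  - intro x. apply continuous_mulR; auto.
  - intros x Hx. rewrite Hs by auto. ring.
  - assert (HC : 0 <= C) by (apply Rle_trans with (2 := Hb 0), Rabs_pos).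
    intro x. destruct (Rle_dec x 1) as [H1|H1].
    { rewrite Hs, Rmult_0_l, Rabs_R0 by auto. pos. }
    destruct (Rle_dec Lc x) as [H2|H2].
    { rewrite Hs, Rmult_0_l, Rabs_R0 by auto. pos. }
    rewrite Rabs_mult. apply Rmult_le_compat; auto using Rabs_pos. apply Hgd. lra.
Qed.

Lemma sin_scal_cont t s : continuous (fun s => sin (t * s)) s.
Proof. eapply continuous_derive, is_derive_sin_scal. Qed.

Lemma cos_scal_cont t s : continuous (fun s => cos (t * s)) s.
Proof. eapply continuous_derive, is_derive_cos_scal. Qed.

Lemma supp_sin_dom w C t : (forall x, continuous w x) -> supported w -> (forall x, Rabs (w x) <= C) ->
  dom (C * (1 + Lc ^ 2)) (fun s => w s * sin (t * s)).
Proof.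
  intros Hc Hs Hb. replace (C * (1 + Lc ^ 2)) with (C * 1 * (1 + Lc ^ 2)) by ring.
  apply supp_mult_dom; auto; try lra. { intro; apply sin_scal_cont. } intros; apply Rabs_sin.
Qed.

Lemma supp_cos_dom w C t : (forall x, continuous w x) -> supported w -> (forall x, Rabs (w x) <= C) ->
  dom (C * (1 + Lc ^ 2)) (fun s => w s * cos (t * s)).
Proof.
  intros Hc Hs Hb. replace (C * (1 + Lc ^ 2)) with (C * 1 * (1 + Lc ^ 2)) by ring.
  apply supp_mult_dom; auto; try lra. { intro; apply cos_scal_cont. } intros; apply Rabs_cos.
Qed.

Lemma sine_transform_derive w C t : (forall x, continuous w x) -> supported w -> (forall x, Rabs (w x) <= C) ->
  is_derive (fun t => rint (fun s => w s * sin (t * s))) t (rint (fun s => w s * (s * cos (t * s)))).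
Proof.
  intros Hc Hs Hb.
  assert (HC : 0 <= C) by (apply Rle_trans with (2 := Hb 0), Rabs_pos).
  assert (Hid : forall x, 1 < x < Lc -> Rabs x <= Lc) by (intros; rewrite Rabs_right; lra).
  apply (rint_diff (fun t s => w s * sin (t * s)) (fun t s => w s * (s * cos (t * s)))
    (fun t s => w s * (s * (s * - sin (t * s)))) t 1 (C * (1 + Lc ^ 2)) (C * Lc * (1 + Lc ^ 2)) (C * (Lc * Lc)
      * (1 + Lc ^ 2))).
  - lra.
  - intros r _. now apply supp_sin_dom.
  - apply supp_mult_dom; auto; try lra.
    + intro x. apply continuous_mulR; [apply continuous_id|apply cos_scal_cont].
    + intros x Hx. rewrite Rabs_mult. rewrite <- (Rmult_1_r Lc).
      apply Rmult_le_compat; auto using Rabs_pos, Rabs_cos.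
  - intros r s _. apply is_derive_scal. auto_derive; auto; ring.
  - intros r s _. apply is_derive_scal, is_derive_scal. auto_derive; auto; ring.
  - intros r s _.
    assert (D : dom (C * (Lc * Lc) * (1 + Lc ^ 2)) (fun s => w s * (s * (s * - sin (r * s))))).
    { apply supp_mult_dom; auto; try nra.
      - intro x. repeat (apply continuous_mulR; [apply continuous_id|]).
        apply @continuous_opp, sin_scal_cont.
      - intros x Hx. rewrite 2!Rabs_mult, Rabs_Ropp. apply Rmult_le_compat; auto using Rabs_pos.
        + pos.
        + rewrite <- (Rmult_1_r Lc). apply Rmult_le_compat; auto using Rabs_pos, Rabs_sin. }
    apply D.
Qed.

Variables (rho : nat -> R -> R) (W : nat -> R).
Hypothesis Hder : forall q x, is_derive (rho q) x (rho (S q) x).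
Hypothesis Hsupp : forall q, supported (rho q).
Hypothesis Hbd : forall q x, Rabs (rho q x) <= W q.

Lemma W_pos q : 0 <= W q.
Proof. apply Rle_trans with (2 := Hbd q 0), Rabs_pos. Qed.

Lemma rho_cont q x : continuous (rho q) x.
Proof. eapply continuous_derive, Hder. Qed.

Definition sine_tr (q : nat) (t : R) : R := rint (fun s => rho q s * sin (t * s)).
Definition cosine_tr (q : nat) (t : R) : R := rint (fun s => rho q s * cos (t * s)).

Lemma supp_mult_id w C x : supported w -> (forall x, Rabs (w x) <= C) -> Rabs (w x) * Rabs x <= C * Lc.
Proof.
  intros Hs Hb. assert (HC : 0 <= C) by (apply Rle_trans with (2 := Hb 0), Rabs_pos).
  destruct (Rle_dec x 1) as [H1|H1].
  { rewrite Hs, Rabs_R0, Rmult_0_l by auto. pos. }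
  destruct (Rle_dec Lc x) as [H2|H2].
  { rewrite Hs, Rabs_R0, Rmult_0_l by auto. pos. }
  apply Rmult_le_compat; auto using Rabs_pos. rewrite Rabs_right; lra.
Qed.

Lemma sin_by_parts w dw C C' t : (forall x, is_derive w x (dw x)) -> (forall x, continuous dw x) ->
  supported w -> supported dw -> (forall x, Rabs (w x) <= C) -> (forall x, Rabs (dw x) <= C') ->
  t * rint (fun s => w s * sin (t * s)) = rint (fun s => dw s * cos (t * s)).
Proof.
  intros Hd Hc Hs Hs' Hb Hb'.
  assert (Hcw : forall x, continuous w x) by (intro; eapply continuous_derive; eauto).
  assert (D1 := supp_sin_dom w C t Hcw Hs Hb). assert (D2 := supp_cos_dom dw C' t Hc Hs' Hb').
  apply Rminus_diag_uniq. rewrite <- (rint_scal _ t _ D1), <- (rint_minus _ _ _ _ (dom_scal _ t _ D1) D2).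
  apply (rint_derive _ (C * Lc) (fun s => - (w s * cos (t * s))) _ (dom_minus _ _ _ _ (dom_scal _ t _ D1) D2)).
  - intro s. evar_last.
    + apply @is_derive_opp, Derive.is_derive_mult; [apply Hd|apply is_derive_cos_scal].
    + unfold opp; simpl. ring.
  - intro s. rewrite Rabs_Ropp, Rabs_mult. apply Rle_trans with (2 := supp_mult_id w C s Hs Hb).
    apply Rmult_le_compat_r; [apply Rabs_pos|]. rewrite <- (Rmult_1_r (Rabs (w s))) at 2.
    apply Rmult_le_compat_l; [apply Rabs_pos|apply Rabs_cos].
Qed.

Lemma sine_tr_by_parts q t : t * sine_tr q t = cosine_tr (S q) t.
Proof. apply (sin_by_parts _ _ (W q) (W (S q))); auto. intro; apply rho_cont. Qed.

Lemma cosine_tr_by_parts q t : t * cosine_tr q t = - sine_tr (S q) t.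
Proof.
  assert (D1 := supp_cos_dom (rho q) (W q) t (rho_cont q) (Hsupp q) (Hbd q)).
  assert (D2 := supp_sin_dom (rho (S q)) (W (S q)) t (rho_cont (S q)) (Hsupp (S q)) (Hbd (S q))).
  cut (t * cosine_tr q t + sine_tr (S q) t = 0); [lra|]. unfold cosine_tr, sine_tr.
  rewrite <- (rint_scal _ t _ D1), <- (rint_plus _ _ _ _ (dom_scal _ t _ D1) D2).
  apply (rint_derive _ (W q * Lc) (fun s => rho q s * sin (t * s)) _ (dom_plus _ _ _ _ (dom_scal _ t _ D1) D2)).
  - intro s. evar_last.
    + apply Derive.is_derive_mult; [apply Hder|apply is_derive_sin_scal].
    + simpl. ring.
  - intro s. rewrite Rabs_mult. apply Rle_trans with (2 := supp_mult_id _ _ s (Hsupp q) (Hbd q)).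
    apply Rmult_le_compat_r; [apply Rabs_pos|]. rewrite <- (Rmult_1_r (Rabs (rho q s))) at 2.
    apply Rmult_le_compat_l; [apply Rabs_pos|apply Rabs_sin].
Qed.

(** With [t = sqrt x], each power of [x] costs two derivatives of [rho]. *)
Lemma sine_tr_pow p : forall q t, t ^ (2 * p) * sine_tr q t = (-1) ^ p * sine_tr (2 * p + q) t.
Proof.
  induction p as [|p IH]; intros q t.
  - simpl. ring.
  - replace (2 * S p)%nat with (2 + 2 * p)%nat by lia. rewrite pow_add.
    replace (t ^ 2 * t ^ (2 * p) * sine_tr q t) with (t ^ (2 * p) * (t * (t * sine_tr q t))) by ring.
    rewrite sine_tr_by_parts, cosine_tr_by_parts, Ropp_mult_distr_r_reverse, IH.
    replace (2 * p + S (S q))%nat with (2 + 2 * p + q)%nat by lia. simpl. ring.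
Qed.

Lemma sine_tr_bound q t : Rabs (sine_tr q t) <= W q * (1 + Lc ^ 2) * PI.
Proof. apply rint_bound, supp_sin_dom; auto. intro; apply rho_cont. Qed.

Lemma sine_tr_cont q t : continuous (sine_tr q) t.
Proof. eapply continuous_derive, (sine_transform_derive _ (W q)); auto. intro; apply rho_cont. Qed.

(* [rho q] vanishes on [(-oo, 1]], so the junk value at [0] is [0]. *)
Definition tau (q : nat) (s : R) : R := rho q s / s.
Definition dtau (q : nat) (s : R) : R := rho (S q) s / s - rho q s / s ^ 2.

Lemma tau_supp q : supported (tau q).
Proof. intros x Hx. unfold tau. rewrite Hsupp by auto. pos. Qed.

Lemma dtau_supp q : supported (dtau q).
Proof. intros x Hx. unfold dtau. rewrite 2!Hsupp by auto. pos. Qed.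

Lemma loc_zero_derive (g : R -> R) x : (forall y, y < 1 -> g y = 0) -> x < 1 -> is_derive g x 0.
Proof.
  intros H Hx. apply (is_derive_ext_loc (fun _ => 0)).
  - assert (He : 0 < 1 - x) by lra. exists (mkposreal _ He). intros y Hy. symmetry. apply H.
    unfold ball in Hy; simpl in Hy. unfold AbsRing_ball, abs, minus, plus, opp in Hy; simpl in Hy.
    unfold Rabs in Hy; destruct Rcase_abs in Hy; lra.
  - apply @is_derive_const.
Qed.

Lemma tau_derive q x : is_derive (tau q) x (dtau q x).
Proof.
  (* Below 1 the quotient is locally 0, so differentiation never meets the division by 0. *)
  destruct (Rlt_dec x 1) as [Hx|Hx].
  - rewrite (dtau_supp q x) by lra. apply loc_zero_derive; auto. intros y Hy. apply tau_supp. lra.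
  - assert (x <> 0) by lra. unfold tau, dtau, Rdiv. evar_last.
    + apply Derive.is_derive_mult; [apply Hder|apply is_derive_inv; [apply @is_derive_id|auto]].
    + unfold one; simpl. field. auto.
Qed.

Lemma dtau_cont q x : continuous (dtau q) x.
Proof.
  destruct (Rlt_dec x 1) as [Hx|Hx].
  - apply (continuous_derive _ _ 0), loc_zero_derive; auto. intros y Hy. apply dtau_supp. lra.
  - assert (x <> 0) by lra. unfold dtau, Rdiv.
    apply @continuous_minus; apply continuous_mulR.
    + apply rho_cont.
    + apply (continuous_Rinv_fun (fun x => x)); [apply continuous_id|auto].
    + apply rho_cont.
    + apply (continuous_Rinv_fun (fun x => x ^ 2)); [apply pow_continuous|now apply pow_nonzero].
Qed.

Lemma div_le_supp (a x n : R) : 1 < x -> 1 <= n -> Rabs (a / n) <= Rabs a.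
Proof.
  intros Hx Hn. unfold Rdiv. rewrite Rabs_mult, Rabs_inv, (Rabs_right n) by lra.
  rewrite <- (Rmult_1_r (Rabs a)) at 2. apply Rmult_le_compat_l; [apply Rabs_pos|].
  rewrite <- Rinv_1. mono.
Qed.

Lemma tau_bound q x : Rabs (tau q x) <= W q.
Proof.
  destruct (Rle_dec x 1) as [Hx|Hx].
  - rewrite tau_supp, Rabs_R0 by auto. apply W_pos.
  - apply Rle_trans with (2 := Hbd q x). unfold tau. apply (div_le_supp _ x); lra.
Qed.

Lemma dtau_bound q x : Rabs (dtau q x) <= W (S q) + W q.
Proof.
  destruct (Rle_dec x 1) as [Hx|Hx].
  - rewrite dtau_supp, Rabs_R0 by auto. generalize (W_pos q) (W_pos (S q)). lra.
  - unfold dtau, Rminus. apply Rle_trans with (1 := Rabs_triang _ _). rewrite Rabs_Ropp.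
    apply Rplus_le_compat.
    + apply Rle_trans with (2 := Hbd (S q) x). apply (div_le_supp _ x); lra.
    + apply Rle_trans with (2 := Hbd q x). apply (div_le_supp _ x); [lra|]. simpl. nra.
Qed.

Lemma tau_cont q x : continuous (tau q) x.
Proof. eapply continuous_derive, tau_derive. Qed.

(** A primitive of [cosine_tr q] that vanishes at 0 and, by one integration by parts, decays like
    [1 / t]. It takes the place of Fourier inversion at 0. *)
Definition sinc_tr (q : nat) (t : R) : R := rint (fun s => tau q s * sin (t * s)).

Lemma sinc_tr_derive q t : is_derive (sinc_tr q) t (cosine_tr q t).
Proof.
  unfold sinc_tr, cosine_tr.
  rewrite (rint_ext (fun s => rho q s * cos (t * s)) (fun s => tau q s * (s * cos (t * s)))).
  - apply (sine_transform_derive _ (W q)); auto using tau_supp, tau_bound. intro; apply tau_cont.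
  - intro s. destruct (Req_dec s 0) as [->|Hs].
    + rewrite tau_supp by lra. rewrite Hsupp by lra. ring.
    + unfold tau. field. auto.
Qed.

Lemma sinc_tr_decay q t : Rabs (t * sinc_tr q t) <= (W (S q) + W q) * (1 + Lc ^ 2) * PI.
Proof.
  unfold sinc_tr. rewrite (sin_by_parts (tau q) (dtau q) (W q) (W (S q) + W q));
   auto using tau_supp, tau_bound, tau_derive, dtau_cont, dtau_supp, dtau_bound.
  apply rint_bound, supp_cos_dom; auto using dtau_supp, dtau_bound. intro; apply dtau_cont.
Qed.

(** The default [sqrt x = 0] for [x < 0] makes this function vanish there. *)
Definition sine_sqrt (x : R) : R := sine_tr 0 (sqrt x).

Lemma sine_tr_at_0 q : sine_tr q 0 = 0.
Proof.
  unfold sine_tr. rewrite (rint_ext _ (fun s => 0 * (rho q s * sin (0 * s)))).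
  - rewrite (rint_scal _ 0 _ (supp_sin_dom (rho q) (W q) 0 (rho_cont q) (Hsupp q) (Hbd q))). ring.
  - intro s. rewrite Rmult_0_l, sin_0. ring.
Qed.

Lemma sine_sqrt_neg x : x <= 0 -> sine_sqrt x = 0.
Proof. intro Hx. unfold sine_sqrt. rewrite sqrt_neg_0 by auto. apply sine_tr_at_0. Qed.

Lemma sine_sqrt_cont x : continuous sine_sqrt x.
Proof. apply (continuous_comp sqrt (sine_tr 0)); [apply continuous_sqrt|apply sine_tr_cont]. Qed.

Lemma sine_sqrt_pow p x : 0 <= x -> x ^ p * sine_sqrt x = (-1) ^ p * sine_tr (2 * p) (sqrt x).
Proof.
  intro Hx. unfold sine_sqrt. generalize (sine_tr_pow p 0 (sqrt x)).
  rewrite Nat.add_0_r, pow_mult, pow2_sqrt by auto. easy.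
Qed.

Lemma Rabs_m1_pow p : Rabs ((-1) ^ p) = 1.
Proof. rewrite <- RPow_abs, Rabs_left by lra. replace (- -1) with 1 by ring. apply pow1. Qed.

Lemma sine_sqrt_bound p x : Rabs (x ^ p * sine_sqrt x) <= W (2 * p) * (1 + Lc ^ 2) * PI.
Proof.
  destruct (Rle_dec 0 x) as [Hx|Hx].
  - rewrite sine_sqrt_pow, Rabs_mult, Rabs_m1_pow, Rmult_1_l by auto. apply sine_tr_bound.
  - rewrite sine_sqrt_neg, Rmult_0_r, Rabs_R0 by lra. apply Rmult_le_pos; [|left; apply PI_RGT_0].
    apply Rmult_le_pos; [apply W_pos|left; apply one_plus_sq_pos].
Qed.

Lemma sine_sqrt_prim p x : 0 <= x ->
  RInt (fun x => x ^ p * sine_sqrt x) 0 x = 2 * (-1) ^ p * sinc_tr (2 * p + 1) (sqrt x).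
Proof.
  intro Hx. set (G := fun x => x ^ p * sine_sqrt x).
  assert (HG : forall y, continuous G y).
  { intro y. apply continuous_mulR; [apply pow_continuous|apply sine_sqrt_cont]. }
  set (Th := fun x => 2 * (-1) ^ p * sinc_tr (2 * p + 1) (sqrt x)).
  assert (HTc : forall y, continuous Th y).
  { intro y. apply (@continuous_scal_r R_UniformSpace R_AbsRing R_NormedModule (2 * (-1) ^ p) (fun x =>
      sinc_tr (2 * p + 1) (sqrt x))).
    apply (continuous_comp sqrt (sinc_tr (2 * p + 1)));
      [apply continuous_sqrt|eapply continuous_derive, sinc_tr_derive]. }
  assert (HK0 : Th 0 = 0).
  { unfold Th. rewrite sqrt_0. unfold sinc_tr.
    rewrite (rint_ext _ (fun s => 0 * (tau (2 * p + 1) s * sin (0 * s)))).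
    - rewrite (rint_scal (W (2 * p + 1) * (1 + Lc ^ 2))); [ring|].
      apply supp_sin_dom; auto using tau_supp, tau_bound. intro; apply tau_cont.
    - intro s. rewrite Rmult_0_l, sin_0. ring. }
  fold (Th x).
  (* [sqrt] is not differentiable at 0; the mean value theorem asks only for continuity at the
     endpoint. *)
  destruct (MVT_gen (fun x => RInt G 0 x - Th x) 0 x (fun _ => 0)) as [c [_ E]].
  - rewrite Rmin_left, Rmax_right by auto. intros y Hy.
    assert (Hs : 0 < sqrt y) by (apply sqrt_lt_R0; lra).
    evar_last.
    + apply @is_derive_minus; [now apply RInt_0_derive|]. apply is_derive_scal.
      apply (is_derive_comp (sinc_tr (2 * p + 1)) sqrt); [apply sinc_tr_derive|].
      apply is_derive_Reals, derivable_pt_lim_sqrt. lra.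
    + unfold minus, plus, opp, scal; simpl; unfold mult; simpl. unfold G. rewrite sine_sqrt_pow by lra.
      replace (p + (p + 0) + 1)%nat with (S (2 * p)) by lia. rewrite <- sine_tr_by_parts.
      replace (2 * p)%nat with (p + (p + 0))%nat by lia. field. lra.
  - rewrite Rmin_left, Rmax_right by auto. intros y Hy. apply continuity_pt_filterlim.
    apply (@continuous_minus R_UniformSpace R_AbsRing R_NormedModule (fun x => RInt G 0 x) Th); [|apply HTc].
    eapply continuous_derive, RInt_0_derive, HG.
  - rewrite RInt_point, HK0 in E. unfold zero in E; simpl in E. lra.
Qed.

(** The truncated moment is a multiple of [sinc_tr (2 k + 1)] at [sqrt n], which tends to 0. *)
Lemma sine_sqrt_zero_moments : zero_moments sine_sqrt.
Proof.
  split. { exact sine_sqrt_neg. }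
  intro k. assert (HPI := PI_RGT_0).
  set (A := fun j => W (2 * j) * (1 + Lc ^ 2) * PI).
  assert (D : dom (A k + A (2 + k)%nat) (fun x => x ^ k * sine_sqrt x)).
  { split.
    - intro x. apply continuous_mulR; [apply pow_continuous|apply sine_sqrt_cont].
    - intro x. assert (Hx := one_plus_sq_pos x). apply Rmult_le_reg_r with (1 + x ^ 2); auto.
      unfold Rdiv. rewrite (Rmult_assoc (A k + _)), Rinv_l, Rmult_1_r by lra.
      assert (H1 := sine_sqrt_bound k x). assert (H2 := sine_sqrt_bound (2 + k) x).
      rewrite pow_add, Rmult_assoc, Rabs_mult in H2.
      rewrite (Rabs_right (x ^ 2)) in H2 by pos.
      fold (A k) in H1. fold (A (2 + k)%nat) in H2. lra. }
  split; [eexists; exact D|]. apply (rint_unique _ _ _ D).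
  set (B := (W (S (2 * k + 1)) + W (2 * k + 1)) * (1 + Lc ^ 2) * PI).
  apply is_lim_seq_ext with (fun n => 2 * (-1) ^ k * sinc_tr (2 * k + 1) (sqrt (INR n))).
  { intro n. rewrite <- sine_sqrt_prim by apply pos_INR.
    assert (Ec := fun u v => ex_RInt_cont _ u v (proj1 D)).
    rewrite <- (RInt_Chasles _ (- INR n) 0 (INR n)) by auto.
    rewrite <- (opp_RInt_swap _ 0 (- INR n)) by auto.
    rewrite (RInt_zero_left (fun x => x ^ k * sine_sqrt x) (- INR n)).
    - set (r := RInt _ 0 (INR n)). change (@eq R r (- 0 + r)). pos.
    - intros y Hy. rewrite sine_sqrt_neg by auto. ring.
    - generalize (pos_INR n). lra. }
  apply is_lim_seq_abs_0.
  apply is_lim_seq_le_le_loc with (fun _ => 0) (fun n => 2 * B * / sqrt (INR n)).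
  - exists 1%nat. intros n Hn. split; [apply Rabs_pos|].
    assert (Hs : 0 < sqrt (INR n)) by (apply sqrt_lt_R0, lt_0_INR; lia).
    rewrite 2!Rabs_mult, Rabs_m1_pow, Rabs_right, Rmult_1_r by lra. rewrite Rmult_assoc.
    apply Rmult_le_compat_l; [lra|].
    apply Rmult_le_reg_l with (sqrt (INR n)); auto.
    replace (sqrt (INR n) * (B * / sqrt (INR n))) with B by (field; lra).
    rewrite <- (Rabs_right (sqrt (INR n))) at 1 by lra. rewrite <- Rabs_mult. apply sinc_tr_decay.
  - apply is_lim_seq_const.
  - replace (Finite 0) with (Rbar_mult (2 * B) (Rbar_inv p_infty)) by (simpl; f_equal; ring).
    apply is_lim_seq_scal_l. apply is_lim_seq_inv; [|easy].
    apply (filterlim_comp _ _ _ INR sqrt _ (Rbar_locally p_infty));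
      [apply is_lim_seq_INR|apply filterlim_sqrt_p].
Qed.

(* For [0 < t <= pi / Lc] the factor [sin (t s)] is positive on the support. *)
Lemma sine_sqrt_pos a b : (forall x, 0 <= rho 0 x) -> 1 < a -> a < b -> b < Lc ->
  (forall x, a <= x <= b -> 0 < rho 0 x) -> forall x, 0 < x -> sqrt x * Lc <= PI -> 0 < sine_sqrt x.
Proof.
  intros Hp Ha Hab Hbl Hpos x Hx Hxl. unfold sine_sqrt, sine_tr. set (t := sqrt x) in *.
  assert (Ht : 0 < t) by now apply sqrt_lt_R0.
  assert (D := supp_sin_dom (rho 0) (W 0) t (rho_cont 0) (Hsupp 0) (Hbd 0)).
  apply Rlt_le_trans with (RInt (fun s => rho 0 s * sin (t * s)) a b).
  - apply RInt_gt_0; auto.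
    + intros s Hs. apply Rmult_lt_0_compat; [apply Hpos; lra|]. apply sin_gt_0; nra.
    + intros s _. apply D.
  - apply (rint_ge_RInt _ _ a b D); [|lra]. intro s.
    destruct (Rle_dec s 1) as [H1|H1]. { rewrite Hsupp by auto. lra. }
    destruct (Rle_dec Lc s) as [H2|H2]. { rewrite Hsupp by auto. lra. }
    apply Rmult_le_pos; auto. apply sin_ge_0; nra.
Qed.
End Osc.

(** * The counterexample when the sum converges *)

Lemma is_derive_RtoC (f : R -> R) x l : is_derive f x l ->
  @is_derive R_AbsRing C_R_NormedModule (fun x => RtoC (f x)) x (RtoC l).
Proof.
  intro H. unfold is_derive.
  apply (filterdiff_ext_lin (U := R_NormedModule) (V := C_R_NormedModule) (fun x => RtoC (f x)) (fun y => RtoC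
    (scal y l))).
  - apply (filterdiff_comp' (U := R_NormedModule) (V := R_NormedModule) (W := C_R_NormedModule) f (fun x =>
      RtoC x) x (fun y => scal y l) (fun y => RtoC y) H).
    apply (filterdiff_linear (U := R_NormedModule) (V := C_R_NormedModule)). split.
    + intros a b. apply C_eq; unfold plus; simpl; unfold plus; simpl; ring.
    + intros k a. apply C_eq; unfold scal; simpl; unfold scal; simpl; unfold mult; simpl; ring.
    + exists 1. split; [lra|]. intro a. rewrite Rmult_1_l. unfold norm at 1; simpl. unfold prod_norm. simpl.
      unfold norm; simpl. unfold abs; simpl. rewrite Rabs_R0.
      replace (Rabs a * (Rabs a * 1) + 0 * (0 * 1)) with (Rsqr (Rabs a)) by (unfold Rsqr; ring).
      rewrite sqrt_Rsqr by apply Rabs_pos. lra.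
  - intro y. apply C_eq; unfold scal; simpl; unfold scal; simpl; unfold mult; simpl; ring.
Qed.

Lemma zero_moments_0 : zero_moments (fun _ => 0).
Proof.
  assert (D : forall k : nat, dom 0 (fun x => x ^ k * 0)).
  { intro k. apply dom_ext with (fun _ => 0); [intro; ring|]. split; [intro; apply continuous_const|].
    intro y. rewrite Rabs_R0. pos. }
  split; auto. intro k. split; [now exists 0|].
  apply Rabs_eq_0, Rle_antisym; [|apply Rabs_pos]. apply Rle_trans with (1 := rint_bound _ _ (D k)). lra.
Qed.

(** Serves to absorb powers of constants, such as a shift of the argument, into [h^p M_p]. *)
Lemma weight_seq_ge_pow M p : weight_seq M -> quot M 0 ^ p <= M p.
Proof.
  intro HM. assert (Hp := proj1 HM). induction p as [|p IH].
  - destruct Hp as [-> _]. simpl. lra.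
  - assert (Hq : quot M 0 <= quot M p).
    { clear IH. induction p; [lra|]. apply Rle_trans with (1 := IHp). now apply quot_incr. }
    assert (H0 := quot_pos M 0 Hp).
    replace (M (S p)) with (quot M p * M p) by (unfold quot; field; destruct Hp as [_ Hp]; specialize (Hp p);
      lra).
    simpl. mono.
Qed.

(** Its plateau [[2, S + 4]] is longer than the total box width [S], so the cascade equals 1 on
    [[S + 2, S + 4]]. The unit slopes give the Lipschitz constant 1. *)
Definition trapezoid (S y : R) : R := Rmax 0 (Rmin 1 (Rmin (y - 1) (S + 5 - y))).

Lemma trapezoid_lip S : lip 1 (trapezoid S).
Proof.
  intros x y. unfold trapezoid, Rmax, Rmin. rewrite Rmult_1_l.
  repeat destruct Rle_dec; unfold Rabs; repeat destruct Rcase_abs; lra.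
Qed.

Lemma trapezoid_zero S y : y <= 1 \/ S + 5 <= y -> trapezoid S y = 0.
Proof. intro H. unfold trapezoid, Rmax, Rmin. repeat destruct Rle_dec; lra. Qed.

Lemma trapezoid_one S y : 2 <= y <= S + 4 -> trapezoid S y = 1.
Proof. intro H. unfold trapezoid, Rmax, Rmin. repeat destruct Rle_dec; lra. Qed.

Lemma trapezoid_bounds S y : 0 <= trapezoid S y <= 1.
Proof. unfold trapezoid, Rmax, Rmin. repeat destruct Rle_dec; lra. Qed.

(** Positivity on a whole interval [(0, x1]], not just nonvanishing, is recorded because it survives
    the later averages. *)
Lemma sine_sqrt_witness M : weight_seq M ->
  (exists B, forall n, sum_n (fun p => / sqrt (quot M p)) n <= B) ->
  exists f C x1, zero_moments f /\ (forall x, continuous f x) /\ 0 <= C /\ 0 < x1 /\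
    (forall p x, Rabs (x ^ p * f x) <= C * 4 ^ p * M p) /\ forall x, 0 < x <= x1 -> 0 < f x.
Proof.
  intros HM [B HB]. assert (Hp := proj1 HM).
  assert (Hq : forall p, 0 < quot M p) by (intro; now apply quot_pos).
  (* Every [sqrt m_p] occurs twice, so the first [2 p] factors multiply to [M p]. *)
  set (b := fun k => sqrt (quot M (Nat.div2 k))).
  assert (Hb : forall k, 0 < b k) by (intro; apply sqrt_lt_R0, Hq).
  assert (Hb0 : forall p, b (2 * p)%nat = sqrt (quot M p)). { intro p. unfold b. now rewrite Nat.div2_double. }
  assert (Hb1 : forall p, b (S (2 * p))%nat = sqrt (quot M p)). { intro p. unfold b.
  now rewrite Nat.div2_succ_double. }
  assert (Hprod : forall p, prodb b (2 * p) = M p).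
  { induction p as [|p IH].
    - simpl. destruct Hp as [-> _]. easy.
    - replace (2 * S p)%nat with (S (S (2 * p))) by lia.
      change (prodb b (2 * p) * b (2 * p)%nat * b (S (2 * p)) = M (S p)).
      rewrite IH, Hb0, Hb1, Rmult_assoc, sqrt_sqrt by (left; apply Hq).
      unfold quot. field. destruct Hp as [_ Hp]. pos. }
  assert (HB0 : 0 <= B).
  { apply Rle_trans with (2 := HB 0%nat). rewrite sum_O. pos. }
  assert (Hsum : forall n, invsum b (2 * S n) = 2 * sum_n (fun p => / sqrt (quot M p)) n).
  { induction n as [|n IH].
    - rewrite sum_O. simpl. rewrite (Hb0 0%nat : b 0%nat = _), (Hb1 0%nat : b 1%nat = _). ring.
    - replace (2 * S (S n))%nat with (S (S (2 * S n))) by lia.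
      change (invsum b (2 * S n) + / b (2 * S n)%nat + / b (S (2 * S n)) = 2 * sum_n (fun p => / sqrt (quot M
        p)) (S n)).
      rewrite IH, Hb0, Hb1, sum_Sn. unfold plus; simpl. ring. }
  set (S0 := 2 * B).
  assert (HS : forall n, invsum b n <= S0).
  { intro n. apply Rle_trans with (invsum b (2 * S n)).
    - apply invsum_mono; auto. lia.
    - rewrite Hsum. specialize (HB n). unfold S0. lra. }
  (* The trapezoid ends at [S0 + 5], and the averages extend it to the right by at most [S0]. *)
  set (f0 := trapezoid S0). set (Lc := 2 * S0 + 5).
  assert (HS0 : 0 <= S0) by (unfold S0; lra).
  assert (HLc : 1 < Lc) by (unfold Lc; lra).
  assert (Hlip := trapezoid_lip S0). fold f0 in Hlip.
  set (rho := casc_tower b f0). set (W := fun q => 2 ^ q * prodb b q * 1).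
  assert (Hder : forall q x, is_derive (rho q) x (rho (S q) x)).
  { intros q x. apply (casc_tower_derive b f0 S0 1); auto. lra. }
  assert (Hbd : forall q x, Rabs (rho q x) <= W q).
  { intros q x. apply (casc_tower_bound b f0 S0 1); auto; [lra|]. intros y _.
    generalize (trapezoid_bounds S0 y). fold f0. intro. rewrite Rabs_right; lra. }
  assert (Hsupp : forall q, supported Lc (rho q)).
  { intros q x Hx. apply Rabs_eq_0, Rle_antisym; [|apply Rabs_pos].
    replace 0 with (2 ^ q * prodb b q * 0) by ring.
    apply (casc_tower_bound b f0 S0 1); auto; [lra|]. intros y Hy. unfold f0. rewrite trapezoid_zero.
    - rewrite Rabs_R0. lra.
    - unfold Lc in Hx. lra. }
  assert (HPI := PI_RGT_0).
  exists (sine_sqrt rho), ((1 + Lc ^ 2) * PI), (Rmin 1 ((PI / Lc) ^ 2)).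
  split; [now apply (sine_sqrt_zero_moments Lc HLc rho W)|].
  split; [intro; now apply (sine_sqrt_cont Lc HLc rho W)|].
  split; [apply Rmult_le_pos; [left; apply one_plus_sq_pos|lra]|].
  assert (HPL : 0 < PI / Lc) by pos.
  split; [apply Rmin_pos; [lra|now apply pow_lt]|].
  split.
  - intros p x. apply Rle_trans with (1 := sine_sqrt_bound Lc HLc rho W Hder Hsupp Hbd p x).
    unfold W. rewrite Hprod, pow_mult. replace (2 ^ 2) with 4 by ring. right. ring.
  - intros x [Hx1 Hx2].
    apply (sine_sqrt_pos Lc rho W Hder Hsupp Hbd (S0 + 2) (S0 + 3)); try (unfold Lc; lra); auto.
    + intro y. apply (casc_tower_between b f0 S0 1 Hb HS) with (hi := 1); auto; [lra|]. intros z _.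
      apply trapezoid_bounds.
    + intros y Hy. apply Rlt_le_trans with 1; [lra|].
      apply (casc_tower_between b f0 S0 1 Hb HS) with (hi := 1); auto; [lra|]. intros z Hz. unfold f0.
      rewrite trapezoid_one; lra.
    + assert (Hs : sqrt x <= PI / Lc).
      { rewrite <- (sqrt_pow2 (PI / Lc)) by lra. apply sqrt_le_1_alt. apply Rle_trans with (1 := Hx2), Rmin_r. }
      apply Rmult_le_compat_r with (r := Lc) in Hs; [|lra].
      replace (PI / Lc * Lc) with PI in Hs by (field; lra). exact Hs.
Qed.

Lemma lip_of_derive (f df : R -> R) (D : R) : (forall x, is_derive f x (df x)) ->
  (forall x, Rabs (df x) <= D) -> lip D f.
Proof.
  intros Hd HD x y. destruct (MVT_gen f y x df) as [c [_ E]].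
  - auto.
  - intros z _. apply continuity_pt_filterlim, (continuous_derive _ _ (df z)), Hd.
  - rewrite E, Rabs_mult. mono.
Qed.

Lemma moment_injective_not_summable M A : weight_seq M -> pos_seq A -> cond_nq A ->
  moment_injective (S_BM (hat A) M) ->
  ~ exists B, forall n, sum_n (fun p => / sqrt (quot M p)) n <= B.
Proof.
  intros HM HA Hnq Hinj HB. assert (HMp : forall p, 0 < M p) by apply HM.
  destruct (sine_sqrt_witness M HM HB) as [g [C [x1 [Hg [Hgc [HC [Hx1 [Hgb Hgpos]]]]]]]].
  assert (Hgneg : forall x, x <= 0 -> g x = 0) by apply Hg.
  assert (HAp : forall p, 0 < A p) by apply HA.
  set (x0 := Rmin 1 x1). assert (Hx0 : 0 < x0) by (apply Rmin_pos; lra).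
  assert (Hx01 : x0 <= 1) by apply Rmin_l. assert (Hx0x : x0 <= x1) by apply Rmin_r.
  (* One box of width 1 turns the bounded continuous [g] into a Lipschitz function, as the cascade
     requires of its seed. *)
  set (f := boxavg 1 g).
  assert (Hfz : zero_moments f) by (apply zero_moments_boxavg; auto; lra).
  assert (Hfb : sup_near 1 g f).
  { intros x D HD. apply Rabs_le. apply boxavg_between; auto; [lra|]. rewrite Rinv_1. intros y Hy.
    apply Rabs_le_between, HD, Hy. }
  assert (Hg0 : forall x, Rabs (g x) <= C).
  { intro x. generalize (Hgb 0%nat x). simpl. rewrite (proj1 (proj1 HM)), Rmult_1_l, !Rmult_1_r. auto. }
  assert (Hflip : lip (2 * C) f).
  { apply (lip_of_derive f (fun x => 1 * (g x - g (x - / 1)))).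
    - intro x. apply boxavg_derive; auto. lra.
    - intro x. rewrite Rmult_1_l. unfold Rminus at 1. apply Rle_trans with (1 := Rabs_triang _ _).
      rewrite Rabs_Ropp. generalize (Hg0 x) (Hg0 (x - / 1)). lra. }
  (* For [y] in [[x0 / 2, x0]] the window [[y - 1, y]] contains [[0, x0 / 2]], and [g] is
     nonnegative on it, so [f y >= c]. *)
  set (c := RInt g 0 (x0 / 2)).
  assert (Hc : 0 < c).
  { apply RInt_gt_0; [lra| |intros; apply Hgc]. intros x Hx. apply Hgpos. lra. }
  assert (Hfc : forall y, x0 / 2 <= y <= x0 -> c <= f y).
  { intros y Hy. unfold f. rewrite boxavg_prim by (auto; lra). rewrite Rinv_1, Rmult_1_l.
    rewrite (RInt_zero_left g (y - 1)) by (auto; lra). rewrite Rminus_0_r.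
    rewrite <- (RInt_Chasles g 0 (x0 / 2) y) by (now apply ex_RInt_cont). fold c.
    assert (0 <= RInt g (x0 / 2) y).
    { apply RInt_ge_0; [lra|now apply ex_RInt_cont|]. intros x Hx. left. apply Hgpos. lra. }
    unfold plus; simpl. lra. }
  set (a := fun k => / (INR (S k) * quot A k)).
  assert (Hqa : forall k, quot (hat A) k = INR (S k) * quot A k).
  { intro k. unfold quot, hat. rewrite fact_simpl, mult_INR. field.
    split; [specialize (HAp k); lra|apply INR_fact_neq_0]. }
  assert (Hqp : forall k, 0 < quot (hat A) k).
  { intro k. rewrite Hqa. apply Rmult_lt_0_compat; [apply lt_0_INR; lia|]. apply Rdiv_lt_0_compat; auto. }
  assert (Ha : forall k, 0 < a k) by (intro k; unfold a; rewrite <- Hqa; now apply Rinv_0_lt_compat).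
  destruct Hnq as [SA HSA]. fold a in HSA.
  assert (HSA' : forall n, sum_n a n <= SA).
  { intro n. apply (is_lim_seq_incr_compare (sum_n a) SA); auto. intro k. rewrite sum_Sn. unfold plus; simpl.
    specialize (Ha (S k)). lra. }
  assert (HSA0 : 0 <= SA). { apply Rle_trans with (2 := HSA' 0%nat). rewrite sum_O. pos. }
  (* Makes the total width of the boxes at most [x0 / 2], so at [x0] the cascade sees [f] only where
     it is at least [c]. *)
  set (lam := 2 * (SA + 1) / x0).
  assert (Hlam : 0 < lam) by (apply Rdiv_lt_0_compat; lra).
  set (b := fun k => lam * quot (hat A) k).
  assert (Hb : forall k, 0 < b k) by (intro; now apply Rmult_lt_0_compat).
  assert (Hinv : forall n, invsum b (S n) = / lam * sum_n a n).
  { assert (Hbk : forall k, / b k = / lam * a k). { intro k. unfold b, a. rewrite <- Hqa. apply Rinv_mult. }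
    induction n as [|n IH].
    - rewrite sum_O. simpl. rewrite Hbk. ring.
    - change (invsum b (S n) + / b (S n) = / lam * sum_n a (S n)). rewrite IH, Hbk, sum_Sn. unfold plus; simpl.
      ring. }
  set (S1 := x0 / 2).
  assert (HS : forall n, invsum b n <= S1).
  { intro n. apply Rle_trans with (invsum b (S n)); [apply invsum_S_le; auto|]. rewrite Hinv.
    apply Rle_trans with (/ lam * (SA + 1)).
    - apply Rmult_le_compat_l; [left; now apply Rinv_0_lt_compat|]. specialize (HSA' n). lra.
    - right. unfold lam, S1. field. lra. }
  assert (HprodA : forall q, prodb b q = lam ^ q * hat A q).
  { induction q as [|q IH].
    - simpl. unfold hat. simpl. rewrite (proj1 HA). ring.
    - change (prodb b q * b q = lam ^ S q * hat A (S q)). rewrite IH. unfold b, quot.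
      assert (hat A q <> 0). { unfold hat.
      apply Rmult_integral_contrapositive_currified; [apply INR_fact_neq_0|specialize (HAp q); lra]. }
      simpl pow. field. auto. }
  assert (HhA : forall q, 0 < hat A q). { intro q. apply Rmult_lt_0_compat; auto. apply INR_fact_lt_0. }
  assert (H2C : 0 <= 2 * C) by lra.
  assert (HS1 : 0 <= S1) by (unfold S1; lra).
  set (Phi := casc_tower b f).
  assert (Hphi0 : sup_near S1 f (Phi 0%nat)).
  { intros x D HD. generalize (casc_tower_bound b f S1 (2 * C) Hb HS H2C Hflip 0 x D HD). simpl.
    rewrite !Rmult_1_l. auto. }
  assert (Hphiz : zero_moments (Phi 0%nat)).
  { apply (zero_moments_limit S1 f); auto.
    - intro x. eapply continuous_derive, (casc_tower_derive b f S1 (2 * C)); auto.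
    - intros e He.
      destruct (casc_tower_approx b f S1 (2 * C) Hb HS H2C Hflip zero_moments Hfz) with (e := e) as [h [H1 [H2
        H3]]]; auto.
      + intros k h Hh. apply zero_moments_boxavg; auto.
      + exists h. auto. }
  (* [sg] is the full reach to the left, that of the cascade plus the first box of width 1. *)
  set (sg := S1 + 1). set (m0 := quot M 0).
  assert (Hm0 : 0 < m0) by (apply quot_pos, HM).
  (* The 4 comes from the bound on [g], and [sg / m0] turns [sg^p] into a multiple of [M p]. The
     factors 2 come from [pow_add_le] and from the difference operators. *)
  set (h1 := Rmax 4 (sg / m0)). set (h := Rmax (2 * lam) (2 * h1)).
  assert (Hh1 : 4 <= h1) by apply Rmax_l.
  assert (HSBM : S_BM (hat A) M (fun x => RtoC (Phi 0%nat x))).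
  { split. { intros x Hx. f_equal. apply Hphiz. lra. }
    exists (fun q x => RtoC (Phi q x)). split.
    { split; auto. intros q x. apply is_derive_RtoC. apply (casc_tower_derive b f S1 (2 * C)); auto. }
    exists h, (2 * C). split. { apply Rlt_le_trans with (2 * lam); [lra|apply Rmax_l]. }
    intros p q x. rewrite Cmod_R.
    assert (Hh : 0 <= h) by (apply Rle_trans with (2 * lam); [lra|apply Rmax_l]).
    assert (HR : 0 <= 2 * C * h ^ (p + q) * M p * hat A q).
    { pos. }
    destruct (Rle_dec x 0) as [Hx|Hx].
    - assert (Z : Rabs (Phi q x) <= 2 ^ q * prodb b q * 0).
      { apply (casc_tower_bound b f S1 (2 * C)); auto. intros y Hy. rewrite (proj1 Hfz) by lra.
        rewrite Rabs_R0; lra. }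
      rewrite Rmult_0_r in Z. replace (Rabs (Phi q x)) with 0 by (generalize (Rabs_pos (Phi q x)); lra).
      rewrite Rmult_0_r. exact HR.
    - assert (Hxp : 0 < x ^ p) by (apply pow_lt; lra).
      rewrite (Rabs_right (x ^ p)) by lra.
      (* Bounds [x^p |g y|] for [y] in [[x - sg, x]]: the orders [p] and 0 of the estimate on [g],
         combined through [pow_add_le]. *)
      set (D := 2 ^ p * (C * 4 ^ p * M p + sg ^ p * C)).
      assert (Hsg : 0 <= sg ^ p) by (apply pow_le; unfold sg; lra).
      assert (H2p : 0 < 2 ^ p) by (apply pow_lt; lra). assert (H4p : 0 < 4 ^ p) by (apply pow_lt; lra).
      assert (HMp0 := HMp p).
      assert (HD0 : 0 <= D).
      { unfold D. apply Rmult_le_pos; [lra|]. apply Rplus_le_le_0_compat; repeat apply Rmult_le_pos; lra. }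
      assert (HD : forall y, x - sg <= y <= x -> Rabs (g y) <= D / x ^ p).
      { intros y Hy. destruct (Rle_dec y 0) as [Hy0|Hy0].
        - rewrite Hgneg, Rabs_R0 by auto. now apply Rdiv_le_0_compat.
        - apply Rmult_le_reg_r with (x ^ p); auto. unfold Rdiv. rewrite Rmult_assoc, Rinv_l, Rmult_1_r by lra.
          assert (Hyp : 0 < y ^ p) by (apply pow_lt; lra).
          assert (Hxy : x ^ p <= 2 ^ p * (y ^ p + sg ^ p)).
          { apply Rle_trans with ((y + sg) ^ p); [apply pow_incr; lra|apply pow_add_le; [lra|unfold sg; lra]]. }
          assert (Hgy := Hgb p y). rewrite Rabs_mult, Rabs_right in Hgy by lra.
          apply Rle_trans with (Rabs (g y) * (2 ^ p * (y ^ p + sg ^ p))).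
          + mono.
          + replace (Rabs (g y) * (2 ^ p * (y ^ p + sg ^ p))) with (2 ^ p * (y ^ p * Rabs (g y) + sg ^ p *
              Rabs (g y))) by ring.
            unfold D. apply Rmult_le_compat_l; [lra|]. apply Rplus_le_compat; auto.
            now apply Rmult_le_compat_l. }
      assert (HP : Rabs (Phi q x) <= 2 ^ q * prodb b q * (D / x ^ p)).
      { apply (casc_tower_bound b f S1 (2 * C)); auto. intros y Hy. apply Hfb. intros z Hz. apply HD.
        unfold sg. lra. }
      apply Rle_trans with (x ^ p * (2 ^ q * prodb b q * (D / x ^ p))); [apply Rmult_le_compat_l; lra|].
      rewrite HprodA.
      replace (x ^ p * (2 ^ q * (lam ^ q * hat A q) * (D / x ^ p))) with ((2 * lam) ^ q * D * hat A q) by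
        (rewrite Rpow_mult_distr; field; lra).
      apply Rmult_le_compat_r; [left; auto|]. rewrite pow_add.
      assert (HDb : D <= 2 * C * (2 * h1) ^ p * M p).
      { unfold D. rewrite Rpow_mult_distr.
        assert (E1 : 4 ^ p <= h1 ^ p) by (apply pow_incr; lra).
        assert (E2 : sg ^ p <= h1 ^ p * M p).
        { apply Rle_trans with ((sg / m0) ^ p * m0 ^ p).
          - rewrite <- Rpow_mult_distr. right. f_equal. field. lra.
          - assert (0 <= sg / m0) by (apply Rdiv_le_0_compat; unfold sg; lra).
            apply Rmult_le_compat; [now apply pow_le|apply pow_le; lra| |now apply weight_seq_ge_pow].
            apply pow_incr. split; auto. apply Rmax_r. }
        replace (2 * C * (2 ^ p * h1 ^ p) * M p) with (2 ^ p * (C * (h1 ^ p * M p) + h1 ^ p * M p * C)) by ring.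
        apply Rmult_le_compat_l; [lra|]. apply Rplus_le_compat.
        - rewrite Rmult_assoc. apply Rmult_le_compat_l; auto. apply Rmult_le_compat_r; lra.
        - mono. }
      assert (E3 : (2 * lam) ^ q <= h ^ q) by (apply pow_incr; split; [lra|apply Rmax_l]).
      assert (E4 : (2 * h1) ^ p <= h ^ p) by (apply pow_incr; split; [lra|apply Rmax_r]).
      apply Rle_trans with (h ^ q * (2 * C * h ^ p * M p)).
      + apply Rmult_le_compat; auto. { apply pow_le; lra. }
        apply Rle_trans with (1 := HDb). apply Rmult_le_compat_r; [lra|]. apply Rmult_le_compat_l; auto.
      + right. ring. }
  assert (HSB0 : S_BM (hat A) M (fun _ => RtoC 0)).
  { split; auto. exists (fun _ _ => RtoC 0). split.
    { split; auto. intros q x. apply (is_derive_RtoC (fun _ => 0)), @is_derive_const. }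
    exists 1, 0. split; [lra|]. intros p q x. rewrite Cmod_0. pos. }
  assert (Z := Hinj _ _ HSBM HSB0).
  assert (Hm : forall p, exists l, moment_is (fun x => RtoC (Phi 0%nat x)) p l /\ moment_is (fun _ => RtoC 0)
    p l).
  { intro p. exists (RtoC 0). split; [now apply zero_moments_moment_is|].
    apply (zero_moments_moment_is (fun _ => 0)), zero_moments_0. }
  specialize (Z Hm x0 Hx0). apply (f_equal Re) in Z. simpl in Z.
  (* The lower bound [c > 0] contradicts the value 0 at [x0] forced by injectivity. *)
  assert (K : c <= Phi 0%nat x0 <= C).
  { apply (casc_tower_between b f S1 (2 * C)); auto. intros y Hy. split.
    - apply Hfc. unfold S1 in Hy. lra.
    - apply Rle_trans with (1 := Rle_abs _). auto. }
  lra.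
Qed.

(** * The cycle of implications *)

Lemma bounded_or_div (u : nat -> R) : (forall n, 0 <= u n) ->
  ~ (exists B, forall n, sum_n u n <= B) -> is_lim_seq (sum_n u) p_infty.
Proof.
  intros Hu H.
  assert (Hi : forall n, sum_n u n <= sum_n u (S n)).
  { intro n. rewrite sum_Sn. unfold plus; simpl. specialize (Hu (S n)). lra. }
  destruct (ex_lim_seq_incr _ Hi) as [[l| |] Hl]; auto.
  - exfalso. apply H. exists l. intro n. now apply (is_lim_seq_incr_compare (sum_n u) l).
  - exfalso. apply is_lim_seq_spec in Hl. destruct (Hl 0) as [N HN]. specialize (HN N (Nat.le_refl N)).
    assert (0 <= sum_n u N); [|lra]. induction N; [rewrite sum_O; auto|].
    apply Rle_trans with (sum_n u 0); [rewrite sum_O; auto|]. clear IHN HN.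
    induction (S N); [lra|]. apply Rle_trans with (1 := IHn). auto.
Qed.

Lemma S_M_C_M M phi : S_M M phi -> C_M M phi.
Proof.
  intros [_ [Phi [[H0 Hd] [h [Hh HK]]]]]. split.
  - intros x _. apply (continuous_ext (Phi 0%nat)); auto.
    apply (@ex_derive_continuous R_AbsRing C_R_NormedModule). exists (Phi 1%nat x). apply Hd.
  - destruct (HK 0%nat) as [K HK0]. exists h, K. split; auto. intros p x Hx.
    rewrite <- H0. generalize (HK0 p x). rewrite Rabs_right; auto. pos.
Qed.

Lemma S_BM_S_M B M phi : S_BM B M phi -> S_M M phi.
Proof.
  intros [H0 [Phi [HT [h [K [Hh HK]]]]]]. split; auto. exists Phi. split; auto. exists h. split; auto.
  intro q. exists (K * h ^ q * B q). intros p x. apply Rle_trans with (1 := HK p q x). right. rewrite pow_add.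
  ring.
Qed.

Lemma moment_injective_sub (P Q : (R -> C) -> Prop) : (forall phi, P phi -> Q phi) ->
  moment_injective Q -> moment_injective P.
Proof. intros H HQ phi psi H1 H2. auto. Qed.

Theorem theorem3p8 (M A : nat -> R) :
  weight_seq M -> cond_sm M -> fact_incl M ->
  pos_seq A -> cond_nq A -> weight_seq (hat A) ->
  let i := is_lim_seq (sum_n (fun p => / sqrt (quot M p))) p_infty in
  (i <-> borel_injective (shift1 M)) /\
  (i <-> moment_injective (C_M M)) /\
  (i <-> moment_injective (S_M M)) /\
  (i <-> moment_injective (S_BM (hat A) M)).
Proof.
  intros HM Hsm _ HA Hnq _ i.
  assert (H12 : i -> borel_injective (shift1 M)) by now apply div_imp_borel_injective.
  assert (H23 := borel_injective_moment_injective M HM Hsm).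
  (* The spaces shrink from (iii) to (v), and injectivity passes to smaller spaces. *)
  assert (H34 := moment_injective_sub _ _ (S_M_C_M M)).
  assert (H45 := moment_injective_sub _ _ (S_BM_S_M (hat A) M)).
  assert (H51 : moment_injective (S_BM (hat A) M) -> i).
  { intro H. apply bounded_or_div.
    - intro n. left. apply Rinv_0_lt_compat, sqrt_lt_R0, quot_pos, HM.
    - now apply (moment_injective_not_summable M A). }
  tauto.
Qed.
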